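(* Let $\mathbb{K}$ be a field of characteristic zero, $d\in\mathbb{Z}$, and let $(A,\mu)$ be a (possibly infinite-dimensional) $A_\infty$-algebra over $\mathbb{K}$. Any degree $(d+1)$ pre-Calabi-Yau extension $\pi$ of $\mu$ makes the dual cyclic Hochschild complex $(Cyc^\bullet(A,\mathbb{K}),\delta_\mu)$ into a $\mathcal{H}olie_d$-algebra.
   Context: Conventions. Graded means $\mathbb{Z}$-graded with cohomological grading, $V[k]^i=V^{i+k}$; signs follow the Koszul rule. Put $D=d+1$. $\mathcal{H}olie_d$ is the minimal resolution of the operad $\mathcal{L}ie_d$ of Lie algebras with bracket of degree $1-d$: it is the dg free operad generated by corollas $c_n$, $n\ge2$, of degree $1+d-nd$, with $c_n\cdot\sigma=\mathrm{sgn}(\sigma)^d c_n$ for $\sigma\in\mathbb{S}_n$, and differential $\delta c_n=\sum_{S\subsetneq[n],\,\#S\ge2}\pm\,c_{[n]\setminus S\,\sqcup\{*\}}\circ_* c_S$ (standard signs; all equal to $-1$ if $d$ is even). $Cyc^\bullet(A,\mathbb{K})=\prod_{k\ge1}\mathrm{Hom}((A[1])^{\otimes k},\mathbb{K})_{\mathbb{Z}_k}$ and $C^\bullet_{[D]}(A)=\prod_{k\ge1}C^{(k)}_{[D]}(A)$, where $$C^{(k)}_{[D]}(A)=\Big(\prod_{n_1,\dots,n_k\ge0}\mathrm{Hom}\big(\textstyle\bigotimes_{i=1}^k(A[1])^{\otimes n_i},(A[2-D])^{\otimes k}\big)\Big)_{\mathbb{Z}_k}.$$ Elements of $Cyc^\bullet(A,\mathbb{K})\oplus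 C^\bullet_{[D]}(A)$ are viewed as cyclic words of letters: $k\ge0$ outputs (in $A[2-D]$) and input slots (for $A[1]$), with $n_i$ input slots between the $i$-th and $(i+1)$-st outputs; $Cyc^\bullet(A,\mathbb{K})$ is the part without outputs. The bracket $[F,G]$, of degree $1-D$, is the sum over all substitutions of one output of $F$ into one input of $G$, plus $(-1)^D$ times (with Koszul sign) the sum over all substitutions of one output of $G$ into one input of $F$, the remaining letters being arranged in the induced cyclic order; it is a degree shifted Lie bracket. A pre-Calabi-Yau structure of degree $D$ is $\pi\in C^\bullet_{[D]}(A)$ of degree $D$ with $[\pi,\pi]=0$; write $\pi=\sum_{k\ge1}\pi^{(k)}$ with $\pi^{(k)}\in C^{(k)}_{[D]}(A)$. An $A_\infty$-structure is a collection $\mu=\{\mu_n:(A[1])^{\otimes n}\to A[2]\}_{n\ge1}$ satisfying the usual equations, and $\pi$ is a pre-Calabi-Yau extension of $\mu$ if $\pi^{(1)}=\mu$. $\delta_\mu=[\mu,\cdot]$ is the Hochschild differential on $Cyc^\bullet(A,\mathbb{K})$. The structure meant: for $n\ge2$, the operation $c_n$ on $f_1,\dots,f_n\in Cyc^\bullet(A,\mathbb{K})$ is $\frac1n\sum_{\sigma\in\mathbb{S}_n}\mathrm{sgn}(\sigma)^d$ (with Koszul signs) times the sum of all cyclic words obtained by substituting the $n$ cyclically consecutive outputs of $\pi^{(n)}$ into one input each of $f_{\sigma(1)},\dots,f_{\sigma(n)}$ in this cyclic order, and reading the remaining inputs in the induced cyclic order. *)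

(* Defs.v *)
From HB Require Import structures.
From mathcomp Require Import all_boot all_order all_algebra all_fingroup.
From mathcomp Require Import generic_quotient.
From mathcomp.classical Require Import boolp functions.
From mathcomp Require Import finmap.
From mathcomp.multinomials Require Import monalg.

Set Implicit Arguments.
Unset Strict Implicit.
Unset Printing Implicit Defensive.

Import GRing.Theory.
Local Open Scope ring_scope.
Local Open Scope quotient_scope.

Definition ksgn (K : fieldType) (e : int) : K := (-1) ^ e.

(* all ways of cutting w into k consecutive, possibly empty, blocks *)
Fixpoint cuts (T : Type) (k : nat) (w : seq T) : seq (seq (seq T)) :=
  match k with
  | 0 => if w is [::] then [:: [::]] else [::]
  | k'.+1 => flatten [seq [seq take i w :: r | r <- cuts k' (drop i w)]
                     | i <- iota 0 (size w).+1]
  end.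

Section Submodules.
Variables (K : fieldType) (V : lmodType K).

Definition is_submod (P : V -> Prop) : Prop :=
  P 0 /\ forall (a : K) x y, P x -> P y -> P (a *: x + y).

Definition spanned (G : V -> Prop) (x : V) : Prop :=
  forall P : V -> Prop, is_submod P -> (forall y, G y -> P y) -> P x.

Lemma spanned_submod G : is_submod (spanned G).
Proof.
split=> [P [P0 _] _ //|a x y Gx Gy P HP GP].
by apply: HP.2; [exact: Gx|exact: Gy].
Qed.

End Submodules.

Section SubLmodule.
Variables (K : fieldType) (V : lmodType K) (P : V -> Prop) (hP : is_submod P).

Definition submod_pred of is_submod P : {pred V} := fun x => `[<P x>].

Lemma submod_predP : submod_closed (submod_pred hP).
Proof.
split; first by apply/asboolP; exact: hP.1.
by move=> a x y /asboolP Px /asboolP Py; apply/asboolP; exact: hP.2.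
Qed.

HB.instance Definition _ :=
  GRing.isSubmodClosed.Build K V (submod_pred hP) submod_predP.

Definition submod := {x : V | x \in submod_pred hP}.

HB.instance Definition _ := SubChoice.on submod.
HB.instance Definition _ := [SubChoice_isSubLmodule of submod by <:].

End SubLmodule.

Section Quotient.
Variables (K : fieldType) (V : lmodType K) (G : V -> Prop).

Definition quot_eq (x y : V) : bool := `[<spanned G (x - y)>].

Lemma quot_eq_equiv : equiv_class_of quot_eq.
Proof.
have [S0 Sl] := spanned_submod G.
split=> [x|x y|y x z].
- by apply/asboolP; rewrite subrr.
- by apply/asboolP/asboolP => h; rewrite -opprB -scaleN1r -[_ *: _]addr0; exact: Sl.
- move=> /asboolP h1 /asboolP h2; apply/asboolP.
  have -> : x - z = 1 *: (x - y) + (y - z) by rewrite scale1r addrA subrK.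
  exact: Sl.
Qed.

Canonical quot_equivRel := EquivRelPack quot_eq_equiv.
Definition quot := {eq_quot quot_eq}.
HB.instance Definition _ := Choice.on quot.

Definition cls (x : V) : quot := \pi_quot x.

Lemma clsP x y : cls x = cls y <-> spanned G (x - y).
Proof.
split=> [/eqP|h]; first by rewrite /cls eqmodE => /asboolP.
by apply/eqP; rewrite /cls eqmodE; apply/asboolP.
Qed.

Lemma cls_repr (x : quot) : cls (repr x) = x.
Proof. exact: reprK. Qed.

Lemma spanned_repr x : spanned G (repr (cls x) - x).
Proof. by apply/clsP; rewrite cls_repr. Qed.

Definition quot_add (x y : quot) := cls (repr x + repr y).
Definition quot_opp (x : quot) := cls (- repr x).
Definition quot_scale (a : K) (x : quot) := cls (a *: repr x).

Lemma quot_addE x y : quot_add (cls x) (cls y) = cls (x + y).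
Proof.
apply/clsP; have -> : repr (cls x) + repr (cls y) - (x + y)
  = 1 *: (repr (cls x) - x) + (repr (cls y) - y).
  by rewrite scale1r opprD addrACA.
by apply: (spanned_submod G).2; exact: spanned_repr.
Qed.

Lemma quot_scaleE a x : quot_scale a (cls x) = cls (a *: x).
Proof.
apply/clsP; rewrite -scalerBr -[_ *: _]addr0.
by apply: (spanned_submod G).2; [exact: spanned_repr|exact: (spanned_submod G).1].
Qed.

Lemma quot_oppE x : quot_opp (cls x) = cls (- x).
Proof. by rewrite -scaleN1r -quot_scaleE /quot_scale scaleN1r. Qed.

Fact quot_addA : associative quot_add.
Proof.
move=> x y z; rewrite -(cls_repr x) -(cls_repr y) -(cls_repr z).
by rewrite !quot_addE addrA.
Qed.
Fact quot_addC : commutative quot_add.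
Proof. by move=> x y; rewrite /quot_add addrC. Qed.
Fact quot_add0 : left_id (cls 0) quot_add.
Proof. by move=> x; rewrite -(cls_repr x) quot_addE add0r. Qed.
Fact quot_addN : left_inverse (cls 0) quot_opp quot_add.
Proof. by move=> x; rewrite -(cls_repr x) quot_oppE quot_addE addNr. Qed.

HB.instance Definition _ :=
  GRing.isZmodule.Build quot quot_addA quot_addC quot_add0 quot_addN.

Fact quot_scaleA a b x : quot_scale a (quot_scale b x) = quot_scale (a * b) x.
Proof. by rewrite -(cls_repr x) !quot_scaleE scalerA. Qed.
Fact quot_scale1 : left_id 1 quot_scale.
Proof. by move=> x; rewrite -(cls_repr x) quot_scaleE scale1r. Qed.
Fact quot_scaleDr : right_distributive quot_scale +%R.
Proof.
move=> a x y; rewrite -(cls_repr x) -(cls_repr y).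
by rewrite [cls _ + cls _]quot_addE !quot_scaleE [RHS]quot_addE scalerDr.
Qed.
Fact quot_scaleDl x : {morph quot_scale^~ x : a b / a + b}.
Proof.
by move=> a b; rewrite -(cls_repr x) !quot_scaleE [RHS]quot_addE scalerDl.
Qed.

HB.instance Definition _ := GRing.Zmodule_isLmodule.Build K quot
  quot_scaleA quot_scale1 quot_scaleDr quot_scaleDl.

Lemma cls_is_linear : linear cls.
Proof. by move=> a x y; rewrite -quot_addE -quot_scaleE. Qed.

HB.instance Definition _ := GRing.isLinear.Build K V quot *:%R cls cls_is_linear.

End Quotient.

Section Graded.
Variable K : fieldType.

(* A graded space is a family V : int -> lmodType K; [letter V] is the type of
   its homogeneous elements, with their degree [tag]. *)
Definition letter (V : int -> lmodType K) : Type := {i : int & V i}.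

HB.instance Definition _ (V : int -> lmodType K) :=
  Choice.copy (letter V) {i : int & (V i : choiceType)}.

Definition letter0 (V : int -> lmodType K) : letter V := Tagged V (0 : V 0).

Definition multilinear (V : int -> lmodType K) (W : lmodType K)
    (phi : seq (letter V) -> W) : Prop :=
  forall s1 s2 i (a : K) (x y : V i),
    phi (s1 ++ Tagged V (a *: x + y) :: s2)
    = a *: phi (s1 ++ Tagged V x :: s2) + phi (s1 ++ Tagged V y :: s2).

Lemma multilinear_submod V W : is_submod (@multilinear V W).
Proof.
split=> [s1 s2 i a x y|a f g hf hg s1 s2 i b x y]; first by rewrite scaler0 addr0.
rewrite !fctE hf hg !scalerDr !scalerA [b * a]mulrC -!addrA; congr (_ + _).
by rewrite addrCA.
Qed.

Section TensorAlgebra.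
Variable A : int -> lmodType K.

(* The direct sum of the tensor powers of A: the free module on words of
   homogeneous elements, modulo multilinearity. *)
Definition multilinear_rel (z : {malg K[seq (letter A)]}) : Prop :=
  exists (s1 s2 : seq (letter A)) (i : int) (a : K) (x y : A i),
    z = << s1 ++ Tagged A (a *: x + y) :: s2 >>
        - a *: << s1 ++ Tagged A x :: s2 >> - << s1 ++ Tagged A y :: s2 >>.

Definition tens : lmodType K := quot multilinear_rel.

Definition pure (w : seq (letter A)) : tens := cls multilinear_rel << w >>.

Section Lift.
Variables (W : lmodType K) (phi : seq (letter A) -> W).

Definition malg_lift (z : {malg K[seq (letter A)]}) : W :=
  \sum_(w <- msupp z) z@_w *: phi w.

(* The linear map on [tens] induced by phi; meaningful for multilinear phi. *)
Definition tlift (t : tens) : W := malg_lift (repr t).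

Lemma malg_liftE (E : {fset seq (letter A)}) z :
  (msupp z `<=` E)%fset -> malg_lift z = \sum_(w <- E) z@_w *: phi w.
Proof.
move=> zE; rewrite /malg_lift (big_fset_incl _ zE) // => w _ /mcoeff_outdom ->.
by rewrite scale0r.
Qed.

Lemma malg_lift_is_linear : linear malg_lift.
Proof.
move=> a x y; pose E := (msupp x `|` msupp y)%fset.
have xE : (msupp x `<=` E)%fset by exact: fsubsetUl.
have yE : (msupp y `<=` E)%fset by exact: fsubsetUr.
have sE : (msupp (a *: x + y) `<=` E)%fset.
  apply: fsubset_trans (msuppD_le _ _) _; rewrite fsubUset yE andbT.
  exact: fsubset_trans (msuppZ_le _ _) xE.
rewrite !(malg_liftE xE, malg_liftE yE, malg_liftE sE) scaler_sumr -big_split /=.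
by apply: eq_bigr => w _; rewrite mcoeffD mcoeffZ scalerDl scalerA.
Qed.

HB.instance Definition _ :=
  GRing.isLinear.Build K _ W *:%R malg_lift malg_lift_is_linear.

Lemma malg_liftU w : malg_lift << w >> = phi w.
Proof.
by rewrite /malg_lift msuppU oner_eq0 big_seq_fset1 mcoeffUU scale1r.
Qed.

Hypothesis phiL : multilinear phi.

Lemma malg_lift_rel z : spanned multilinear_rel z -> malg_lift z = 0.
Proof.
move/(_ (fun z => malg_lift z = 0)); apply.
  by split=> [|a x y hx hy]; rewrite ?linear0 // linearP /= hx hy scaler0 addr0.
move=> _ [s1 [s2 [i [a [x [y ->]]]]]].
by rewrite !linearB linearZ /= !malg_liftU phiL addrAC addrK addrN.
Qed.

Lemma tlift_cls z : tlift (cls multilinear_rel z) = malg_lift z.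
Proof.
apply/eqP; rewrite -subr_eq0 /tlift -linearB; apply/eqP.
by apply: malg_lift_rel; exact: spanned_repr.
Qed.

Lemma tlift_pure w : tlift (pure w) = phi w.
Proof. by rewrite tlift_cls malg_liftU. Qed.

Lemma tlift_is_linear : linear tlift.
Proof.
move=> a x y; rewrite -(cls_repr x) -(cls_repr y) -linearP !tlift_cls.
exact: linearP.
Qed.

End Lift.

End TensorAlgebra.

Section CyclicWords.
Variable A : int -> lmodType K.

(* degree of a in A[1] *)
Definition ideg (a : letter A) : int := tag a - 1.

(* degree of b in A[2 - D] *)
Definition odeg (D : int) (b : letter A) : int := tag b - (2 - D).

Definition wdeg (w : seq (letter A)) : int := \sum_(a <- w) ideg a.

Definition owdeg (D : int) (w : seq (letter A)) : int := \sum_(b <- w) odeg D b.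

(* The degree p part of \prod_(k >= 1) Hom((A[1])^{\otimes k}, K); the
   restriction of f to words of length k is the k-th component. *)
Definition is_cyc_cochain (p : int) (f : seq (letter A) -> K^o) : Prop :=
  [/\ multilinear f, f [::] = 0 & forall w, wdeg w + p != 0 -> f w = 0].

Lemma is_cyc_cochain_submod p : is_submod (is_cyc_cochain p).
Proof.
split=> [|a f g [fl f0 fd] [gl g0 gd]].
  by split=> //; exact: (multilinear_submod _ _).1.
split=> [||w hw]; first exact: (multilinear_submod _ _).2.
  by rewrite !fctE f0 g0 scaler0 addr0.
by rewrite !fctE fd // gd // scaler0 addr0.
Qed.

Definition cyc_cochain (p : int) : lmodType K := submod (is_cyc_cochain_submod p).

(* i-fold cyclic rotation of the letters, with its Koszul sign *)
Definition rotf (i : nat) (f : seq (letter A) -> K^o) (w : seq (letter A)) : K^o :=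
  ksgn K (wdeg (take i w) * wdeg (drop i w)) *: f (rot i w).

(* the sum over all ways of reading the cyclic word w from one of its letters *)
Definition cycsum (f : seq (letter A) -> K^o) (w : seq (letter A)) : K^o :=
  \sum_(i < size w) rotf i f w.

Definition cyc_rel (p : int) (z : cyc_cochain p) : Prop :=
  exists h : cyc_cochain p, forall w, val z w = val h w - rotf 1 (val h) w.

(* Cyc^p(A, K): the coinvariants of the cyclic groups *)
Definition Cyc (p : int) : lmodType K := quot (@cyc_rel p).

Definition cyc_cls (p : int) (f : cyc_cochain p) : Cyc p := cls (@cyc_rel p) f.

(* The degree p part of
     \prod_(k >= 1) \prod_(n_1, ..., n_k)
        Hom(\bigotimes_i (A[1])^{\otimes n_i}, (A[2-D])^{\otimes k}),
   evaluated on blocks us = [:: u_1; ...; u_k] with size u_i = n_i.  A term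
   b_1 ... b_k of F us stands for the word u_1 b_1 u_2 b_2 ... u_k b_k, and all
   Koszul signs are those of rearrangements of this word: the sign relating it
   to the order "inputs, then outputs" is absorbed in this identification, and
   is trivial for k = 1. *)
Definition is_C_cochain (D p : int) (F : seq (seq (letter A)) -> tens A) : Prop :=
  [/\ forall us1 us2, multilinear (fun u => F (us1 ++ u :: us2)),
      F [::] = 0
    & forall us, spanned (fun t => exists2 bs : seq (letter A),
          size bs = size us /\ owdeg D bs = wdeg (flatten us) + p
        & t = pure bs) (F us)].

Lemma is_C_cochain_submod D p : is_submod (is_C_cochain D p).
Proof.
split=> [|a F G [Fl F0 Fs] [Gl G0 Gs]]; split=> //.
- by move=> us1 us2; exact: (multilinear_submod _ _).1.
- by move=> us; exact: (spanned_submod _).1.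
- by move=> us1 us2; exact: (multilinear_submod _ _).2.
- by rewrite !fctE F0 G0 scaler0 addr0.
- by move=> us; exact: (spanned_submod _).2.
Qed.

Definition C_cochain (D p : int) : lmodType K := submod (is_C_cochain_submod D p).

(* rotation by the first i pairs (block, output), with its Koszul sign *)
Definition rotC (D : int) (i : nat) (F : seq (seq (letter A)) -> tens A)
    (us : seq (seq (letter A))) : tens A :=
  tlift (fun bs' => let bs := rotr i bs' in
      ksgn K ((wdeg (flatten (take i us)) + owdeg D (take i bs))
              * (wdeg (flatten (drop i us)) + owdeg D (drop i bs)))
      *: pure bs)
    (F (rot i us)).

(* the sum over all ways of reading the cyclic word from one of its blocks *)
Definition cycsumC (D : int) (F : seq (seq (letter A)) -> tens A)
    (us : seq (seq (letter A))) : tens A :=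
  \sum_(i < size us) rotC D i F us.

Definition C_rel (D p : int) (z : C_cochain D p) : Prop :=
  exists h : C_cochain D p, forall us, val z us = val h us - rotC D 1 (val h) us.

Definition C (D p : int) : lmodType K := quot (@C_rel D p).

Definition C_cls (D p : int) (F : C_cochain D p) : C D p := cls (@C_rel D p) F.

(* All substitutions of one output of F (of degree p) into one input of G (of
   degree q).  Read F as u_1 b_1 ... u_k b_k with b_k the output to be
   substituted, and G from the block v' x v'' containing the input x.  The
   result is the cyclic word
     v' u_1 b_1 u_2 ... b_{k-1} u_k v'' c_1 v_2 c_2 ... v_l c_l,
   which has k + l - 1 outputs.  The sign moves the substitution, of degree
   1 - D, together with F, past G and v'.  Below, the number of outputs of F is
   k.+1. *)
Definition insertion (D p q : int) (F G : seq (seq (letter A)) -> tens A)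
    (ws : seq (seq (letter A))) : tens A :=
  if ws is w1 :: ws' then
    \sum_(k < size ws) \sum_(i < (size w1).+1)
      let us0 := drop i w1 :: take k ws' in
      let z := nth [::] us0 k in
      let v' := take i w1 in
      \sum_(j < (size z).+1)
        let us := set_nth [::] us0 k (take j z) in
        let v'' := drop j z in
        ksgn K ((p + 1 - D) * (q + wdeg v')) *:
        tlift (fun bs => if size bs == k.+1 then
            tlift (fun cs => pure (take k bs ++ cs))
              (cycsumC D G ((v' ++ nth (letter0 A) bs k :: v'') :: drop k ws'))
          else 0)
        (cycsumC D F us)
  else 0.

Definition bracket (D p q : int) (F G : seq (seq (letter A)) -> tens A)
    (ws : seq (seq (letter A))) : tens A :=
  insertion D p q F G ws + ksgn K (D + p * q) *: insertion D q p G F ws.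

(* [pi, pi] = 0 in C, the bracket being computed on a representative of pi. *)
Definition is_preCY (D : int) (pi : C D D) : Prop :=
  exists2 F : C_cochain D D, C_cls F = pi &
  exists2 H : C_cochain D (D + D + (1 - D)),
    C_cls H = 0 & forall ws, val H ws = bracket D D D (val F) (val F) ws.

(* mu u q is the component of degree q (in A) of mu_n(u), n = size u. *)
Definition is_Ainfinity (mu : seq (letter A) -> forall q, A q) : Prop :=
  [/\ forall q, multilinear (fun u => mu u q),
      forall q, mu [::] q = 0,
      forall u q, q - 2 != wdeg u -> mu u q = 0
    & forall w q,
        \sum_(t <- cuts 3 w)
          (let u1 := nth [::] t 0 in let u2 := nth [::] t 1 in
           let u3 := nth [::] t 2 in
           ksgn K (wdeg u1)
           *: mu (u1 ++ Tagged A (mu u2 (wdeg u2 + 2)) :: u3) q) = 0].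

(* pi^(1) = mu; Z_1 being trivial, this does not depend on the representative. *)
Definition preCY_extends (D : int) (mu : seq (letter A) -> forall q, A q)
    (pi : C D D) : Prop :=
  exists2 F : C_cochain D D, C_cls F = pi &
    forall u, val F [:: u] = pure [:: Tagged A (mu u (wdeg u + 2))].

(* [mu, f] for f of degree p: as f has no outputs, only the output of mu can be
   substituted. *)
Definition hochschild (mu : seq (letter A) -> forall q, A q) (p : int)
    (f : seq (letter A) -> K^o) (w : seq (letter A)) : K^o :=
  if w is [::] then 0 else
  ksgn K p *: \sum_(i < (size w).+1)
    let u := take i w in
    cycsum f (Tagged A (mu u (wdeg u + 2)) :: drop i w).

End CyclicWords.

Section Holie.
Variables (d : int) (V : int -> lmodType K).

Definition vdeg (s : seq (letter V)) : int := \sum_(x <- s) tag x.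

(* degree of c_n applied to s, n = size s *)
Definition cdeg (s : seq (letter V)) : int :=
  vdeg s + (1 + d - (size s)%:Z * d).

Definition subseq_at (s : seq (letter V)) (S : {set 'I_(size s)}) : seq (letter V) :=
  [seq nth (letter0 V) s i | i : 'I_(size s) <- enum S].

Definition permute (s : seq (letter V)) (sigma : 'S_(size s)) : seq (letter V) :=
  [seq nth (letter0 V) s (sigma i) | i : 'I_(size s) <- enum 'I_(size s)].

(* exponent of sgn(sigma)^d times the Koszul sign of s |-> permute s sigma *)
Definition perm_sign (s : seq (letter V)) (sigma : 'S_(size s)) : int :=
  d *+ odd_perm sigma +
  \sum_(i < size s) \sum_(j < size s | (i < j)%N && (sigma j < sigma i)%N)
    tag (nth (letter0 V) s (sigma i)) * tag (nth (letter0 V) s (sigma j)).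

(* exponent of sgn^d times the Koszul sign of the unshuffle moving S to the front *)
Definition unshuffle_sign (s : seq (letter V)) (S : {set 'I_(size s)}) : int :=
  \sum_(i in ~: S) \sum_(j in S | (i < j)%N)
    (d + tag (nth (letter0 V) s i) * tag (nth (letter0 V) s j)).

Definition is_complex (delta : forall p, {linear V p -> V (p + 1)}) : Prop :=
  forall p (x : V p), delta (p + 1) (delta p x) = 0.

(* A Holie_d-algebra structure on the complex (V, delta), i.e. a morphism from
   the dg free operad Holie_d to the endomorphism operad; c s q is the component
   of degree q of c_n(s), n = size s >= 2.  For odd d, the sign
   (-1)^{d m (n - m)}, m = #|S|, is the one making the relations those of a
   square-zero coderivation of degree 1 on the symmetric coalgebra of V[d]. *)
Definition is_Holie (delta : forall p, {linear V p -> V (p + 1)})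
    (c : seq (letter V) -> forall q, V q) : Prop :=
  [/\ forall q, multilinear (fun s => c s q),
      forall s q, q != cdeg s -> c s q = 0,
      forall s q (sigma : 'S_(size s)),
        c (permute sigma) q = ksgn K (perm_sign sigma) *: c s q
    & forall s, (1 < size s)%N ->
        let n := size s in
        let q := cdeg s + 1 in
        delta (cdeg s) (c s (cdeg s))
        - ksgn K (1 + d - n%:Z * d) *:
          \sum_(i < n)
            (let x := nth (letter0 V) s i in
             ksgn K (vdeg (take i s)) *:
             c (set_nth (letter0 V) s i (Tagged V (delta (tag x) (tagged x)))) q)
        = - \sum_(S : {set 'I_n} | (1 < #|S| < n)%N)
              ksgn K (d * (#|S| * (n - #|S|))%N%:Z + unshuffle_sign S) *:
              c (Tagged V (c (subseq_at S) (cdeg (subseq_at S)))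
                 :: subseq_at (~: S)) q].

End Holie.

Section Operations.
Variables (d : int) (A : int -> lmodType K).

(* c_n(f_1, ..., f_n) on w.  For each sigma, w is cut into
   u_1 v_1 u_2 v_2 ... u_n v_n; pi^(n) gets the inputs u_1, ..., u_n, and its
   i-th output b_i is substituted in g_i = f_{sigma(i)}, whose remaining inputs
   are v_i.  The sums over the n ways of numbering the outputs of pi^(n)
   consecutively, and over the input slots of g_i, are those of cycsumC and
   cycsum.  The sign is the Koszul sign of
     pi, n pairings of degree -d, g_1, ..., g_n, u_1 v_1 ... u_n v_n
       |-> pi on u_1 b_1 ... u_n b_n, then the g_i on b_i v_i,
   each pairing being normalized by (-1)^{d(|b_i| + 1)}, |b_i| the degree in
   A[1]; for n = 1 this gives the sign of [mu, f]. *)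
Definition contraction (F : seq (seq (letter A)) -> tens A)
    (fs : seq (letter (cyc_cochain A))) (w : seq (letter A)) : K^o :=
  if w is [::] then 0 else
  let n := size fs in
  n%:R^-1 *: \sum_(sigma : 'S_n) ksgn K (perm_sign d sigma) *:
  \sum_(t <- cuts (n + n) w)
    let u i := nth [::] t i.*2 in
    let v i := nth [::] t i.*2.+1 in
    let g i := nth (letter0 (cyc_cochain A)) (permute sigma) i in
    tlift (fun bs =>
        if size bs == n then
          let b i := nth (letter0 A) bs i in
          ksgn K (\sum_(i < n)
             (d * (n - i.+1)%N%:Z * tag (g i) + tag (g i)
              + (d + tag (g i)) *
                (wdeg (flatten (take i.*2.+1 t)) + ideg (b i) + 1))) *:
          (\prod_(i < n) cycsum (val (tagged (g i))) (b i :: v i) : K^o)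
        else 0)
      (cycsumC (d + 1) F (mkseq u n)).

Definition letter_cls (x : letter (cyc_cochain A)) : letter (Cyc A) :=
  Tagged (Cyc A) (cyc_cls (tagged x)).

(* The conditions below include that the formulas define cochains and descend to
   coinvariants. *)
Definition is_hochschild_differential (mu : seq (letter A) -> forall q, A q)
    (delta : forall p, {linear Cyc A p -> Cyc A (p + 1)}) : Prop :=
  forall p (f : cyc_cochain A p), exists2 g : cyc_cochain A (p + 1),
    delta p (cyc_cls f) = cyc_cls g
    & forall w, val g w = hochschild mu p (val f) w.

Definition is_contraction (pi : C A (d + 1) (d + 1))
    (c : seq (letter (Cyc A)) -> forall q, Cyc A q) : Prop :=
  forall F : C_cochain A (d + 1) (d + 1), C_cls F = pi ->
  forall fs : seq (letter (cyc_cochain A)), (1 < size fs)%N ->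
  exists2 g : cyc_cochain A (cdeg d fs),
    c [seq letter_cls x | x <- fs] (cdeg d fs) = cyc_cls g
    & forall w, val g w = contraction (val F) fs w.

End Operations.
End Graded.

(* Main.v *)
Require Import Defs.
From HB Require Import structures.
From mathcomp Require Import all_boot all_order all_algebra all_fingroup.
From mathcomp Require Import generic_quotient zify ring.
From mathcomp.classical Require Import boolp functions.
From mathcomp Require Import finmap.
From mathcomp.multinomials Require Import monalg.

Set Implicit Arguments.
Unset Strict Implicit.
Unset Printing Implicit Defensive.

Import GRing.Theory.
Local Open Scope ring_scope.

(** Adjoin to the inputs of A the functionals on A. A cochain F with outputs
    becomes a cyclically invariant function on words of inputs and functionals,
    [ceval F], by pairing its outputs with the functionals of the word
    ([ceval_wordof]). An element of Cyc becomes a cyclically invariant function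
    which vanishes on the words with functionals, [HatC]; in characteristic zero
    this loses nothing ([cyc_cls_inj]). The substitution of an output of Phi into
    an input of Psi becomes the product [bul], which sums over the arcs b of a
    cyclic word and replaces b by the functional x |-> Psi (x b). So A may be
    infinite-dimensional: only functionals are ever needed, and outputs enter
    through the finite sums of condition [coch_rep].

    Let f and g have no outputs. Then the insertions of f and of g commute
    ([bul_comm]), because neither can read the functional made from the other, and
    the insertion of f is a derivation of the bracket ([brk_bul]). Hence the
    iterated insertions J Phi (f_1, ..., f_n) are higher derived brackets: they are
    graded symmetric, and inserting f_1, ..., f_n in the bracket of Phi with itself
    gives a sum over unshuffles (S, T) of brackets of J Phi S with J Phi T
    ([J_brk]). The equation [pi, pi] = 0 says that Phi . Phi = 0 for the function
    Phi of pi ([ceval_MC]). Read on words without functionals, the sum becomes the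
    quadratic relation on the operations J Phi ([maurer_cartan_relation]).

    It remains to recognise the terms. Expanding J Phi (f_1, ..., f_n) gives the sum
    over all configurations of n disjoint arcs of a cyclic word, one for each f_i.
    The formula for c_n lists the arcs in a linear order, starting after one of
    them, so its sum over rotations meets every configuration n times
    ([cyc_arcs], [contractionE]): this is the factor 1/n. The sums over permutations
    and subsets are turned into Koszul signed sums for the degrees shifted by d by
    the decalage signs ([sum_perm], [sum_subsets]). In the relation, the subsets S
    with 1 < #|S| < n give the compositions of two operations, the full set and
    the singletons give the Hochschild differential, which is the operation of
    arity one, and the empty set gives nothing because pi has no component without
    outputs ([cyc_op_Holie]). *)

(** * Signs, cuts and rotations of words *)

Definition parity (e : int) : bool := odd `|e|%N.

Lemma parityN a : parity (- a) = parity a.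
Proof. by rewrite /parity abszN. Qed.

Lemma parity_nat (n : nat) : parity n%:Z = odd n.
Proof. by []. Qed.

Lemma parityM a b : parity (a * b) = parity a && parity b.
Proof. by rewrite /parity abszM oddM. Qed.

Section Signs.
Variable K : fieldType.
Implicit Types (a b : int).

Lemma ksgnD a b : ksgn K (a + b) = ksgn K a * ksgn K b.
Proof. by rewrite /ksgn expfzDr // oppr_eq0 oner_eq0. Qed.

Lemma ksgnE a : ksgn K a = (-1) ^+ parity a.
Proof.
rewrite /ksgn /parity; case: a => n; first by rewrite -[LHS]signr_odd.
rewrite -[LHS]/(((-1) ^+ n.+1)^-1) -signr_odd -[absz (Negz n)]/n.+1.
by case: (odd _); rewrite ?invrN invr1.
Qed.
End Signs.

Lemma parityD a b : parity (a + b) = parity a (+) parity b.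
Proof.
have := ksgnD rat a b; rewrite !ksgnE.
by do 3 case: (parity _).
Qed.

Definition parityE := (parityD, parityN, parityM, parity_nat).

Section SignRules.
Variable K : fieldType.
(** Every comparison of signs below reduces to one of parities, which
    [parity_cases] settles by splitting on the parities of the atoms. *)
Lemma ksgn_eq a b : parity a = parity b -> ksgn K a = ksgn K b.
Proof. by rewrite !ksgnE => ->. Qed.
Lemma ksgn0 : ksgn K 0 = 1. Proof. by []. Qed.
Lemma ksgnN1 a x : - (ksgn K a * x) = ksgn K (a + 1) * x.
Proof. by rewrite ksgnD mulrN1 mulNr. Qed.
End SignRules.

Ltac parity_cases :=
  rewrite ?parityE /=;
  repeat match goal with |- context [parity ?x] => case: (parity x) => /= end;
  try by [].

Section Cuts.
Variables (T : Type) (K : fieldType).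
Implicit Types (w a b : seq T) (G H : seq T -> seq T -> K).

Definition cutsum w G : K := \sum_(k < (size w).+1) G (take k w) (drop k w).

Lemma cutsum_nil G : cutsum [::] G = G [::] [::].
Proof. by rewrite /cutsum big_ord1. Qed.

Lemma cutsum_cons x w G :
  cutsum (x :: w) G = G [::] (x :: w) + cutsum w (fun a b => G (x :: a) b).
Proof. by rewrite /cutsum big_ord_recl. Qed.

Lemma eq_cutsum w G H :
  (forall a b, w = a ++ b -> G a b = H a b) -> cutsum w G = cutsum w H.
Proof. by move=> e; apply: eq_bigr => k _; apply: e; rewrite cat_take_drop. Qed.

Lemma cutsum0 w : cutsum w (fun _ _ => 0) = 0.
Proof. by rewrite /cutsum big1. Qed.

Lemma cutsumD w G H :
  cutsum w (fun a b => G a b + H a b) = cutsum w G + cutsum w H.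
Proof. exact: big_split. Qed.

Lemma cutsumZ w c G : cutsum w (fun a b => c * G a b) = c * cutsum w G.
Proof. by rewrite /cutsum mulr_sumr. Qed.

Lemma cutsum_sum (I : Type) (r : seq I) w (G : I -> seq T -> seq T -> K) :
  cutsum w (fun a b => \sum_(i <- r) G i a b) = \sum_(i <- r) cutsum w (G i).
Proof. exact: exchange_big. Qed.

(** Both sides sum over the cuts of w into three consecutive words. *)
Lemma cutsumA w (G : seq T -> seq T -> seq T -> K) :
  cutsum w (fun x c => cutsum x (fun a b => G a b c))
  = cutsum w (fun a y => cutsum y (fun b c => G a b c)).
Proof.
elim: w G => [|x w IH] G; first by rewrite !cutsum_nil.
rewrite [LHS]cutsum_cons cutsum_nil [RHS]cutsum_cons [X in _ = X + _]cutsum_cons.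
rewrite -addrA; congr (_ + _).
rewrite -IH -cutsumD; apply: eq_cutsum => a b _.
by rewrite [LHS]cutsum_cons.
Qed.

Lemma cutsum_cat w1 x w2 G :
  cutsum (w1 ++ x :: w2) G
  = cutsum w1 (fun a b => G a (b ++ x :: w2))
    + cutsum w2 (fun a b => G (w1 ++ x :: a) b).
Proof.
elim: w1 G => [|y w1 IH] G; first by rewrite cutsum_nil /= cutsum_cons.
by rewrite /= [LHS]cutsum_cons IH [X in _ = X + _]cutsum_cons addrA.
Qed.

Lemma cutsum_rcons w x G :
  cutsum (rcons w x) G
  = cutsum w (fun a b => G a (rcons b x)) + G (rcons w x) [::].
Proof.
rewrite -cats1 cutsum_cat cutsum_nil; congr (_ + _).
by apply: eq_cutsum => a b _; rewrite cats1.
Qed.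

End Cuts.

Lemma cutsum_exch (T1 T2 : Type) (K : fieldType) (v : seq T1) (w : seq T2)
    (G : seq T1 -> seq T1 -> seq T2 -> seq T2 -> K) :
  cutsum v (fun a b => cutsum w (G a b))
  = cutsum w (fun x y => cutsum v (fun a b => G a b x y)).
Proof. exact: exchange_big. Qed.

Lemma cutsum_map (T1 T2 : Type) (K : fieldType) (f : T1 -> T2) (w : seq T1)
    (G : seq T2 -> seq T2 -> K) :
  cutsum (map f w) G = cutsum w (fun a b => G (map f a) (map f b)).
Proof.
elim: w G => [|x w IH] G; first by rewrite !cutsum_nil.
by rewrite /= !cutsum_cons IH.
Qed.

Section TrivialCuts.
Variables (T : Type) (K : fieldType).
Lemma cutsum_full (w : seq T) (F : seq T -> K) :
  cutsum w (fun x z => if z is [::] then F x else 0) = F w.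
Proof.
elim: w F => [|y w IH] F; first by rewrite cutsum_nil.
by rewrite cutsum_cons add0r IH.
Qed.
Lemma cutsum_empty (w : seq T) (F : seq T -> K) :
  cutsum w (fun x z => if x is [::] then F z else 0) = F w.
Proof.
case: w => [|y w]; first by rewrite cutsum_nil.
by rewrite cutsum_cons cutsum0 addr0.
Qed.
End TrivialCuts.

Section Cyclic.
Variables (T : Type) (K : fieldType) (deg : T -> int).
Implicit Types (w a b : seq T) (G : seq T -> K) (H : seq T -> seq T -> K).

(** The total degree of a word. Three kinds of words occur: words of inputs and
    functionals, words of blocks, and sequences of operands. *)
Definition wd_of w : int := foldr (fun x n => deg x + n) 0 w.

Arguments wd_of : simpl never.

Lemma wd_sum w : wd_of w = \sum_(x <- w) deg x.
Proof. by elim: w => [|x w IH]; rewrite ?big_nil ?big_cons -?IH. Qed.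
Lemma wd_nil : wd_of [::] = 0. Proof. by []. Qed.
Lemma wd_cons x w : wd_of (x :: w) = deg x + wd_of w. Proof. by []. Qed.
Lemma wd_cat a b : wd_of (a ++ b) = wd_of a + wd_of b.
Proof. by rewrite !wd_sum big_cat. Qed.
Lemma wd_rcons w x : wd_of (rcons w x) = wd_of w + deg x.
Proof. by rewrite -cats1 wd_cat wd_cons wd_nil addr0. Qed.
Definition wdE := (wd_nil, wd_cons, wd_rcons, wd_cat).

Definition rho i G w : K :=
  ksgn K (wd_of (take i w) * wd_of (drop i w)) * G (rot i w).

Definition cyc_of w G : K := \sum_(i < size w) rho i G w.

Lemma rho_cat a b G :
  rho (size a) G (a ++ b) = ksgn K (wd_of a * wd_of b) * G (b ++ a).
Proof. by rewrite /rho take_size_cat // drop_size_cat // rot_size_cat. Qed.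

Lemma rho1_cons x w G : rho 1 G (x :: w) = ksgn K (deg x * wd_of w) * G (rcons w x).
Proof. by rewrite /rho rot1_cons /= take0 drop0 wd_cons wd_nil addr0. Qed.

Lemma rho0 G w : rho 0 G w = G w.
Proof. by rewrite /rho take0 rot0 wd_nil mul0r mul1r. Qed.

Lemma rho_size G w : rho (size w) G w = G w.
Proof. by rewrite -{2}[w]cats0 rho_cat wd_nil mulr0 mul1r. Qed.

Lemma rhoD i j G w : (i + j <= size w)%N ->
  rho (i + j) G w = rho i (rho j G) w.
Proof.
move=> ij.
have ew : w = take i w ++ take j (drop i w) ++ drop (i + j) w.
  by rewrite addnC -drop_drop !cat_take_drop.
have si : size (take i w) = i.
  by rewrite size_takel // (leq_trans _ ij) // leq_addr.
have sj : size (take j (drop i w)) = j.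
  by rewrite size_takel // size_drop leq_subRL // (leq_trans _ ij) // leq_addr.
move: (take i w) (take j (drop i w)) (drop (i + j) w) ew si sj => a b c -> <- <-.
rewrite rho_cat -catA rho_cat mulrA -ksgnD catA -size_cat rho_cat -catA.
congr (_ * _); apply: ksgn_eq; rewrite !wd_cat; parity_cases.
Qed.

Lemma eq_cyc w G G' :
  (forall a b, w = a ++ b -> G (b ++ a) = G' (b ++ a)) -> cyc_of w G = cyc_of w G'.
Proof.
by move=> e; apply: eq_bigr => i _; rewrite /rho /rot e // cat_take_drop.
Qed.

Lemma cycD w G G' : cyc_of w (fun x => G x + G' x) = cyc_of w G + cyc_of w G'.
Proof. by rewrite -big_split; apply: eq_bigr => i _; rewrite /rho mulrDr. Qed.

Lemma cycZ w c G : cyc_of w (fun x => c * G x) = c * cyc_of w G.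
Proof. by rewrite /cyc_of mulr_sumr; apply: eq_bigr => i _; rewrite /rho mulrCA. Qed.

Lemma cyc0 w : cyc_of w (fun _ => 0) = 0.
Proof. by rewrite /cyc_of big1 // => i _; rewrite /rho mulr0. Qed.

Lemma cyc_sum (I : Type) (r : seq I) w (G : I -> seq T -> K) :
  cyc_of w (fun x => \sum_(i <- r) G i x) = \sum_(i <- r) cyc_of w (G i).
Proof.
rewrite /cyc_of exchange_big; apply: eq_bigr => i _ /=.
by rewrite /rho mulr_sumr.
Qed.

(** The rotations of w form a cycle: the last one, composed with one more, is
    the identity. *)
Lemma cyc_rho1 w G : cyc_of w (rho 1 G) = cyc_of w G.
Proof.
rewrite /cyc_of; case: w => [|x w]; first by rewrite !big_ord0.
set v := x :: w.
rewrite -[size v]/(size w).+1 [RHS]big_ord_recl big_ord_recr /= [RHS]addrC; congr (_ + _).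
  apply: eq_bigr => i _; rewrite -rhoD addn1 ?lift0 //.
  exact: leqW (ltn_ord i).
by rewrite -rhoD ?addn1 // rho0 -[(size w).+1]/(size v) rho_size.
Qed.

Lemma cyc_rho k w G : (k <= size w)%N -> cyc_of w (rho k G) = cyc_of w G.
Proof.
elim: k => [|k IH] kw.
  by apply: eq_cyc => a b _; rewrite rho0.
rewrite -IH ?(ltnW kw) // -[RHS]cyc_rho1; apply: eq_cyc => a b ew.
by rewrite -rhoD // add1n size_cat addnC -size_cat -ew.
Qed.

Lemma cyc_cat a b G : cyc_of (a ++ b) G = ksgn K (wd_of a * wd_of b) * cyc_of (b ++ a) G.
Proof.
have cyc_rot1 x w : cyc_of (x :: w) G = ksgn K (deg x * wd_of w) * cyc_of (rcons w x) G.
  rewrite -[LHS]cyc_rho1 /cyc_of size_rcons mulr_sumr; apply: eq_bigr => i _.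
  rewrite -rhoD ?addn1 // -add1n rhoD // {1}/rho rot1_cons /= take0 drop0.
  by rewrite wd_cons wd_nil addr0.
elim: a b => [|x a IH] b; first by rewrite cats0 wd_nil mul0r mul1r.
rewrite /= cyc_rot1 rcons_cat IH -cats1 -catA mulrA -ksgnD; congr (_ * _).
by apply: ksgn_eq; rewrite !wdE; parity_cases.
Qed.

Lemma cyc_rcons r x G :
  cyc_of (rcons r x) G
  = cutsum r (fun a b => ksgn K (wd_of a * wd_of (rcons b x)) * G (b ++ x :: a)).
Proof.
rewrite /cyc_of size_rcons; apply: eq_bigr => i _.
have ir : (i <= size r)%N by rewrite -ltnS.
rewrite /rho /rot -cats1 take_cat drop_cat.
case: ltngtP ir => // [ir|->] _; first by rewrite !cats1 -cat_rcons.
by rewrite subnn take0 drop0 take_size drop_size cats0.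
Qed.

(** A rotation followed by a cut is an ordered pair of complementary arcs of the
    cyclic word; the two arcs may exchange their roles. *)
Lemma cyc_swap w H :
  cyc_of w (fun v => cutsum v H)
  = cyc_of w (fun v => cutsum v (fun a b => ksgn K (wd_of a * wd_of b) * H b a)).
Proof.
have E (G : seq T -> seq T -> K) : cyc_of w (fun v => cutsum v G)
    = \sum_(k < (size w).+1) cyc_of w (fun v => G (take k v) (drop k v)).
  rewrite -cyc_sum; apply: eq_cyc => a b ->.
  by rewrite /cutsum !size_cat addnC.
rewrite !E [LHS](reindex_inj rev_ord_inj) /=; apply: eq_bigr => k _.
have kw : (k <= size w)%N by rewrite -ltnS.
rewrite -[LHS](cyc_rho _ kw) subSS.
move: (nat_of_ord k) kw => {}k kw; apply: eq_cyc => a b ew.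
rewrite /rho; congr (_ * _).
have sv : (size w = size (b ++ a))%N by rewrite ew !size_cat addnC.
set v := b ++ a in sv *.
have sd : (size w - k = size (drop k v))%N by rewrite size_drop sv.
by rewrite sd /rot take_size_cat // drop_size_cat.
Qed.

End Cyclic.

Arguments wd_of : simpl never.

Section KoszulSums.
Variables (T : Type) (K : fieldType) (hdeg : T -> int).
Local Notation hd := (wd_of hdeg).
Implicit Types (s fs : seq T).

(** The Koszul signed sum over all unshuffles (U, V) of s. The first entry joins
    U, or passes U to join V. *)
Fixpoint Msum (s : seq T) (G : seq T -> seq T -> K) : K :=
  if s is f :: s' then
    Msum s' (fun U V => G (f :: U) V + ksgn K (hdeg f * hd U) * G U (f :: V))
  else G [::] [::].

Lemma eq_Msum s G H : (forall U V, G U V = H U V) -> Msum s G = Msum s H.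
Proof.
elim: s G H => [|f s IH] G H e /=; first exact: e.
by apply: IH => U V; rewrite !e.
Qed.

Lemma MsumD s G H : Msum s (fun U V => G U V + H U V) = Msum s G + Msum s H.
Proof.
elim: s G H => //= f s IH G H; rewrite -IH; apply: eq_Msum => U V.
by rewrite mulrDr addrACA.
Qed.

Lemma MsumZ s c G : Msum s (fun U V => c * G U V) = c * Msum s G.
Proof.
elim: s G => //= f s IH G; rewrite -IH; apply: eq_Msum => U V.
by rewrite mulrDr mulrCA.
Qed.

Lemma Msum_swap s G :
  Msum s G = Msum s (fun U V => ksgn K (hd U * hd V) * G V U).
Proof.
elim: s G => [|f s IH] G /=; first by rewrite mul1r.
rewrite IH; apply: eq_Msum => U V.
rewrite mulrDr addrC !mulrA -!ksgnD; congr (_ * _ + _ * _).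
  by apply: ksgn_eq; rewrite !wd_cons; parity_cases.
by apply: ksgn_eq; rewrite !wd_cons; parity_cases.
Qed.

(** The Koszul signed sum over all reorderings: the first entry is inserted at
    every place of every reordering of the others. *)
Fixpoint Psum fs (G : seq T -> K) : K :=
  if fs is f :: fs' then
    Psum fs' (fun t => cutsum t (fun a b => ksgn K (hdeg f * hd a) * G (a ++ f :: b)))
  else G [::].

Lemma eq_Psum fs (G H : seq T -> K) :
  (forall t, size t = size fs -> G t = H t) -> Psum fs G = Psum fs H.
Proof.
elim: fs G H => [|f fs IH] G H e; first exact: e.
apply: IH => t st; apply: eq_cutsum => a b et; congr (_ * _); apply: e.
by rewrite size_cat /= addnS -size_cat -et st.
Qed.

Lemma PsumD fs (G H : seq T -> K) : Psum fs (fun t => G t + H t) = Psum fs G + Psum fs H.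
Proof.
elim: fs G H => //= f fs IH G H; rewrite -IH; apply: eq_Psum => t _.
by rewrite -cutsumD; apply: eq_cutsum => a b _; rewrite mulrDr.
Qed.

Lemma PsumZ fs c (G : seq T -> K) : Psum fs (fun t => c * G t) = c * Psum fs G.
Proof.
elim: fs G => //= f fs IH G; rewrite -IH; apply: eq_Psum => t _.
by rewrite -cutsumZ; apply: eq_cutsum => a b _; rewrite mulrCA.
Qed.

Lemma Psum0 fs : Psum fs (fun _ => 0) = 0.
Proof.
transitivity (0 * Psum fs (fun _ => 0)); last by rewrite mul0r.
by rewrite -PsumZ; apply: eq_Psum => t _; rewrite mul0r.
Qed.

Lemma Psum_sum (I : Type) (r : seq I) fs (G : I -> seq T -> K) :
  Psum fs (fun t => \sum_(i <- r) G i t) = \sum_(i <- r) Psum fs (G i).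
Proof.
elim: r => [|i r IH].
  by rewrite big_nil -[RHS](Psum0 fs); apply: eq_Psum => t _; rewrite big_nil.
by rewrite big_cons -IH -PsumD; apply: eq_Psum => t _; rewrite big_cons.
Qed.

(** Rotating all reorderings permutes them: when the first entry f ends up last,
    it comes from the front, and otherwise the others are rotated. *)
Lemma Psum_rho1 fs (G : seq T -> K) : Psum fs (rho hdeg 1 G) = Psum fs G.
Proof.
elim: fs G => [|f fs IH] G /=; first by rewrite /rho mul0r mul1r.
pose last_ t := ksgn K (hdeg f * hd t) * G (rcons t f).
pose init t := cutsum t (fun a b => ksgn K (hdeg f * hd a) * G (a ++ f :: b)) - last_ t.
rewrite [RHS](_ : _ = Psum fs init + Psum fs last_); last first.
  by rewrite -PsumD; apply: eq_Psum => t _; rewrite /init subrK.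
rewrite -[X in _ = X + _]IH -PsumD; apply: eq_Psum => -[|y t] _.
  rewrite cutsum_nil /rho /init cutsum_nil /last_ /= !wdE /=.
  by rewrite !(mulr0, mul0r, mul1r) subrr add0r.
rewrite cutsum_cons cat0s rho1_cons wd_nil mulr0 mul1r addrC; congr (_ + _).
rewrite rho1_cons /init cutsum_rcons /last_ cats1 addrK -cutsumZ.
apply: eq_cutsum => a b ->; rewrite cat_cons rho1_cons rcons_cat /= !mulrA -!ksgnD.
by congr (_ * _); apply: ksgn_eq; rewrite !wdE; parity_cases.
Qed.

Lemma Psum_rho fs k (G : seq T -> K) : (k <= size fs)%N ->
  Psum fs (rho hdeg k G) = Psum fs G.
Proof.
elim: k => [|k IH] kn; first by apply: eq_Psum => t _; rewrite rho0.
rewrite -IH ?(ltnW kn) // -[RHS]Psum_rho1; apply: eq_Psum => t st.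
by rewrite -rhoD ?add1n // st.
Qed.

(** The reorderings of f :: fs which are rotations of each other contribute
    equally to a cyclically invariant G, and one of them starts with f. *)
Lemma Psum_cyclic f fs (G : seq T -> K) :
  (forall a b, G (a ++ b) = ksgn K (hd a * hd b) * G (b ++ a)) ->
  Psum (f :: fs) G = (size fs).+1%:R * Psum fs (fun t => G (f :: t)).
Proof.
move=> cG; pose Gf t := G (f :: t).
transitivity (Psum fs (fun t => cyc_of hdeg t Gf + Gf t)).
  rewrite [LHS]/=; apply: eq_Psum => t _.
  transitivity (\sum_(k < (size t).+1) rho hdeg k Gf t); last first.
    by rewrite big_ord_recr /= rho_size.
  apply: eq_bigr => k _.
  rewrite /rho cG mulrA -ksgnD; congr (_ * _); apply: ksgn_eq.
  by rewrite !wd_cons; parity_cases.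
rewrite PsumD -[Psum fs Gf]/(Psum fs (fun t => Gf t)).
rewrite -natr1 mulrDl mul1r; congr (_ + _).
transitivity (Psum fs (fun t => \sum_(i < size fs) rho hdeg i Gf t)).
  by apply: eq_Psum => t st; rewrite /cyc_of st.
rewrite Psum_sum (eq_bigr (fun _ => Psum fs Gf)) => [|i _].
  by rewrite big_const_ord iter_addr_0 mulr_natl.
by apply: Psum_rho; exact: ltnW.
Qed.

End KoszulSums.

Section KoszulSumsMap.
Variables (T1 T2 : Type) (K : fieldType) (f : T1 -> T2) (h1 : T1 -> int) (h2 : T2 -> int).
Hypothesis hf : forall x, h2 (f x) = h1 x.

Lemma wd_map s : wd_of h2 (map f s) = wd_of h1 s.
Proof. by elim: s => // x s IH; rewrite /= !wd_cons IH hf. Qed.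

Lemma Psum_map s (G : seq T2 -> K) :
  Psum h2 (map f s) G = Psum h1 s (fun t => G (map f t)).
Proof.
elim: s G => //= x s IH G; rewrite IH; apply: eq_Psum => t _.
rewrite cutsum_map; apply: eq_cutsum => a b _.
by rewrite map_cat hf wd_map.
Qed.

Lemma Msum_map s (G : seq T2 -> seq T2 -> K) :
  Msum h2 (map f s) G = Msum h1 s (fun U V => G (map f U) (map f V)).
Proof.
elim: s G => //= x s IH G; rewrite IH; apply: eq_Msum => U V.
by rewrite hf wd_map.
Qed.

End KoszulSumsMap.

(** * Cyclic cochains and the insertion product *)

Section Insertions.
Variables (K : fieldType) (d : int) (A : int -> lmodType K).

(** A functional of degree e, where - e is the degree in A[2 - D], D = d + 1, of
    the letters on which it does not vanish. *)
Definition is_dual (e : int) (f : letter A -> K) : Prop :=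
  (forall i (c : K) (x y : A i),
      f (Tagged A (c *: x + y)) = c * f (Tagged A x) + f (Tagged A y))
  /\ (forall x, ideg x + e + d != 0 -> f x = 0).

Record dual : Type :=
  Dual { ddeg : int; dfun : letter A -> K; dualP : is_dual ddeg dfun }.

Lemma is_dual0 e : is_dual e (fun _ => 0).
Proof. by split=> // i c x y; rewrite mulr0 addr0. Qed.

(** The zero functional is a default value: [mkdual] is applied below to
    functions which are functionals as soon as the cochains involved are
    multilinear of the given degree. *)
Definition mkdual (e : int) (f : letter A -> K) : dual :=
  if pselect (is_dual e f) is left h then Dual h else Dual (is_dual0 e).

Lemma ddeg_mkdual e f : ddeg (mkdual e f) = e.
Proof. by rewrite /mkdual; case: pselect. Qed.

Lemma dfun_mkdual e f : is_dual e f -> dfun (mkdual e f) = f.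
Proof. by rewrite /mkdual; case: pselect. Qed.

(** The letters of a word are inputs, and functionals which stand for outputs. *)
Definition letterE : Type := (letter A + dual)%type.

Definition edeg (x : letterE) : int :=
  match x with inl a => ideg a | inr xi => ddeg xi end.

Local Notation word := (seq letterE).
Local Notation wd := (wd_of edeg).
Local Notation cyc := (cyc_of edeg).

Definition mlin (G : word -> K) : Prop :=
  forall s1 s2 i (c : K) (x y : A i),
    G (s1 ++ inl (Tagged A (c *: x + y)) :: s2)
    = c * G (s1 ++ inl (Tagged A x) :: s2) + G (s1 ++ inl (Tagged A y) :: s2).

(** Condition [coch_rep] says that a functional is only evaluated, at finitely
    many letters which depend on the rest of the word. It expresses that the
    outputs of a cochain lie in A rather than in its bidual, and so replaces
    duality when A has infinite dimension. *)
Record cyclic_cochain (p : int) (Phi : word -> K) : Prop := CyclicCochain {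
  coch_lin : mlin Phi;
  coch_deg : forall w, wd w + p != 0 -> Phi w = 0;
  coch_cyc : forall a b, Phi (a ++ b) = ksgn K (wd a * wd b) * Phi (b ++ a);
  coch_rep : forall a, exists l : seq (K * letter A), forall xi,
    Phi (rcons a (inr xi)) = \sum_(c <- l) c.1 * dfun xi c.2 }.

(** Cochains without outputs. *)
Definition plain (f : word -> K) : Prop := forall a xi b, f (a ++ inr xi :: b) = 0.

(** The functional which feeds its argument, followed by the arc b, to Psi. The
    sign is that of one factor of the contraction formula. *)
Definition dl (q : int) (Psi : word -> K) (b : word) : dual :=
  mkdual (wd b + q - d)
    (fun x => ksgn K (q + (d + q) * (ideg x + 1)) * Psi (inl x :: b)).

Lemma ddeg_dl q Psi b : ddeg (dl q Psi b) = wd b + q - d.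
Proof. exact: ddeg_mkdual. Qed.

(** The sum over the ends b of the word, each of which is read by Psi after an
    output of Phi. *)
Definition insert (q : int) (Phi Psi : word -> K) (w : word) : K :=
  cutsum w (fun a b =>
    ksgn K ((d + q) * wd a) * Phi (rcons a (inr (dl q Psi b)))).

(** The insertion product, a sum over all arcs of the cyclic word. *)
Definition bul (q : int) (Phi Psi : word -> K) (w : word) : K :=
  cyc w (insert q Phi Psi).

Definition wE := (wd_nil, wd_cons, wd_rcons, wd_cat, cat_rcons, ddeg_dl).

Section Dl.
Variables (q : int) (Psi : word -> K).
Hypotheses (lPsi : mlin Psi) (dPsi : forall w, wd w + q != 0 -> Psi w = 0).

Lemma dl_is_dual b : is_dual (wd b + q - d)
  (fun x => ksgn K (q + (d + q) * (ideg x + 1)) * Psi (inl x :: b)).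
Proof.
split=> [i c x y|x hx].
  by rewrite (lPsi [::]) mulrDr mulrCA.
rewrite dPsi ?mulr0 // wd_cons /=; apply: contra_neq hx => e; lia.
Qed.

Lemma dlE b x : dfun (dl q Psi b) x
  = ksgn K (q + (d + q) * (ideg x + 1)) * Psi (inl x :: b).
Proof. by rewrite dfun_mkdual //; exact: dl_is_dual. Qed.

Lemma dl_lin s1 s2 i (c : K) (x y : A i) z :
  dfun (dl q Psi (s1 ++ inl (Tagged A (c *: x + y)) :: s2)) z
  = c * dfun (dl q Psi (s1 ++ inl (Tagged A x) :: s2)) z
    + dfun (dl q Psi (s1 ++ inl (Tagged A y) :: s2)) z.
Proof. by rewrite !dlE -!cat_cons lPsi mulrDr mulrCA. Qed.

End Dl.

Lemma dl_plain q f b xi c : mlin f -> (forall w, wd w + q != 0 -> f w = 0) ->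
  plain f -> forall x, dfun (dl q f (b ++ inr xi :: c)) x = 0.
Proof. by move=> lf df pf x; rewrite dlE // -cat_cons pf mulr0. Qed.

Section Cochain.
Variables (p : int) (Phi : word -> K).
Hypothesis cPhi : cyclic_cochain p Phi.

(** On words of other degrees Phi vanishes, so signs need only be compared when
    the degrees match. *)
Lemma coch_sgn a b w :
  (wd w + p = 0 -> parity a = parity b) -> ksgn K a * Phi w = ksgn K b * Phi w.
Proof.
move=> h; have [e|ne] := eqVneq (wd w + p) 0; first by rewrite (ksgn_eq _ (h e)).
by rewrite (coch_deg cPhi ne) !mulr0.
Qed.

(** The finite lists of [coch_rep] may be chosen as a function of the word, with
    the letters of the only degree that contributes. *)
Lemma coch_repE : exists2 g : word -> seq (K * letter A),
  (forall a xi, Phi (rcons a (inr xi)) = \sum_(c <- g a) c.1 * dfun xi c.2)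
  & forall a c, c \in g a -> ideg c.2 = wd a + p - d.
Proof.
have [g hg] := choice (coch_rep cPhi).
exists (fun a => [seq c <- g a | ideg c.2 == wd a + p - d]) => [a xi|a c].
  rewrite big_filter; have [e|ne] := eqVneq (wd a + ddeg xi + p) 0.
    rewrite hg [LHS](bigID (fun c => ideg c.2 == wd a + p - d)) /=.
    rewrite [X in _ + X]big1 ?addr0 // => c hc; rewrite (dualP xi).2 ?mulr0 //.
    by apply: contra_neq hc => h; lia.
  rewrite (coch_deg cPhi) ?wd_rcons // big1 // => c /eqP hc.
  by rewrite (dualP xi).2 ?mulr0 //; apply: contra_neq ne => h; lia.
by rewrite mem_filter => /andP[/eqP].
Qed.

Lemma coch_rep_mid a b e : exists l : seq (K * letter A), forall xi,
  ddeg xi = e -> Phi (a ++ inr xi :: b) = \sum_(c <- l) c.1 * dfun xi c.2.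
Proof.
have [l hl] := coch_rep cPhi (b ++ a).
exists [seq (ksgn K ((wd a + e) * wd b) * c.1, c.2) | c <- l] => xi xie.
rewrite -cat_rcons (coch_cyc cPhi) -rcons_cat hl big_map mulr_sumr.
by apply: eq_bigr => c _; rewrite mulrA wd_rcons /= xie.
Qed.

Lemma coch_dual_lin a b c xi xi1 xi2 :
  ddeg xi1 = ddeg xi -> ddeg xi2 = ddeg xi ->
  (forall x, dfun xi x = c * dfun xi1 x + dfun xi2 x) ->
  Phi (a ++ inr xi :: b)
  = c * Phi (a ++ inr xi1 :: b) + Phi (a ++ inr xi2 :: b).
Proof.
move=> e1 e2 e; have [l hl] := coch_rep_mid a b (ddeg xi).
rewrite !hl // mulr_sumr -big_split; apply: eq_bigr => z _ /=.
by rewrite e mulrDr mulrCA.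
Qed.

Lemma coch_dual0 a b xi :
  (forall x, dfun xi x = 0) -> Phi (a ++ inr xi :: b) = 0.
Proof.
move=> h; have [l hl] := coch_rep_mid a b (ddeg xi).
by rewrite hl // big1 // => c _; rewrite h mulr0.
Qed.

End Cochain.

Lemma mlin_cutsum (G : word -> word -> K) :
  (forall b, mlin (fun a => G a b)) -> (forall a, mlin (G a)) ->
  mlin (fun w => cutsum w G).
Proof.
move=> G1 G2 s1 s2 i c x y; rewrite !cutsum_cat mulrDr addrACA -!cutsumZ -!cutsumD.
by congr (_ + _); apply: eq_cutsum => a b _; [rewrite G2|rewrite G1].
Qed.

(** Multilinearity is not obvious rotation by rotation, since the position of the
    distinguished letter moves; [cyc_cat] brings this letter to the end first. *)
Lemma mlin_cyc (G : word -> K) : mlin G -> mlin (fun w => cyc w G).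
Proof.
move=> G1 s1 s2 i c x y.
have E (z : A i) : cyc (s1 ++ inl (Tagged A z) :: s2) G
  = ksgn K ((wd s1 + (i - 1)) * wd s2)
    * cutsum (s2 ++ s1) (fun a b => ksgn K (wd a * (wd b + (i - 1)))
                           * G (b ++ inl (Tagged A z) :: a)).
  rewrite -cat_rcons cyc_cat wd_rcons -rcons_cat cyc_rcons; congr (_ * _).
  by apply: eq_cutsum => a b _; rewrite wd_rcons.
rewrite !E mulrCA -mulrDr; congr (_ * _).
rewrite -cutsumZ -cutsumD; apply: eq_cutsum => a b _.
by rewrite G1 mulrDr mulrCA.
Qed.

Lemma cyc_deg (G : word -> K) p : (forall w, wd w + p != 0 -> G w = 0) ->
  forall w, wd w + p != 0 -> cyc w G = 0.
Proof.
move=> h w hw; rewrite -(cyc0 K edeg w); apply: eq_cyc => a b ew; apply: h.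
by rewrite wd_cat addrC [wd b + _]addrC -wd_cat -ew addrC.
Qed.

Section Insert.
Variables (p q : int) (Phi Psi : word -> K).
Hypotheses (cPhi : cyclic_cochain p Phi).
Hypotheses (lPsi : mlin Psi) (dPsi : forall w, wd w + q != 0 -> Psi w = 0).

Lemma mlin_insert : mlin (insert q Phi Psi).
Proof.
apply: mlin_cutsum => [b|a] s1 s2 i c x y.
  rewrite !rcons_cat /= (coch_lin cPhi) mulrDr mulrCA.
  by rewrite !wd_cat !wd_cons.
rewrite -!cats1 (coch_dual_lin cPhi _ _ _ _ (dl_lin lPsi dPsi _ _ _ _ _)).
- by rewrite mulrDr mulrCA.
- by rewrite !ddeg_dl !wd_cat !wd_cons.
- by rewrite !ddeg_dl !wd_cat !wd_cons.
Qed.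

Lemma insert_deg w : wd w + (p + q - d) != 0 -> insert q Phi Psi w = 0.
Proof.
move=> hw; rewrite -(cutsum0 K w); apply: eq_cutsum => a b ew.
rewrite (coch_deg cPhi) ?mulr0 // wd_rcons /= ddeg_dl.
by apply: contra_neq hw => e; rewrite ew wd_cat; lia.
Qed.

Lemma mlin_bul : mlin (bul q Phi Psi).
Proof. exact: mlin_cyc mlin_insert. Qed.

Lemma bul_deg w : wd w + (p + q - d) != 0 -> bul q Phi Psi w = 0.
Proof. exact: cyc_deg insert_deg w. Qed.

(** The two parts of [bul_rcons]: the arc of the cyclic word r y which is fed to
    Psi avoids y, or contains it. *)
Definition insert_off (r : word) (t : word) : K :=
  cutsum r (fun x s => cutsum x (fun a v =>
    ksgn K ((d + q) * wd a) * Phi (a ++ inr (dl q Psi v) :: s ++ t))).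

Definition insert_over (r : word) (y : letterE) : K :=
  cutsum r (fun x s => cutsum s (fun a b =>
    ksgn K (wd x * (wd s + edeg y) + (d + q) * wd a)
    * Phi (rcons a (inr (dl q Psi (b ++ y :: x)))))).

Lemma bul_rcons r y :
  bul q Phi Psi (rcons r y) = insert_off r [:: y] + insert_over r y.
Proof.
rewrite /bul cyc_rcons addrC -cutsumD; apply: eq_cutsum => x s _.
rewrite /insert cutsum_cat mulrDr wd_rcons -!cutsumZ; congr (_ + _).
  by apply: eq_cutsum => a b _; rewrite mulrA -ksgnD.
apply: eq_cutsum => a v ->.
have -> z : rcons (s ++ y :: a) z = rcons s y ++ rcons a z.
  by rewrite cat_rcons rcons_cat.
rewrite (coch_cyc cPhi (rcons s y)) cat_rcons -cats1 mulrA -ksgnD mulrA -ksgnD.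
apply: (coch_sgn cPhi).
rewrite !wE /= ddeg_dl => /(congr1 parity); parity_cases.
Qed.
End Insert.

End Insertions.

(** * Two successive insertions *)

Section DoubleInsertions.
Variables (K : fieldType) (d : int) (A : int -> lmodType K).
Local Notation letterE := (@letterE K d A).
Local Notation edeg := (@edeg K d A).
Local Notation word := (seq letterE).
Local Notation wd := (wd_of edeg).
Local Notation cyc := (cyc_of edeg).
Local Notation cyclic_cochain := (@cyclic_cochain K d A).

(** Both Psi and Theta take an output of Phi, on disjoint arcs. *)
Definition disj (q r : int) (Phi Psi Theta : word -> K) (w : word) : K :=
  cyc w (fun w => cutsum w (fun x z => cutsum x (fun a u => cutsum z (fun a' v =>
    ksgn K ((d + r) * (wd x + wd a') + (d + q) * wd a)
    * Phi (a ++ inr (dl q Psi u) :: rcons a' (inr (dl r Theta v))))))).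

(** Theta takes an output of Psi, and Psi takes an output of Phi. *)
Definition enclosing (q r : int) (Phi Psi Theta : word -> K) (w : word) : K :=
  cyc w (fun w => cutsum w (fun c v =>
    ksgn K ((d + r) * wd c) * insert_over q Phi Psi c (inr (dl r Theta v)))).

Section Disj.
Variables (p q r : int) (Phi Psi Theta : word -> K).
Hypothesis cPhi : cyclic_cochain p Phi.

(** Rotations make the order of two disjoint arcs irrelevant. *)
Lemma disj_swap w :
  disj q r Phi Psi Theta w = ksgn K ((d + q) * (d + r)) * disj r q Phi Theta Psi w.
Proof.
rewrite /disj cyc_swap -cycZ; apply: eq_cyc => b0 a0 _; rewrite -cutsumZ.
apply: eq_cutsum => x z _; rewrite cutsum_exch -!cutsumZ.
apply: eq_cutsum => a u ->; rewrite -!cutsumZ; apply: eq_cutsum => a' v ->.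
rewrite -cat_rcons (coch_cyc cPhi) cat_rcons !mulrA -!ksgnD.
by apply: (coch_sgn cPhi); rewrite !wE /= !wE => /(congr1 parity); parity_cases.
Qed.

(** By [bul_rcons] for the functional made from Theta: the arc fed to Psi avoids
    it or contains it. *)
Lemma bul_bul w :
  bul r (bul q Phi Psi) Theta w = disj q r Phi Psi Theta w + enclosing q r Phi Psi Theta w.
Proof.
rewrite -cycD; apply: eq_cyc => b0 a0 _; move: (a0 ++ b0) => {a0 b0}w.
rewrite /insert.
under eq_cutsum => c v _ do rewrite (bul_rcons _ _ cPhi) mulrDr.
rewrite cutsumD; congr (_ + _).
under [RHS]eq_cutsum => x z _ do rewrite cutsum_exch.
rewrite -cutsumA; apply: eq_cutsum => c v _; rewrite -cutsumZ.
apply: eq_cutsum => x s ->; rewrite -cutsumZ; apply: eq_cutsum => a u _.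
by rewrite mulrA -ksgnD wd_cat cats1.
Qed.

(** A cochain without outputs cannot read the functional made from Theta. *)
Lemma bul_bul_plain w : mlin Psi -> (forall w, wd w + q != 0 -> Psi w = 0) ->
  plain Psi -> bul r (bul q Phi Psi) Theta w = disj q r Phi Psi Theta w.
Proof.
move=> lP dP pP; rewrite bul_bul [X in _ + X](_ : _ = 0) ?addr0 //.
rewrite /enclosing -(cyc0 K edeg w); apply: eq_cyc => b0 a0 _.
rewrite -(cutsum0 K (a0 ++ b0)); apply: eq_cutsum => c v _.
rewrite -[RHS](mulr0 (ksgn K ((d + r) * wd c))); congr (_ * _).
rewrite -(cutsum0 K c); apply: eq_cutsum => x s _.
rewrite -(cutsum0 K s); apply: eq_cutsum => a b _.
by rewrite -cats1 (coch_dual0 cPhi) ?mulr0 //; exact: dl_plain.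
Qed.

End Disj.

(** Insertions of cochains without outputs commute, as their arcs are always
    disjoint. *)
Lemma bul_comm p q r Phi f g w : cyclic_cochain p Phi ->
  cyclic_cochain q f -> plain f -> cyclic_cochain r g -> plain g ->
  bul r (bul q Phi f) g w
  = ksgn K ((d + q) * (d + r)) * bul q (bul r Phi g) f w.
Proof.
move=> cP cf pf cg pg.
rewrite (bul_bul_plain _ _ cP _ (coch_lin cf) (coch_deg cf) pf).
rewrite (bul_bul_plain _ _ cP _ (coch_lin cg) (coch_deg cg) pg).
exact: disj_swap cP w.
Qed.

Section BulPlain.
Variables (p r : int) (Phi f : word -> K).
Hypotheses (cPhi : cyclic_cochain p Phi) (cf : cyclic_cochain r f) (pf : plain f).

Lemma bul_rcons_plain s xi :
  bul r Phi f (rcons s (inr xi)) = insert_off r Phi f s [:: inr xi].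
Proof.
rewrite (bul_rcons _ _ cPhi) [X in _ + X](_ : _ = 0) ?addr0 //.
rewrite -(cutsum0 K s); apply: eq_cutsum => x t _.
rewrite -(cutsum0 K t); apply: eq_cutsum => a b _.
by rewrite -cats1 (coch_dual0 cPhi) ?mulr0 //; apply: dl_plain pf; case: cf.
Qed.

Lemma cyclic_cochain_bul : cyclic_cochain (p + r - d) (bul r Phi f).
Proof.
split.
- by apply: mlin_bul cPhi _ _; case: cf.
- by move=> w; exact: bul_deg.
- by move=> a b; exact: cyc_cat.
move=> s.
have [g hg _] := coch_repE cPhi.
exists (flatten [seq flatten [seq
   [seq (ksgn K ((d + r) * wd (take j (take k s))) * c.1, c.2)
     | c <- g (take j (take k s) ++ inr (dl r f (drop j (take k s))) :: drop k s)]
   | j <- iota 0 (size (take k s)).+1] | k <- iota 0 (size s).+1]) => xi.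
rewrite bul_rcons_plain big_flatten big_map /insert_off /cutsum.
rewrite -[iota 0 _]/(index_iota 0 (size s).+1) big_mkord; apply: eq_bigr => k _.
rewrite big_flatten big_map -[iota 0 _]/(index_iota 0 _.+1) big_mkord.
apply: eq_bigr => j _; rewrite big_map -cat_cons catA cats1 hg mulr_sumr.
by apply: eq_bigr => c _; rewrite mulrA.
Qed.

End BulPlain.

End DoubleInsertions.

(** * Inserting a cochain without outputs is a derivation *)

Section DerivationProperty.
Variables (K : fieldType) (d : int) (A : int -> lmodType K).
Local Notation letterE := (@letterE K d A).
Local Notation edeg := (@edeg K d A).
Local Notation word := (seq letterE).
Local Notation wd := (wd_of edeg).
Local Notation cyc := (cyc_of edeg).
Local Notation cyclic_cochain := (@cyclic_cochain K d A).
Implicit Types (a b c v w x y z : word).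

Section Both.
Variables (r : int) (f : word -> K).
Hypothesis cf : cyclic_cochain r f.
Hypothesis pf : plain f.

(** Here f takes an output of Phi and an output of Psi. The lists gPhi and gPsi
    are those of [coch_repE]; written with them, the term is symmetric in Phi
    and Psi, whereas a functional made from f would hide one of the two. *)
Definition both_term (p q : int) (gPhi gPsi : word -> seq (K * letter A))
    a b1 c b2 : K :=
  \sum_(i <- gPhi a) \sum_(j <- gPsi c)
    ksgn K ((d + p) * (d + q) + (d + p) * (d + r) + (d + q) * (d + r)
            + (ideg i.2 + wd b1) * (ideg j.2 + wd b2)
            + (ideg i.2 + wd b1) * (d + q))
    * (i.1 * j.1 * f (inl j.2 :: b2 ++ inl i.2 :: b1)).

Definition both p q gPhi gPsi w : K :=
  cyc w (fun w => cutsum w (fun x z => cutsum x (fun a b1 => cutsum z (fun c b2 =>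
    both_term p q gPhi gPsi a b1 c b2)))).

(** As for [disj_swap], rotations exchange the two arcs. *)
Lemma both_swap p q gPhi gPsi w :
  (forall a i, i \in gPhi a -> ideg i.2 = wd a + p - d) ->
  (forall a i, i \in gPsi a -> ideg i.2 = wd a + q - d) ->
  both p q gPhi gPsi w = ksgn K ((d + p) * (d + q)) * both q p gPsi gPhi w.
Proof.
move=> hPhi hPsi; rewrite /both cyc_swap -cycZ; apply: eq_cyc => b0 a0 _.
rewrite -cutsumZ; apply: eq_cutsum => z x _; rewrite cutsum_exch -!cutsumZ.
apply: eq_cutsum => c b2 ->; rewrite -!cutsumZ; apply: eq_cutsum => a b1 ->.
rewrite /both_term exchange_big [LHS]mulr_sumr [RHS]mulr_sumr; apply: eq_big_seq => j hj.
rewrite [LHS]mulr_sumr [RHS]mulr_sumr; apply: eq_big_seq => i hi.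
rewrite -[inl j.2 :: _]cat_cons (coch_cyc cf) cat_cons.
have lhsE s1 s2 s3 F : s1 * (s2 * (i.1 * j.1 * (s3 * F)))
  = i.1 * j.1 * ((s1 * s2 * s3) * F) by ring.
have rhsE s1 s2 F : s1 * (s2 * (j.1 * i.1 * F)) = i.1 * j.1 * ((s1 * s2) * F) by ring.
rewrite [LHS]lhsE [RHS]rhsE -!ksgnD; congr (_ * _).
apply: (coch_sgn cf); rewrite !wE /= (hPhi _ _ hi) (hPsi _ _ hj).
by move=> /(congr1 parity); parity_cases.
Qed.

(** The output of Phi is fed to an input of Psi or to an input of f, according to
    [bul_rcons] for this input. *)
Lemma bul_bul_r p q Phi Psi gPhi gPsi w :
  cyclic_cochain p Phi -> cyclic_cochain q Psi ->
  (forall a xi, Phi (rcons a (inr xi)) = \sum_(i <- gPhi a) i.1 * dfun xi i.2) ->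
  (forall a i, i \in gPhi a -> ideg i.2 = wd a + p - d) ->
  (forall a xi, Psi (rcons a (inr xi)) = \sum_(i <- gPsi a) i.1 * dfun xi i.2) ->
  (forall a i, i \in gPsi a -> ideg i.2 = wd a + q - d) ->
  bul (q + r - d) Phi (bul r Psi f) w
  = enclosing q r Phi Psi f w + both p q gPhi gPsi w.
Proof.
move=> cPhi cPsi gPhiE hPhi gPsiE hPsi.
set t := q + r - d; have cPf : cyclic_cochain t (bul r Psi f).
  exact: cyclic_cochain_bul cPsi cf pf.
rewrite /enclosing.
(* the first summand, with the arcs in the order of the left-hand side *)
pose off a b := cutsum b (fun z x => cutsum z (fun b1 v =>
  ksgn K ((d + r) * (wd a + wd b1) + (d + q) * wd a)
  * Phi (rcons a (inr (dl q Psi (b1 ++ inr (dl r f v) :: x)))))).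
rewrite [X in X + _](_ : _ = cyc w (fun w => cutsum w off)); last first.
  rewrite [RHS](_ : _ = cyc w (fun w => cutsum w (fun z x => cutsum z (fun s v =>
    cutsum s (fun a b1 => ksgn K ((d + r) * (wd a + wd b1) + (d + q) * wd a)
  * Phi (rcons a (inr (dl q Psi (b1 ++ inr (dl r f v) :: x))))))))); last first.
    apply: eq_cyc => b0 a0 _; rewrite /off -cutsumA; apply: eq_cutsum => z x _.
    by rewrite cutsumA.
  rewrite [RHS]cyc_swap; apply: eq_cyc => b0 a0 _.
  under eq_cutsum => c v _.
    rewrite /insert_over -cutsumZ.
    under eq_cutsum => x s ec do rewrite {1}ec wd_cat.
    over.
  rewrite cutsumA; apply: eq_cutsum => x z _; rewrite -cutsumZ.
  apply: eq_cutsum => s v ->; rewrite -!cutsumZ; apply: eq_cutsum => a b ->.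
  rewrite !mulrA -!ksgnD; apply: (coch_sgn cPhi); rewrite !wE /= !wE /= ddeg_dl.
  by move=> /(congr1 parity); parity_cases.
rewrite -cycD; apply: eq_cyc => b0 a0 _; move: (a0 ++ b0) => {a0 b0}w'.
rewrite cutsumA -cutsumD; apply: eq_cutsum => a b _.
pose u (l : letter A) := ksgn K ((d + t) * wd a + t + (d + t) * (ideg l + 1) + ideg l * wd b).
rewrite gPhiE mulr_sumr.
transitivity (\sum_(i <- gPhi a)
   i.1 * (u i.2 * insert_off r Psi f b [:: inl i.2])
   + \sum_(i <- gPhi a) i.1 * (u i.2 * insert_over r Psi f b (inl i.2))).
  rewrite -big_split; apply: eq_bigr => i _ /=.
  rewrite (dlE (coch_lin cPf) (coch_deg cPf)) -cat1s (coch_cyc cPf) cats1.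
  rewrite (bul_rcons _ _ cPsi) -!mulrDr !wE /= /u mulrCA; congr (_ * _).
  by rewrite !mulrA -!ksgnD; congr (ksgn K _ * _); rewrite addr0; ring.
congr (_ + _).
  rewrite /off /insert_off.
  under eq_bigr => i _ do rewrite -!cutsumZ.
  rewrite -cutsum_sum; apply: eq_cutsum => z x eb.
  under eq_bigr => i _ do rewrite -!cutsumZ.
  rewrite -cutsum_sum; apply: eq_cutsum => b1 v ez.
  rewrite gPhiE mulr_sumr; apply: eq_big_seq => i hi.
  rewrite (dlE (coch_lin cPsi) (coch_deg cPsi)) [RHS]mulrCA; congr (_ * _).
  rewrite -[_ :: _ ++ [:: _]]cat_cons catA (coch_cyc cPsi _ [:: _]) cat1s.
  rewrite /u !mulrA -!ksgnD; apply: (coch_sgn cPsi).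
  rewrite eb ez /t (hPhi _ _ hi) !wE /= ?wE /= ?(hPhi _ _ hi).
  by move=> /(congr1 parity); parity_cases.
rewrite /insert_over.
under eq_bigr => i _ do rewrite -!cutsumZ.
rewrite -cutsum_sum; apply: eq_cutsum => b1 z eb.
under eq_bigr => i _ do rewrite -!cutsumZ.
rewrite -cutsum_sum; apply: eq_cutsum => c b2 ez.
apply: eq_big_seq => i hi; rewrite gPsiE !mulr_sumr; apply: eq_big_seq => j hj.
rewrite (dlE (coch_lin cf) (coch_deg cf)).
have lhsE s1 s2 s3 F : i.1 * (s1 * (s2 * (j.1 * (s3 * F))))
  = i.1 * j.1 * ((s1 * s2 * s3) * F) by ring.
rewrite ?lhsE [RHS]mulrCA -!ksgnD.
congr (_ * _); apply: (coch_sgn cf).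
rewrite /u eb ez /t !wE /= ?wE /= (hPhi _ _ hi) (hPsi _ _ hj).
by move=> /(congr1 parity); parity_cases.
Qed.

End Both.

(** The bracket of cochains, of degrees p and q. *)
Definition brk (p q : int) (Phi Psi : word -> K) w : K :=
  bul q Phi Psi w - ksgn K ((d + p) * (d + q)) * bul p Psi Phi w.

(** The products are expanded into the configurations of Phi, Psi and f. Those of
    types [enclosing] and [disj] appear once on each side, the latter in different
    orders ([disj_swap]); those of type [both] only appear on the right, where
    they cancel ([both_swap]). *)
Lemma brk_bul p q r Phi Psi f w :
  cyclic_cochain p Phi -> cyclic_cochain q Psi -> cyclic_cochain r f -> plain f ->
  bul r (brk p q Phi Psi) f w
  = brk p (q + r - d) Phi (bul r Psi f) w
    + ksgn K ((d + q) * (d + r)) * brk (p + r - d) q (bul r Phi f) Psi w.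
Proof.
move=> cPhi cPsi cf pf.
have [gPhi gPhiE hPhi] := coch_repE cPhi; have [gPsi gPsiE hPsi] := coch_repE cPsi.
have -> : bul r (brk p q Phi Psi) f w = bul r (bul q Phi Psi) f w
    - ksgn K ((d + p) * (d + q)) * bul r (bul p Psi Phi) f w.
  rewrite -mulNr /bul -cycZ -cycD; apply: eq_cyc => b0 a0 _.
  rewrite /insert -cutsumZ -cutsumD; apply: eq_cutsum => a b _.
  by rewrite /brk mulrBr mulNr; congr (_ - _); rewrite mulrCA.
rewrite /brk (bul_bul _ _ _ _ cPhi) (bul_bul _ _ _ _ cPsi).
rewrite (bul_bul_r cf pf w cPhi cPsi gPhiE hPhi gPsiE hPsi).
rewrite (bul_bul_r cf pf w cPsi cPhi gPsiE hPsi gPhiE hPhi).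
rewrite (bul_bul_plain _ _ cPhi _ (coch_lin cf) (coch_deg cf) pf).
rewrite (bul_bul_plain _ _ cPsi _ (coch_lin cf) (coch_deg cf) pf).
rewrite (disj_swap _ _ _ _ cPhi) (disj_swap _ _ _ _ cPsi) (both_swap cf _ hPhi hPsi).
rewrite !ksgnE; parity_cases; ring.
Qed.

End DerivationProperty.

(** * Higher derived brackets *)

Section HigherBrackets.
Variables (K : fieldType) (d : int) (A : int -> lmodType K).
Local Notation letterE := (@letterE K d A).
Local Notation edeg := (@edeg K d A).
Local Notation word := (seq letterE).
Local Notation cyclic_cochain := (@cyclic_cochain K d A).
Implicit Types (w : word).

Definition is_input (x : letterE) : bool := if x is inl _ then true else false.

(** The component without outputs. *)
Definition restr (Phi : word -> K) w : K := if all is_input w then Phi w else 0.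

Lemma plain_restr Phi : plain (restr Phi).
Proof. by move=> a xi b; rewrite /restr all_cat /= andbF. Qed.

Lemma restr_cochain p Phi : cyclic_cochain p Phi -> cyclic_cochain p (restr Phi).
Proof.
move=> c; split=> [s1 s2 i k x y|w hw|a b|a].
- by rewrite /restr !all_cat /=; case: ifP => _; rewrite ?(coch_lin c) // mulr0 addr0.
- by rewrite /restr (coch_deg c hw) if_same.
- rewrite /restr !all_cat [X in _ = _ * (if X then _ else _)]andbC.
  by case: ifP => _; [exact: coch_cyc c _ _|rewrite mulr0].
- by exists [::] => xi; rewrite big_nil -cats1 plain_restr.
Qed.

(** On a word without functionals, no arc contains a functional. *)
Lemma bul_restr q Phi Psi w : all is_input w ->
  bul q Phi Psi w = bul q Phi (restr Psi) w.
Proof.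
move=> pw; apply: eq_cyc => b0 a0 ew; apply: eq_cutsum => a b eb.
have pb : all is_input b.
  by move: pw; rewrite ew all_cat andbC -all_cat eb all_cat => /andP[].
rewrite (_ : dl q (restr Psi) b = dl q Psi b) //.
by congr mkdual; apply/funext => x; rewrite /restr /= pb.
Qed.

Section BulLinear.
Variables (q : int).

Lemma bul_linl c Phi1 Phi2 Psi w :
  bul q (fun w => c * Phi1 w + Phi2 w) Psi w
  = c * bul q Phi1 Psi w + bul q Phi2 Psi w.
Proof.
rewrite /bul -cycZ -cycD; apply: eq_cyc => b0 a0 _.
rewrite /insert -cutsumZ -cutsumD; apply: eq_cutsum => a b _.
by rewrite mulrDr mulrCA.
Qed.

Lemma bul_linr p c Phi Psi Psi1 Psi2 w : cyclic_cochain p Phi ->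
  cyclic_cochain q Psi -> cyclic_cochain q Psi1 -> cyclic_cochain q Psi2 ->
  (forall w, Psi w = c * Psi1 w + Psi2 w) ->
  bul q Phi Psi w = c * bul q Phi Psi1 w + bul q Phi Psi2 w.
Proof.
move=> cP [l d0 _ _] [l1 d1 _ _] [l2 d2 _ _] e.
rewrite /bul -cycZ -cycD; apply: eq_cyc => b0 a0 _.
rewrite /insert -cutsumZ -cutsumD; apply: eq_cutsum => a b _.
rewrite mulrCA -mulrDr -!cats1; congr (_ * _); apply: (coch_dual_lin cP).
- by rewrite !ddeg_dl.
- by rewrite !ddeg_dl.
by move=> x; rewrite !dlE // e mulrDr mulrCA.
Qed.

End BulLinear.

Record pcoch : Type := PCoch {
  pdeg : int;
  pfun :> word -> K;
  pcochP : cyclic_cochain pdeg pfun;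
  pcoch_plain : plain pfun }.

Definition hdeg (f : pcoch) : int := d + pdeg f.
Local Notation hd := (wd_of hdeg).
Implicit Types (f g : pcoch) (fs S T : seq pcoch).

(** The iterated insertion (..((Phi . f_1) . f_2) ..) . f_n, a derived bracket of
    Phi with the f_i. *)
Definition J (Phi : word -> K) fs : word -> K :=
  foldl (fun Phi f => bul (pdeg f) Phi f) Phi fs.

(** The degree of [J Phi fs], for Phi of degree p. *)
Definition jdeg (p : int) fs : int := foldl (fun p f => p + pdeg f - d) p fs.

Lemma J_cochain p Phi fs : cyclic_cochain p Phi -> cyclic_cochain (jdeg p fs) (J Phi fs).
Proof.
elim: fs p Phi => //= f fs IH p Phi c; apply: IH.
by apply: cyclic_cochain_bul c (pcochP f) (pcoch_plain f).
Qed.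

Lemma J_rcons Phi fs f : J Phi (rcons fs f) = bul (pdeg f) (J Phi fs) f.
Proof. exact: foldl_rcons. Qed.

Lemma J_lin c Phi1 Phi2 fs w :
  J (fun w => c * Phi1 w + Phi2 w) fs w = c * J Phi1 fs w + J Phi2 fs w.
Proof.
elim: fs Phi1 Phi2 => //= f fs IH Phi1 Phi2; rewrite -IH; congr (J _ fs w).
by apply/funext => v; exact: bul_linl.
Qed.

Lemma bul0 q Psi w : bul q (fun _ => 0) Psi w = 0.
Proof.
rewrite -[RHS](cyc0 K edeg w); apply: eq_cyc => b0 a0 _.
by rewrite -[RHS](cutsum0 K (a0 ++ b0)); apply: eq_cutsum => a b _; rewrite mulr0.
Qed.

Lemma J0 fs w : J (fun _ => 0) fs w = 0.
Proof.
elim: fs => //= f fs IH; rewrite -[RHS]IH; congr (J _ fs w).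
by apply/funext => v; exact: bul0.
Qed.

Lemma J_Z c Phi fs w : J (fun w => c * Phi w) fs w = c * J Phi fs w.
Proof.
rewrite -[RHS]addr0 -[X in _ + X](J0 fs w) -J_lin; congr (J _ fs w).
by apply/funext => v; rewrite addr0.
Qed.

Section JPhi.
Variables (p : int) (Phi : word -> K).
Hypothesis cPhi : cyclic_cochain p Phi.

Lemma J_swap f g fs w :
  J Phi (f :: g :: fs) w = ksgn K (hdeg f * hdeg g) * J Phi (g :: f :: fs) w.
Proof.
rewrite /= -J_Z; congr (J _ fs w); apply/funext => v.
by rewrite (bul_comm _ cPhi (pcochP f) (@pcoch_plain f) (pcochP g) (@pcoch_plain g)).
Qed.

End JPhi.

Lemma J_move p Phi t1 f t2 w : cyclic_cochain p Phi ->
  J Phi (t1 ++ f :: t2) w = ksgn K (hdeg f * hd t1) * J Phi (f :: t1 ++ t2) w.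
Proof.
elim: t1 p Phi => [|g t1 IH] p Phi c; first by rewrite wd_nil mulr0 mul1r.
rewrite /= (IH _ _ (cyclic_cochain_bul c (pcochP g) (@pcoch_plain g))).
rewrite -[J _ (f :: _)]/(J Phi (g :: f :: t1 ++ t2)) (J_swap c) mulrA -ksgnD.
by congr (_ * _); apply: ksgn_eq; rewrite wd_cons; parity_cases.
Qed.

Lemma J_linr p Phi c f f1 f2 fs w : cyclic_cochain p Phi ->
  pdeg f1 = pdeg f -> pdeg f2 = pdeg f -> (forall w, f w = c * f1 w + f2 w) ->
  J Phi (f :: fs) w = c * J Phi (f1 :: fs) w + J Phi (f2 :: fs) w.
Proof.
move=> cP e1 e2 e; rewrite /= -J_lin; congr (J _ fs w); apply/funext => v.
rewrite e1 e2; apply: (bul_linr _ cP) => //; first exact: pcochP.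
  by rewrite -e1; exact: pcochP.
by rewrite -e2; exact: pcochP.
Qed.

Lemma parity_jdeg p fs : parity (d + jdeg p fs) = parity (d + p) (+) parity (hd fs).
Proof.
elim: fs p => [|f fs IH] p; first by rewrite wd_nil addbF.
rewrite /= IH wd_cons /hdeg; parity_cases.
Qed.

(** Iteration of the derivation property [brk_bul]: each f_i is inserted in one of
    the two entries of the bracket. *)
Lemma J_brk p q Phi Psi fs w : cyclic_cochain p Phi -> cyclic_cochain q Psi ->
  J (brk p q Phi Psi) fs w
  = Msum hdeg fs (fun S T => ksgn K ((d + q + hd S) * hd T)
      * brk (jdeg p T) (jdeg q S) (J Phi T) (J Psi S) w).
Proof.
elim: fs p q Phi Psi => [|f fs IH] p q Phi Psi cPhi cPsi.
  by rewrite /= wd_nil mulr0 mul1r.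
rewrite /= (_ : bul _ _ _ = fun w =>
  ksgn K ((d + q) * (d + pdeg f))
    * brk (p + pdeg f - d) q (bul (pdeg f) Phi f) Psi w
  + brk p (q + pdeg f - d) Phi (bul (pdeg f) Psi f) w); last first.
  apply/funext => v; rewrite addrC.
  exact: brk_bul cPhi cPsi (pcochP f) (@pcoch_plain f).
rewrite J_lin (IH _ _ _ _ (cyclic_cochain_bul cPhi (pcochP f) (@pcoch_plain f)) cPsi).
rewrite (IH _ _ _ _ cPhi (cyclic_cochain_bul cPsi (pcochP f) (@pcoch_plain f))).
rewrite addrC -MsumZ -MsumD; apply: eq_Msum => S T; rewrite !mulrA -!ksgnD.
by congr (_ * _ + _ * _); apply: ksgn_eq; rewrite !wd_cons /hdeg; parity_cases.
Qed.

Section MaurerCartan.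
Variables (p : int) (Phi : word -> K).
Hypotheses (cPhi : cyclic_cochain p Phi) (oddP : parity (d + p)).
Hypothesis MC : forall w, bul p Phi Phi w = 0.

Definition Jp S : pcoch :=
  PCoch (restr_cochain (J_cochain S cPhi)) (@plain_restr (J Phi S)).

(** The bracket of Phi with itself vanishes, hence so does the sum given by
    [J_brk]. On a word without functionals, each of the two terms of the bracket
    of [J Phi T] and [J Phi S] is again an iterated insertion, of the component
    without outputs of one into the other. The unshuffles (S, T) and (T, S) give
    the same terms, whence the factor 2 which is divided out. *)
Lemma maurer_cartan_relation fs w : 2%:R != 0 :> K -> all is_input w ->
  Msum hdeg fs (fun S T => J Phi (Jp S :: T) w) = 0.
Proof.
move=> two_neq0 pw; have := J_brk fs w cPhi cPhi.
have -> : brk p p Phi Phi = fun _ => 0.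
  by apply/funext => v; rewrite /brk !MC mulr0 subr0.
rewrite J0 /brk; under eq_Msum => S T.
  rewrite (bul_restr _ _ _ pw) [X in _ - _ * X](bul_restr _ _ _ pw).
  rewrite -[bul _ (J Phi T) _ w]/(bul (pdeg (Jp S)) (J Phi T) (Jp S) w) -J_rcons.
  rewrite -[bul _ (J Phi S) _ w]/(bul (pdeg (Jp T)) (J Phi S) (Jp T) w) -J_rcons.
  rewrite -!cats1 !(J_move _ _ _ _ cPhi) !cats0 mulrBr -mulNr.
  over.
rewrite MsumD [X in _ + X]Msum_swap -MsumD => /esym e.
apply: (mulfI two_neq0); rewrite mulr0 -[RHS]e -MsumZ; apply: eq_Msum => S T.
have hS := parity_jdeg p S; have hT := parity_jdeg p T.
rewrite !(mulNr, mulrN) !mulrA -!ksgnD.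
rewrite -[hdeg (Jp S)]/(d + jdeg p S).
have -> : ksgn K ((d + p + hd S) * hd T + (d + jdeg p S) * hd T) = 1.
  by rewrite -(ksgn0 K); apply: ksgn_eq; rewrite -mulrDl parityM parityD hS (parityD (d + p)) addbb.
rewrite (@ksgn_eq _ _ 1); first by rewrite mulN1r opprK mul1r mulr_natl.
by rewrite !(parityD _ (_ * _)) !parityM !hS !hT (parityD _ (hd _)) oddP; parity_cases.
Qed.

End MaurerCartan.

End HigherBrackets.

(** * Iterated insertion as a sum over arcs *)

Section Arcs.
Variables (K : fieldType) (d : int) (A : int -> lmodType K).
Local Notation dual := (@dual K d A).
Local Notation letterE := (@letterE K d A).
Local Notation edeg := (@edeg K d A).
Local Notation word := (seq letterE).
Local Notation wd := (wd_of edeg).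
Local Notation cyc := (cyc_of edeg).
Local Notation cyclic_cochain := (@cyclic_cochain K d A).
Local Notation pcoch := (@pcoch K d A).
Local Notation hdeg := (@hdeg K d A).
Local Notation hd := (wd_of hdeg).
Implicit Types (w : word) (f g : pcoch) (fs gs : seq pcoch) (G : word -> K).

(** The functional of an arc v fed to g; it has the degree [edl g] up to that of
    v. *)
Definition dlp g v : dual := dl (pdeg g) g v.

Definition edl g : int := pdeg g - d.
Local Notation ed := (wd_of edl).

Lemma parity_ed gs : parity (ed gs) = parity (hd gs).
Proof. by elim: gs => // g gs IH; rewrite !wd_cons /edl /hdeg !parityE IH; parity_cases. Qed.

(** The sum over all ways of replacing consecutive disjoint arcs of w, the last of
    which ends w, by the functionals of gs in this order, G being applied to the
    result. The sign moves each g to its arc, t being the degree of what precedes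
    w. *)
Fixpoint arcs gs (t : int) G w : K :=
  if gs is g :: gs' then
    cutsum w (fun x z => cutsum x (fun u v =>
      ksgn K (hdeg g * (t + wd u))
      * arcs gs' (t + wd x) (fun s => G (u ++ inr (dlp g v) :: s)) z))
  else if w is [::] then G [::] else 0.

Lemma eq_arcs gs t G G' w :
  (forall s, wd s = wd w + ed gs ->
     (if gs is [::] then s = [::] else exists s' xi, s = rcons s' (inr xi)) ->
     G s = G' s) ->
  arcs gs t G w = arcs gs t G' w.
Proof.
elim: gs t G G' w => [|g gs IH] t G G' w e /=.
  by case: w e => // e; apply: e.
apply: eq_cutsum => x z ew; apply: eq_cutsum => u v ex; congr (_ * _).
apply: IH => s es ls; apply: e.
  rewrite ew ex wd_cons !wd_cat wd_cons es /= ddeg_dl /edl; ring.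
case: gs es ls => [_ ->|g' gs' _ [s' [xi ->]]].
  by exists u, (dlp g v); rewrite cats1.
by exists (u ++ inr (dlp g v) :: s'), xi; rewrite rcons_cat.
Qed.

Lemma arcsD gs t G G' w :
  arcs gs t (fun s => G s + G' s) w = arcs gs t G w + arcs gs t G' w.
Proof.
elim: gs t G G' w => [|g gs IH] t G G' w /=; first by case: w; rewrite ?addr0.
rewrite -cutsumD; apply: eq_cutsum => x z _; rewrite -cutsumD.
by apply: eq_cutsum => u v _; rewrite IH mulrDr.
Qed.

Lemma arcsZ gs t c G w : arcs gs t (fun s => c * G s) w = c * arcs gs t G w.
Proof.
elim: gs t G w => [|g gs IH] t G w /=; first by case: w; rewrite ?mulr0.
rewrite -cutsumZ; apply: eq_cutsum => x z _; rewrite -cutsumZ.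
by apply: eq_cutsum => u v _; rewrite IH mulrCA.
Qed.

Lemma arcs0 gs t w : arcs gs t (fun _ => 0) w = 0.
Proof.
by have := arcsZ gs t 0 (fun _ => 0) w; under eq_fun do rewrite mul0r; move->; rewrite mul0r.
Qed.

Lemma arcs_sum (I : Type) (r : seq I) gs t (G : I -> word -> K) w :
  arcs gs t (fun s => \sum_(i <- r) G i s) w = \sum_(i <- r) arcs gs t (G i) w.
Proof.
elim: r => [|i r IH].
  by under eq_fun do rewrite big_nil; rewrite arcs0 big_nil.
by under eq_fun do rewrite big_cons; rewrite arcsD IH big_cons.
Qed.

Lemma arcs_cutsum gs t (v : word) (G : word -> word -> word -> K) w :
  arcs gs t (fun s => cutsum v (fun a b => G a b s)) w
  = cutsum v (fun a b => arcs gs t (G a b) w).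
Proof. exact: arcs_sum. Qed.

Lemma arcs_shift gs t t' G w :
  arcs gs (t + t') G w = ksgn K (t' * hd gs) * arcs gs t G w.
Proof.
elim: gs t G w => [|g gs IH] t G w /=; first by rewrite wd_nil mulr0 mul1r.
rewrite -cutsumZ; apply: eq_cutsum => x z _; rewrite -cutsumZ.
apply: eq_cutsum => u v _; rewrite [t + t' + wd x]addrAC IH !mulrA -!ksgnD; congr (_ * _).
by apply: ksgn_eq; rewrite wd_cons; parity_cases.
Qed.

Lemma arcs_rcons gs g t G w :
  arcs (rcons gs g) t G w = cutsum w (fun x y => cutsum y (fun u v =>
    ksgn K (hdeg g * (t + wd x + wd u))
    * arcs gs t (fun s => G (s ++ u ++ [:: inr (dlp g v)])) x)).
Proof.
elim: gs t G w => [|g' gs IH] t G w /=.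
  pose F w := cutsum w (fun u v =>
    ksgn K (hdeg g * (t + wd u)) * G (u ++ [:: inr (dlp g v)])).
  transitivity (F w).
    rewrite -(cutsum_full w F); apply: eq_cutsum => x [|y z] _ //.
    by rewrite -[RHS](cutsum0 K x); apply: eq_cutsum => u v _; rewrite mulr0.
  rewrite -(cutsum_empty w F); apply: eq_cutsum => [[|x0 x] z] _.
    by apply: eq_cutsum => u v _; rewrite wd_nil addr0.
  by rewrite -[LHS](cutsum0 K z); apply: eq_cutsum => u v _; rewrite mulr0.
pose H x x2 y := cutsum x (fun u' v' => cutsum y (fun u v =>
  ksgn K (hdeg g' * (t + wd u')) * (ksgn K (hdeg g * (t + wd x + wd x2 + wd u))
  * arcs gs (t + wd x) (fun s =>
      G (u' ++ inr (dlp g' v') :: s ++ u ++ [:: inr (dlp g v)])) x2))).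
transitivity (cutsum w (fun x z => cutsum z (fun x2 y => H x x2 y))).
  apply: eq_cutsum => x z _; rewrite cutsum_exch; apply: eq_cutsum => u' v' _.
  rewrite IH -cutsumZ; apply: eq_cutsum => x2 y _; rewrite -cutsumZ.
  by apply: eq_cutsum => u v _; rewrite ?addrA.
rewrite -cutsumA; apply: eq_cutsum => X y _.
under [RHS]eq_cutsum => u v _ do rewrite -cutsumZ.
rewrite cutsum_exch; apply: eq_cutsum => x x2 eX; rewrite /H cutsum_exch.
apply: eq_cutsum => u v _; rewrite -cutsumZ; apply: eq_cutsum => u' v' _.
rewrite mulrCA eX wd_cat !addrA; congr (_ * (_ * arcs _ _ _ _)).
by apply/funext => s; rewrite -catA.
Qed.

(** The configurations of arcs on a cyclic word may be read from any arc. *)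
Lemma arcs_rot p Psi g gs w : cyclic_cochain p Psi ->
  cyc w (arcs (g :: gs) 0 Psi)
  = ksgn K (hdeg g * hd gs) * cyc w (arcs (rcons gs g) 0 Psi).
Proof.
move=> cP; rewrite [LHS]cyc_swap -cycZ; apply: eq_cyc => b0 a0 _.
rewrite arcs_rcons -cutsumZ; apply: eq_cutsum => z x _; rewrite -!cutsumZ.
apply: eq_cutsum => u v ex; rewrite -/arcs arcs_shift.
rewrite (@eq_arcs gs 0 _ (fun s => ksgn K ((wd x + pdeg g - d) * (wd z + ed gs))
   * Psi (s ++ u ++ [:: inr (dlp g v)]))); last first.
  move=> s es _; rewrite -cat_rcons (coch_cyc cP) cats1; congr (_ * _).
  by rewrite wd_rcons es ex wd_cat /= ddeg_dl; congr ksgn; ring.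
rewrite arcsZ !mulrA -!ksgnD; congr (_ * _); apply: ksgn_eq.
rewrite ?parityE ?parity_ed /hdeg; parity_cases.
Qed.

Section InsertBefore.
Variables (p : int) (Psi : word -> K) (f : pcoch).
Hypothesis cPsi : cyclic_cochain p Psi.

(** The insertion of f in P s, on an arc of s which does not end s. If s ends with
    a functional, which f cannot read, these are all the arcs of f on the cyclic
    word s ([insert_before_last]). *)
Definition insert_before (P s : word) : K :=
  cutsum s (fun x a' => if a' is [::] then 0 else cutsum x (fun a v =>
    ksgn K (hdeg f * (wd P + wd a)) * Psi (P ++ a ++ inr (dlp f v) :: a'))).

Lemma insert_before_last s xi :
  bul (pdeg f) Psi f (rcons s (inr xi)) = insert_before [::] (rcons s (inr xi)).
Proof.
rewrite (bul_rcons_plain cPsi (pcochP f) (@pcoch_plain _ _ _ f)).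
rewrite /insert_before cutsum_rcons addr0; apply: eq_cutsum => x a' _.
have -> : rcons a' (inr xi) = a' ++ [:: inr xi] by rewrite cats1.
by case: a' => [|y a'] /=; apply: eq_cutsum => a v _; rewrite wd_nil add0r.
Qed.

Lemma insert_before_cat P u xi s :
  insert_before P (u ++ inr xi :: s)
  = cutsum u (fun x b => cutsum x (fun a v =>
      ksgn K (hdeg f * (wd P + wd a))
      * Psi (P ++ a ++ inr (dlp f v) :: b ++ inr xi :: s)))
    + insert_before (P ++ u ++ [:: inr xi]) s.
Proof.
rewrite /insert_before cutsum_cat; congr (_ + _).
  by apply: eq_cutsum => x [|y b].
apply: eq_cutsum => x a' _; case: a' => // y a'; move: (y :: a') => {y}a'.
rewrite cutsum_cat [X in X + _](_ : _ = 0) ?add0r.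
  apply: eq_cutsum => a v _; rewrite -!catA !cat_cons; congr (ksgn K (_ * _) * _).
  by rewrite !wd_cat !wd_cons wd_nil; ring.
rewrite -[RHS](cutsum0 K u); apply: eq_cutsum => a b _.
rewrite catA (coch_dual0 cPsi) ?mulr0 //; apply: dl_plain.
- exact: coch_lin (pcochP f).
- exact: coch_deg (pcochP f).
exact: pcoch_plain.
Qed.

(** The arc of f lies before one of the arcs of gs: the position of f in the
    sequence of arcs is arbitrary, except that it is not the last one. *)
Lemma arcs_insert_before gs t P w :
  arcs gs t (insert_before P) w
  = cutsum gs (fun a b => ksgn K (hdeg f * (hd a + wd P - t))
      * arcs (a ++ f :: b) t (fun s => Psi (P ++ s)) w)
    - ksgn K (hdeg f * (hd gs + wd P - t))
      * arcs (rcons gs f) t (fun s => Psi (P ++ s)) w.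
Proof.
elim: gs t P w => [|g gs IH] t P w.
  by rewrite cutsum_nil subrr; case: w => //=; rewrite /insert_before cutsum_nil.
rewrite cutsum_cons -addrA.
pose H y0 b v z := cutsum y0 (fun a v0 =>
  ksgn K (hdeg f * (wd P + wd a) + hdeg g * (t + wd y0 + wd b))
  * arcs gs (t + wd y0 + wd b + wd v)
      (fun s => Psi (P ++ a ++ inr (dlp f v0) :: b ++ inr (dlp g v) :: s)) z).
transitivity (cutsum w (fun x z => cutsum x (fun u v =>
      cutsum u (fun y0 b => H y0 b v z)))
  + cutsum w (fun x z => cutsum x (fun u v => ksgn K (hdeg g * (t + wd u))
      * arcs gs (t + wd x) (insert_before (P ++ u ++ [:: inr (dlp g v)])) z))).
  rewrite -cutsumD; apply: eq_cutsum => x z _; rewrite -cutsumD.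
  apply: eq_cutsum => u v ex; rewrite -/arcs.
  under [X in arcs _ _ X _]eq_fun => s do rewrite insert_before_cat.
  rewrite arcsD mulrDr arcs_cutsum -cutsumZ; congr (_ + _).
  apply: eq_cutsum => y0 b eu; rewrite arcs_cutsum -cutsumZ.
  apply: eq_cutsum => a v0 _; rewrite arcsZ mulrA -ksgnD ex eu !wd_cat !addrA.
  by congr (ksgn K _ * _); ring.
congr (_ + _).
  under eq_cutsum => x z _ do rewrite cutsumA.
  rewrite cutsumA /= -cutsumZ; apply: eq_cutsum => y0 z0 _.
  under eq_cutsum => x' z _ do rewrite cutsum_exch.
  rewrite cutsum_exch -cutsumZ; apply: eq_cutsum => a v0 _.
  rewrite -!cutsumZ; apply: eq_cutsum => x' z _.
  rewrite -!cutsumZ; apply: eq_cutsum => b v ex.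
  rewrite ex wd_cat !mulrA -!ksgnD !addrA; congr (_ * arcs _ _ _ _).
    by apply: ksgn_eq; rewrite wd_nil; parity_cases.
pose F x z u v fs := ksgn K (hdeg g * (t + wd u))
  * arcs fs (t + wd x) (fun s => Psi (P ++ u ++ inr (dlp g v) :: s)) z.
transitivity (cutsum w (fun x z => cutsum x (fun u v =>
    cutsum gs (fun a b => ksgn K (hdeg f * (hd (g :: a) + wd P - t))
                          * F x z u v (a ++ f :: b))
    + - ksgn K (hdeg f * (hd (g :: gs) + wd P - t)) * F x z u v (rcons gs f)))).
  apply: eq_cutsum => x z _; apply: eq_cutsum => u v ex.
  rewrite IH mulrBr -mulrN -mulNr -cutsumZ /F.
  have -> : (fun s => Psi ((P ++ u ++ [:: inr (dlp g v)]) ++ s))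
      = (fun s => Psi (P ++ u ++ inr (dlp g v) :: s)).
    by apply/funext => s; rewrite -!catA.
  congr (_ + _); last first.
    rewrite mulrCA mulNr -mulNr; congr (- _ * _); apply: ksgn_eq.
    by rewrite ex !wE /= ddeg_dl /hdeg; parity_cases.
  apply: eq_cutsum => a b _; rewrite mulrCA; congr (_ * _); apply: ksgn_eq.
  by rewrite ex !wE /= ddeg_dl /hdeg; parity_cases.
under eq_cutsum => x z _ do rewrite cutsumD cutsumZ cutsum_exch.
rewrite cutsumD cutsumZ mulNr cutsum_exch; congr (_ - _).
apply: eq_cutsum => a b _; rewrite -cutsumZ; apply: eq_cutsum => x z _.
by rewrite -cutsumZ.
Qed.

End InsertBefore.

(** Each configuration of arcs on a cyclic word is met once for each of its arcs,
    namely when the word is read from the end of this arc.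

    The induction inserts f first. In terms of n + 1 arcs, inserting f and then n
    arcs gives all their orders except those with f in the last position,
    by [arcs_insert_before]. By [Psum_cyclic] the latter make up one part in
    n + 1 of the sum over all orders, and the induction hypothesis accounts for a
    factor n. *)
Lemma cyc_arcs p Psi f fs w : cyclic_cochain p Psi ->
  (forall n, n.+1%:R != 0 :> K) ->
  cyc w (fun v => Psum hdeg (f :: fs) (fun t => arcs t 0 Psi v))
  = (size fs).+1%:R * J Psi (f :: fs) w.
Proof.
move=> cP n0; elim: fs f p Psi cP => [|g fs IH] f p Psi cP.
  rewrite mul1r /=; apply: eq_cyc => b0 a0 _.
  rewrite cutsum_nil wd_nil mulr0 mul1r /= /insert.
  pose F v := cutsum v (fun a b =>
    ksgn K (hdeg f * (0 + wd a)) * Psi (a ++ [:: inr (dlp f b)])).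
  transitivity (F (a0 ++ b0)).
    rewrite -cutsum_full; apply: eq_cutsum => x [|y z] _ //.
    by rewrite -[RHS](cutsum0 K x); apply: eq_cutsum => u v _; rewrite mulr0.
  by apply: eq_cutsum => a b _; rewrite add0r cats1.
have cPf := cyclic_cochain_bul cP (pcochP f) (@pcoch_plain _ _ _ f).
pose G t := cyc w (arcs t 0 Psi).
have cG a b : G (a ++ b) = ksgn K (hd a * hd b) * G (b ++ a).
  elim: a b => [|h a IHa] b; first by rewrite cats0 wd_nil mul0r mul1r.
  rewrite /G cat_cons (arcs_rot _ _ _ cP) rcons_cat -/(G (a ++ _)) IHa cat_rcons.
  rewrite mulrA -ksgnD; congr (_ * _); apply: ksgn_eq.
  by rewrite !wE; parity_cases.
have cycPsum fs' (H : seq pcoch -> word -> K) :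
    cyc w (fun v => Psum hdeg fs' (fun t => H t v)) = Psum hdeg fs' (fun t => cyc w (H t)).
  rewrite /cyc_of Psum_sum; apply: eq_bigr => i _.
  by rewrite /rho -PsumZ.
have cycG fs' : cyc w (fun v => Psum hdeg fs' (fun t => arcs t 0 Psi v)) = Psum hdeg fs' G.
  exact: cycPsum.
rewrite cycG (Psum_cyclic _ _ cG); congr (_ * _).
have := IH g _ _ cPf; rewrite -[J _ _ w]/(J Psi (f :: g :: fs) w) => e.
apply: (mulfI (n0 (size fs))); rewrite -e.
transitivity (cyc w (fun v => Psum hdeg (g :: fs) (fun t =>
    cutsum t (fun a b => ksgn K (hdeg f * hd a) * arcs (a ++ f :: b) 0 Psi v)
    + - ksgn K (hdeg f * hd t) * arcs (rcons t f) 0 Psi v))); last first.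
  apply: eq_cyc => b0 a0 _; apply: eq_Psum => t st.
  rewrite [RHS](@eq_arcs t 0 _ (insert_before Psi f [::])); last first.
    by move=> s _; case: t st => // h t _ [s' [xi ->]]; exact: insert_before_last cP _ _.
  rewrite (arcs_insert_before _ cP) wd_nil mulNr; congr (_ - _).
    by apply: eq_cutsum => a b _; rewrite subr0 addr0.
  by rewrite subr0 addr0.
pose last_ t := ksgn K (hdeg f * hd t) * G (rcons t f).
transitivity (Psum hdeg (f :: g :: fs) G - Psum hdeg (g :: fs) last_); last first.
    transitivity (cyc w (fun v => Psum hdeg (f :: g :: fs) (fun t => arcs t 0 Psi v)
      + Psum hdeg (g :: fs) (fun t => - ksgn K (hdeg f * hd t) * arcs (rcons t f) 0 Psi v))).
    rewrite cycD cycG cycPsum -mulN1r -PsumZ; congr (_ + _); apply: eq_Psum => t _.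
    by rewrite cycZ mulN1r mulNr.
  by apply: eq_cyc => b0 a0 _; apply: (esym (PsumD hdeg (g :: fs) _ _)).
rewrite (Psum_cyclic _ _ cG) -[(size (g :: fs)).+1%:R]natr1 mulrDl mul1r.
rewrite [X in _ + _ - X](_ : _ = Psum hdeg (g :: fs) (fun t => G (f :: t))) ?addrK //.
apply: eq_Psum => t _; rewrite /last_ -cats1 cG mulrA -ksgnD.
by rewrite (@ksgn_eq _ _ 0) ?mul1r // wd_cons wd_nil; parity_cases.
Qed.

End Arcs.

(** * Evaluation of outputs on functionals *)

Section Evaluation.
Variables (K : fieldType) (d : int) (A : int -> lmodType K).
Local Notation dual := (@dual K d A).
Local Notation letterE := (@letterE K d A).
Local Notation edeg := (@edeg K d A).
Local Notation word := (seq letterE).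
Local Notation wd := (wd_of edeg).
Local Notation cyc := (cyc_of edeg).
Local Notation inr := (@inr (letter A) dual).
Local Notation inl := (@inl (letter A) dual).
Implicit Types (w : word) (xs : seq dual) (xi : dual) (bs u : seq (letter A)).
Implicit Types (us : seq (seq (letter A))) (F : seq (seq (letter A)) -> tens A).

(** Extends phi, defined on products of letters, to tensors. *)
Definition tpair (phi : seq (letter A) -> K) (t : tens A) : K :=
  tlift (phi : seq (letter A) -> K^o) t.

Fixpoint pair xs bs : K :=
  match xs, bs with
  | [::], [::] => 1
  | xi :: xs', b :: bs' => dfun xi b * pair xs' bs'
  | _, _ => 0
  end.

Lemma pair_multilinear xs : multilinear (pair xs : seq (letter A) -> K^o).
Proof.
move=> s1 s2 i c x y; elim: xs s1 => [|xi xs IH] [|b s1] /=.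
- by rewrite scaler0 addr0.
- by rewrite scaler0 addr0.
- by rewrite (dualP xi).1 mulrDl -mulrA.
by rewrite IH mulrDr; congr (_ + _); rewrite /GRing.scale /= mulrCA.
Qed.

Lemma pair_size xs bs : size bs != size xs -> pair xs bs = 0.
Proof.
by elim: xs bs => [|xi xs IH] [|b bs] //= h; rewrite IH ?mulr0.
Qed.

Lemma pair_cat xs1 xs2 bs1 bs2 : size bs1 = size xs1 ->
  pair (xs1 ++ xs2) (bs1 ++ bs2) = pair xs1 bs1 * pair xs2 bs2.
Proof.
by elim: xs1 bs1 => [|xi xs IH] [|b bs] //= => [_|[h]]; rewrite ?mul1r // IH // mulrA.
Qed.

Lemma pair_rotr i xs bs : (i <= size xs)%N ->
  pair xs (rotr i bs) = pair (rot i xs) bs.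
Proof.
move=> ix; have [e|ne] := eqVneq (size bs) (size xs); last first.
  by rewrite !pair_size ?size_rotr ?size_rot.
rewrite -{2}[bs](rotrK i); move: (rotr i bs) (size_rotr i bs) => cs; rewrite e => ec.
rewrite /rot pair_cat ?size_drop ?ec // mulrC -pair_cat ?size_take ?ec //.
by rewrite !cat_take_drop.
Qed.

Lemma pair_deg xs bs : pair xs bs != 0 ->
  [seq odeg (d + 1) b | b <- bs] = [seq - ddeg xi | xi <- xs].
Proof.
elim: xs bs => [|xi xs IH] [|b bs] //=; rewrite ?eqxx //.
rewrite mulf_eq0 negb_or => /andP[h1 /IH ->]; congr (_ :: _).
have [e|ne] := eqVneq (ideg b + ddeg xi + d) 0.
  by rewrite /odeg; move: e; rewrite /ideg; lia.
by rewrite (dualP xi).2 ?eqxx in h1.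
Qed.

Lemma owdeg_sum D bs : owdeg D bs = \sum_(z <- [seq odeg D b | b <- bs]) z.
Proof. by rewrite big_map. Qed.

Definition xdeg xs : int := \sum_(xi <- xs) ddeg xi.

(** Outputs and functionals which pair non-trivially have opposite degrees. *)
Lemma pair_owdeg xs bs : pair xs bs != 0 -> owdeg (d + 1) bs = - xdeg xs.
Proof. by move=> /pair_deg h; rewrite owdeg_sum h big_map -sumrN. Qed.

Lemma pair_owdeg_take i xs bs : pair xs bs != 0 ->
  owdeg (d + 1) (take i bs) = - xdeg (take i xs).
Proof. by move=> /pair_deg h; rewrite owdeg_sum map_take h -map_take big_map -sumrN. Qed.

Lemma pair_owdeg_drop i xs bs : pair xs bs != 0 ->
  owdeg (d + 1) (drop i bs) = - xdeg (drop i xs).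
Proof. by move=> /pair_deg h; rewrite owdeg_sum map_drop h -map_drop big_map -sumrN. Qed.

Lemma tpairE phi t :
  tpair phi t = \sum_(bs <- msupp (repr t)) (repr t)@_bs * phi bs.
Proof. by []. Qed.

Lemma eq_tpair phi psi t : (forall bs, phi bs = psi bs) -> tpair phi t = tpair psi t.
Proof. by move=> e; rewrite !tpairE; apply: eq_bigr => bs _; rewrite e. Qed.

Lemma tpairZ c phi t : tpair (fun bs => c * phi bs) t = c * tpair phi t.
Proof. by rewrite !tpairE mulr_sumr; apply: eq_bigr => bs _; rewrite mulrCA. Qed.

Section TensorPairing.
Variable xs : seq dual.

Lemma tpair_is_linear : linear (tpair (pair xs) : tens A -> K^o).
Proof. exact: tlift_is_linear (pair_multilinear xs). Qed.

Lemma tpair_pure bs : tpair (pair xs) (pure bs) = pair xs bs.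
Proof. exact: (tlift_pure (pair_multilinear xs)). Qed.

Lemma tpair0 : tpair (pair xs) 0 = 0.
Proof. by have := tpair_is_linear (-1) 0 0; rewrite scaler0 add0r scaleN1r addNr. Qed.

Lemma tpairZr c t : tpair (pair xs) (c *: t) = c * tpair (pair xs) t.
Proof. by have := tpair_is_linear c t 0; rewrite addr0 tpair0 addr0. Qed.

Lemma tpairDr s t : tpair (pair xs) (s + t) = tpair (pair xs) s + tpair (pair xs) t.
Proof. by have := tpair_is_linear 1 s t; rewrite !scale1r. Qed.

Lemma tpair_sum (I : Type) (r : seq I) (f : I -> tens A) :
  tpair (pair xs) (\sum_(i <- r) f i) = \sum_(i <- r) tpair (pair xs) (f i).
Proof.
elim: r => [|i r IH]; first by rewrite !big_nil tpair0.
by rewrite !big_cons tpairDr IH.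
Qed.

Lemma tpair_tlift (phi : seq (letter A) -> tens A) t :
  tpair (pair xs) (tlift phi t) = tpair (fun bs => tpair (pair xs) (phi bs)) t.
Proof.
by rewrite tpair_sum tpairE; apply: eq_bigr => bs _; rewrite tpairZr.
Qed.

End TensorPairing.

(** A word ended by a functional is a sequence of blocks, each a word of inputs
    followed by a functional. *)
Definition block : Type := (seq (letter A) * dual)%type.
Implicit Types (z : seq block).

Definition wordof z : word := flatten [seq map inl p.1 ++ [:: inr p.2] | p <- z].

Lemma wordof_cons p z : wordof (p :: z) = map inl p.1 ++ inr p.2 :: wordof z.
Proof. by rewrite /wordof /= -catA. Qed.

Lemma wordof_cat z1 z2 : wordof (z1 ++ z2) = wordof z1 ++ wordof z2.
Proof. by rewrite /wordof map_cat flatten_cat. Qed.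

Lemma wordof_rcons z u xi : wordof (rcons z (u, xi)) = rcons (wordof z ++ map inl u) (inr xi).
Proof. by rewrite -!cats1 wordof_cat wordof_cons -catA. Qed.

Lemma wd_inl u : wd (map inl u) = wdeg u.
Proof. by rewrite wd_sum big_map. Qed.

Lemma wdeg_cat u1 u2 : wdeg (u1 ++ u2) = wdeg u1 + wdeg u2.
Proof. exact: big_cat. Qed.

Definition bdeg (p : block) : int := wdeg p.1 + ddeg p.2.

Lemma wd_bdeg z : wd_of bdeg z = wdeg (flatten (unzip1 z)) + xdeg (unzip2 z).
Proof.
elim: z => [|p z IH]; first by rewrite /wdeg /xdeg !big_nil.
rewrite wd_cons IH /bdeg /= wdeg_cat /xdeg big_cons; ring.
Qed.

Lemma wd_wordof z : wd (wordof z) = wd_of bdeg z.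
Proof.
elim: z => // p z IH.
by rewrite wordof_cons wd_cat !wd_cons IH wd_inl /bdeg addrA.
Qed.

Lemma wordofP w : exists z u, w = wordof z ++ map inl u.
Proof.
elim: w => [|[x|xi] w [z [u ->]]]; first by exists [::], [::].
  case: z => [|[v eta] z]; first by exists [::], (x :: u).
  by exists ((x :: v, eta) :: z), u.
by exists (([::], xi) :: z), u.
Qed.

(** The cuts of the first block of z2, or of the final word u if there is none. *)
Definition block_cut u z2 (H : word -> word -> K) : K :=
  if z2 is p :: z2' then
    cutsum (map inl p.1) (fun v v' => H v (v' ++ inr p.2 :: wordof z2' ++ map inl u))
  else cutsum (map inl u) H.

Lemma cutsum_wordof z u (H : word -> word -> K) :
  cutsum (wordof z ++ map inl u) H
  = cutsum z (fun z1 z2 => block_cut u z2 (fun v b => H (wordof z1 ++ v) b)).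
Proof.
elim: z H => [|p z IH] H; first by rewrite cutsum_nil.
rewrite wordof_cons -catA cat_cons cutsum_cat [RHS]cutsum_cons /=; congr (_ + _).
rewrite IH; apply: eq_cutsum => z1 z2 _; rewrite /block_cut wordof_cons.
by case: z2 => [|q z2]; apply: eq_cutsum => a b _; rewrite -catA.
Qed.

Lemma cutsum_last z u (H : word -> word -> K) :
  (forall a x v b, H (a ++ map inl (x :: v)) b = 0) ->
  cutsum (wordof z ++ map inl u) H
  = cutsum z (fun z1 z2 => H (wordof z1) (wordof z2 ++ map inl u)).
Proof.
move=> H0; rewrite cutsum_wordof; apply: eq_cutsum => z1 z2 _.
have E v (G : word -> word -> K) : (forall x v' b, G (map inl (x :: v')) b = 0) ->
    cutsum (map inl v) G = G [::] (map inl v).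
  move=> G0; rewrite cutsum_map; case: v => [|x v]; first by rewrite cutsum_nil.
  rewrite cutsum_cons -[RHS]addr0; congr (_ + _); rewrite -[RHS](cutsum0 K v).
  by apply: eq_cutsum => a b _; exact: G0.
have G0 x v b : H (wordof z1 ++ map inl (x :: v)) b = 0 by exact: H0.
case: z2 => [|p z2]; first by rewrite /block_cut E ?cats0.
rewrite /block_cut (E p.1 (fun v v' => H _ _)) ?cats0; first by rewrite wordof_cons -catA.
by move=> *; exact: H0.
Qed.

(** The value of F on the blocks of a word, its outputs being paired with the
    functionals which end the blocks; zero if the word does not end with a
    functional. The accumulators are the completed blocks, their functionals and
    the inputs of the current block. *)
Fixpoint eval_blocks F us xs u w : K :=
  match w with
  | [::] => if u is [::] then tpair (pair xs) (F us) else 0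
  | Datatypes.inl a :: w' => eval_blocks F us xs (rcons u a) w'
  | Datatypes.inr xi :: w' => eval_blocks F (rcons us u) (rcons xs xi) [::] w'
  end.

Definition eval F w : K := eval_blocks F [::] [::] [::] w.

(** Summing over rotations makes this cyclically invariant, and determines it on
    the words that do not end with a functional. *)
Definition ceval F w : K := cyc w (eval F).

Lemma eval_blocks_wordof F us xs z :
  eval_blocks F us xs [::] (wordof z)
  = tpair (pair (xs ++ unzip2 z)) (F (us ++ unzip1 z)).
Proof.
have E us' xs' u v w : eval_blocks F us' xs' u (map inl v ++ w)
    = eval_blocks F us' xs' (u ++ v) w.
  by elim: v u => [|a v IH] u /=; rewrite ?cats0 // IH cat_rcons.
elim: z us xs => [|[u xi] z IH] us xs; first by rewrite !cats0.
by rewrite wordof_cons E /= IH !cat_rcons.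
Qed.

Lemma eval_wordof F z : eval F (wordof z) = tpair (pair (unzip2 z)) (F (unzip1 z)).
Proof. exact: eval_blocks_wordof. Qed.

Lemma eval_last F a x v : eval F (a ++ map inl (x :: v)) = 0.
Proof.
have E us xs u y w : eval_blocks F us xs u (rcons w (inl y)) = 0.
  elim: w us xs u => [|[a'|xi] w IH] us xs u //=; by case: u.
rewrite lastI map_rcons -rcons_cat; exact: E.
Qed.

Lemma eval_deg F p w : is_C_cochain (d + 1) p F -> wd w + p != 0 -> eval F w = 0.
Proof.
move=> [_ F0 Fs] hw; have [z [u ew]] := wordofP w.
case: u ew => [|x u] ew; last by rewrite ew eval_last.
rewrite ew cats0 eval_wordof.
apply: (Fs (unzip1 z) (fun t => tpair (pair (unzip2 z)) t = 0)) => [|t [bs [_ e] ->]].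
  by split=> [|a t t' h h']; rewrite ?tpair0 // tpairDr tpairZr h h' mulr0 addr0.
rewrite tpair_pure; apply/eqP; apply: contraNT hw => /pair_owdeg ebs.
by rewrite ew cats0 wd_wordof wd_bdeg; apply/eqP; move: e; rewrite ebs; lia.
Qed.

Lemma eval_mlin F : (forall us1 us2, multilinear (fun u => F (us1 ++ u :: us2))) ->
  mlin (eval F).
Proof.
move=> Fl.
have E3 us1 us2 xs u1 u2 u w i c (x y : A i) :
    let e x := eval_blocks F (us1 ++ (u1 ++ x :: u2) :: us2) xs u w in
    e (Tagged A (c *: x + y)) = c * e (Tagged A x) + e (Tagged A y).
  elim: w us2 xs u => [|[a|xi] w IH] us2 xs u /=.
  - case: u => [|? ?]; last by rewrite mulr0 addr0.
    by rewrite (Fl _ _ _ _ _ _ _) tpairDr tpairZr.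
  - exact: IH.
  by rewrite !rcons_cat !rcons_cons; exact: IH.
have E2 us xs u1 u2 w i c (x y : A i) :
    let e x := eval_blocks F us xs (u1 ++ x :: u2) w in
    e (Tagged A (c *: x + y)) = c * e (Tagged A x) + e (Tagged A y).
  elim: w us u2 => [|[a|xi] w IH] us u2 /=.
  - by case: u1 => [|? ?] /=; rewrite mulr0 addr0.
  - by rewrite !rcons_cat !rcons_cons; exact: IH.
  by rewrite -!cats1; exact: E3.
suff E1 us xs u s1 s2 i c (x y : A i) :
    let e x := eval_blocks F us xs u (s1 ++ inl x :: s2) in
    e (Tagged A (c *: x + y)) = c * e (Tagged A x) + e (Tagged A y).
  by move=> s1 s2 i c x y; exact: E1.
elim: s1 us xs u => [|[a|xi] s1 IH] us xs u /=; try exact: IH.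
by rewrite -!cats1; exact: E2.
Qed.

Definition beval F z : K := tpair (pair (unzip2 z)) (F (unzip1 z)).

Lemma beval_rotC F i z : (i <= size z)%N ->
  beval (rotC (d + 1) i F) z = rho bdeg i (beval F) z.
Proof.
move=> iz; rewrite /beval /rotC tpair_tlift /rho.
have -> : unzip2 (rot i z) = rot i (unzip2 z) by exact: map_rot.
have -> : unzip1 (rot i z) = rot i (unzip1 z) by exact: map_rot.
rewrite -tpairZ; apply: eq_tpair => bs; rewrite tpairZr tpair_pure.
rewrite pair_rotr ?size_map //.
have [->|ne] := eqVneq (pair (rot i (unzip2 z)) bs) 0; first by rewrite !mulr0.
congr (_ * _); apply: ksgn_eq.
have ne' : pair (unzip2 z) (rotr i bs) != 0 by rewrite pair_rotr ?size_map.
rewrite (pair_owdeg_take _ ne') (pair_owdeg_drop _ ne') !wd_bdeg.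
rewrite /unzip1 /unzip2 !map_take !map_drop; parity_cases.
Qed.

(** Only the rotations which start at a block contribute. *)
Lemma ceval_cyc F z : ceval F (wordof z) = cyc_of bdeg z (beval F).
Proof.
case/lastP: z => [|z [u0 xi0]]; first by rewrite /ceval /cyc_of !big_ord0.
rewrite /ceval wordof_rcons !cyc_rcons cutsum_last; last first.
  by move=> a x v b; rewrite -cat_rcons catA eval_last mulr0.
apply: eq_cutsum => z1 z2 _; rewrite -wordof_rcons !wd_wordof.
by rewrite -cat_rcons -wordof_rcons -wordof_cat eval_wordof cat_rcons.
Qed.

(** Hence the evaluation on a word is that of the sum over cyclic readings of F
    on its blocks. *)
Lemma ceval_wordof F z :
  ceval F (wordof z) = tpair (pair (unzip2 z)) (cycsumC (d + 1) F (unzip1 z)).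
Proof.
rewrite ceval_cyc tpair_sum size_map; apply: eq_bigr => i _.
by rewrite -[RHS]/(beval _ z) beval_rotC // ltnW.
Qed.

End Evaluation.

(** * The Maurer-Cartan equation on words *)

Section EvaluatedInsertions.
Variables (K : fieldType) (d : int) (A : int -> lmodType K).
Local Notation dual := (@dual K d A).
Local Notation letterE := (@letterE K d A).
Local Notation edeg := (@edeg K d A).
Local Notation word := (seq letterE).
Local Notation wd := (wd_of edeg).
Local Notation cyclic_cochain := (@cyclic_cochain K d A).
Local Notation inr := (@inr (letter A) dual).
Local Notation inl := (@inl (letter A) dual).
Local Notation block := (@block K d A).
Local Notation D := (d + 1).
Implicit Types (w : word) (xs : seq dual) (xi : dual) (bs u v : seq (letter A)).
Implicit Types (us : seq (seq (letter A))) (F : seq (seq (letter A)) -> tens A).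
Implicit Types (z : seq block).

Lemma pair_rcons xs xi bs : pair (rcons xs xi) bs =
  if bs is b :: bs' then pair xs (belast b bs') * dfun xi (last b bs') else 0.
Proof.
case: bs => [|b bs]; first by case: xs.
have [e|ne] := eqVneq (size bs) (size xs); last first.
  by rewrite !pair_size ?mul0r ?size_belast ?size_rcons.
rewrite lastI -!cats1 pair_cat ?size_belast //=.
by rewrite mulr1.
Qed.

(** Condition [coch_rep] holds because a tensor is a finite sum: the last
    functional of the word is evaluated at the last letters of the products in
    it. *)
Lemma ceval_cochain p F : is_C_cochain D p F -> cyclic_cochain p (ceval F : word -> K).
Proof.
move=> cF; split.
- by apply: mlin_cyc; apply: eval_mlin; case: cF.
- by apply: cyc_deg => w; exact: eval_deg.
- by move=> a b; exact: cyc_cat.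
move=> a; have [z [u ->]] := wordofP a.
pose T := cycsumC D F (rcons (unzip1 z) u).
exists [seq ((repr T)@_bs * (if bs is b :: bs' then pair (unzip2 z) (belast b bs') else 0),
  (if bs is b :: bs' then last b bs' else letter0 A)) | bs <- enum_fset (msupp (repr T))] => xi.
rewrite -wordof_rcons ceval_wordof big_map tpairE.
have -> : unzip1 (rcons z (u, xi)) = rcons (unzip1 z) u by exact: map_rcons.
have -> : unzip2 (rcons z (u, xi)) = rcons (unzip2 z) xi by exact: map_rcons.
apply: eq_bigr => bs _; rewrite pair_rcons.
by case: bs => [|b bs]; rewrite /= ?mulr0 ?mul0r // mulrA.
Qed.

(** There are no components without outputs. *)
Lemma ceval_plain F x u : ceval F (map inl (x :: u)) = 0.
Proof.
rewrite /ceval -[RHS](cyc0 K edeg (map inl (x :: u))); apply: eq_cyc => a b e.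
have -> : b ++ a = map inl (drop (size a) (x :: u) ++ take (size a) (x :: u)).
  by rewrite map_cat map_drop map_take e drop_size_cat // take_size_cat.
case: (_ ++ _) (size_cat (drop (size a) (x :: u)) (take (size a) (x :: u))) => [|y v] s.
  by move: s; rewrite addnC -size_cat cat_take_drop.
by rewrite -[map _ _]cat0s eval_last.
Qed.

Lemma set_nth_rcons_last (T : Type) (x0 : T) n (s : seq T) x y :
  size s = n -> set_nth x0 (rcons s x) n y = rcons s y.
Proof. by move<-; elim: s => //= a s ->. Qed.

Section MC.
Variable F : seq (seq (letter A)) -> tens A.
Hypothesis cF : is_C_cochain D D F.
Let Phi : word -> K := ceval F.
Let cPhi : cyclic_cochain D Phi := ceval_cochain cF.

(** One substitution: the block of index [size z1] is cut into a, read by the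
    copy of F whose last output is substituted, and b', read by the other copy. *)
Lemma insertion_term z1 (a b' : seq (letter A)) (xk : dual) z3 v :
  tpair (pair (unzip2 z1 ++ xk :: unzip2 z3))
    (ksgn K ((D + 1 - D) * (D + wdeg v)) *: tlift (fun bs =>
      if size bs == (size z1).+1 then
        tlift (fun cs => pure (take (size z1) bs ++ cs))
          (cycsumC D F ((v ++ nth (letter0 A) bs (size z1) :: b') :: unzip1 z3))
      else 0) (cycsumC D F (rcons (unzip1 z1) a)))
  = ksgn K (wdeg v * wd (wordof z1 ++ map inl a ++ map inl b' ++ inr xk :: wordof z3))
    * (ksgn K ((d + D) * wd (wordof z1 ++ map inl a))
    * Phi (rcons (wordof z1 ++ map inl a)
        (inr (dl D Phi (map inl b' ++ inr xk :: wordof z3 ++ map inl v))))).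
Proof.
set b := map inl b' ++ inr xk :: wordof z3 ++ map inl v.
have -> : ksgn K (wdeg v
        * wd (wordof z1 ++ map inl a ++ map inl b' ++ inr xk :: wordof z3))
    * (ksgn K ((d + D) * wd (wordof z1 ++ map inl a))
    * Phi (rcons (wordof z1 ++ map inl a) (inr (dl D Phi b))))
  = ksgn K (wdeg v * D + (d + D) * (wd b + D + 1))
    * Phi (rcons (wordof z1 ++ map inl a) (inr (dl D Phi b))).
  rewrite !mulrA -!ksgnD; apply: (coch_sgn cPhi).
  rewrite wd_rcons /= ddeg_dl /b !wd_cat !wd_cons !wd_cat !wd_inl.
  by move=> /(congr1 parity); parity_cases.
rewrite -wordof_rcons [Phi (wordof _)]ceval_wordof tpairZr tpair_tlift -!tpairZ.
have -> : unzip1 (rcons z1 (a, dl D Phi b)) = rcons (unzip1 z1) a by exact: map_rcons.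
have -> : unzip2 (rcons z1 (a, dl D Phi b)) = rcons (unzip2 z1) (dl D Phi b).
  exact: map_rcons.
apply: eq_tpair => bs; case: eqP => [es|/eqP ne]; last first.
  by rewrite tpair0 pair_size ?mulr0 // size_rcons size_map.
case/lastP: bs es => [|bs c]; rewrite // size_rcons => -[es].
rewrite -es nth_rcons ltnn eqxx -cats1 take_size_cat // cats1 tpair_tlift.
rewrite -!cats1 pair_cat ?size_map //= mulr1.
rewrite (@eq_tpair _ _ _ (fun cs => pair (unzip2 z1) bs * pair (xk :: unzip2 z3) cs)).
  rewrite tpairZ -[tpair _ _]/(tpair (pair (unzip2 ((v ++ c :: b', xk) :: z3)))
    (cycsumC D F (unzip1 ((v ++ c :: b', xk) :: z3)))) -ceval_wordof.
  rewrite mulrCA [RHS]mulrCA; congr (_ * _).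
  rewrite (dlE (coch_lin cPhi) (coch_deg cPhi)) wordof_cons map_cat /=.
  rewrite -catA -[ceval F]/Phi (coch_cyc cPhi) /b !cat_cons -!catA !mulrA -!ksgnD.
  apply: (coch_sgn cPhi); rewrite !(wd_cat, wd_cons, wd_inl) /=.
  by move=> /(congr1 parity); parity_cases.
by move=> cs; rewrite tpair_pure pair_cat // size_map.
Qed.

(** The cut of the first block turns into a rotation of the word, and the cut of
    another block, or of the rest of the first, into that of [insert]. *)
Lemma insertion_eval u1 xi z :
  tpair (pair (xi :: unzip2 z)) (insertion D D D F F (u1 :: unzip1 z))
  = cutsum u1 (fun v v' => ksgn K (wdeg v * wd (map inl v' ++ inr xi :: wordof z))
      * insert D Phi Phi (map inl v' ++ inr xi :: wordof z ++ map inl v)).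
Proof.
rewrite /insertion exchange_big tpair_sum; apply: eq_bigr => i _.
move: (take i u1) (drop i u1) => v v'; rewrite tpair_sum.
have -> : map inl v' ++ inr xi :: wordof z ++ map inl v
    = wordof ((v', xi) :: z) ++ map inl v by rewrite wordof_cons -catA.
have -> : map inl v' ++ inr xi :: wordof z = wordof ((v', xi) :: z).
  by rewrite wordof_cons.
pose Z := (v', xi) :: z.
have -> : insert D Phi Phi (wordof Z ++ map inl v) = \sum_(k < size Z)
    block_cut v (drop k Z) (fun a b =>
      ksgn K ((d + D) * wd (wordof (take k Z) ++ a))
      * Phi (rcons (wordof (take k Z) ++ a) (inr (dl D Phi b)))).
  rewrite /insert cutsum_wordof /cutsum big_ord_recr /= -[(size z).+1]/(size Z).
  rewrite drop_size take_size /block_cut [X in _ + X](_ : _ = 0) ?addr0 //.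
  rewrite cutsum_map -[RHS](cutsum0 K v); apply: eq_cutsum => a b _.
  rewrite -cats1 (coch_dual0 cPhi) ?mulr0 // => x.
  rewrite (dlE (coch_lin cPhi) (coch_deg cPhi)) -[_ :: _]/(map inl (x :: b)).
  by rewrite /Phi ceval_plain mulr0.
rewrite mulr_sumr -[size (u1 :: unzip1 z)]/(size (unzip1 Z)) size_map.
apply: eq_bigr => -[k kz] _; rewrite [nat_of_ord _]/=.
have [z1 [[zk xk] [z3 [eZ sk]]]] :
    exists z1 p z3, (v', xi) :: z = z1 ++ p :: z3 /\ size z1 = k.
  exists (take k ((v', xi) :: z)), (nth (v', xi) ((v', xi) :: z) k), (drop k z).
  rewrite size_takel ?(ltnW kz) //; split=> //.
  by rewrite -[drop k z]/(drop k.+1 ((v', xi) :: z)) -drop_nth // cat_take_drop.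
subst k; have sk1 : size (unzip1 z1) = size z1 by rewrite size_map.
have e1 : v' :: take (size z1) (unzip1 z) = rcons (unzip1 z1) zk.
  rewrite -[_ :: _]/(take (size z1).+1 (unzip1 Z)) [Z]eZ /unzip1 map_cat /= -cat_rcons.
  by rewrite take_size_cat // size_rcons size_map.
have e2 : drop (size z1) (unzip1 z) = unzip1 z3.
  rewrite -[LHS]/(drop (size z1).+1 (unzip1 Z)) [Z]eZ /unzip1 map_cat /= -cat_rcons.
  by rewrite drop_size_cat // size_rcons size_map.
have e3 : xi :: unzip2 z = unzip2 z1 ++ xk :: unzip2 z3.
  by rewrite -[LHS]/(unzip2 Z) [Z]eZ /unzip2 map_cat.
rewrite e1 e2 e3 [Z]eZ nth_rcons sk1 ltnn eqxx take_size_cat // drop_size_cat //=.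
rewrite cutsum_map /cutsum mulr_sumr tpair_sum; apply: eq_bigr => j _.
rewrite (set_nth_rcons_last _ _ _ sk1) insertion_term; congr (ksgn K (_ * wd _) * _).
by rewrite eZ wordof_cat wordof_cons -[in RHS](cat_take_drop j zk) map_cat -catA.
Qed.

Hypothesis F_MC : forall w, ceval (insertion D D D F F) w = 0 :> K.

(** A rotation of a word starts inside a block; the sum over the rotations starting
    in a given block is the sum over its cuts in [insertion_eval]. *)
Lemma ceval_MC w : bul D Phi Phi w = 0.
Proof.
have [z [u ->]] := wordofP w; rewrite [LHS]cyc_cat; apply/eqP.
rewrite mulf_eq0; apply/orP; right; apply/eqP.
case: z => [|[u1 xi1] z].
  rewrite cats0 -[RHS](cyc0 K edeg (map inl u)); apply: eq_cyc => b0 a0 eu.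
  rewrite /insert -[RHS](cutsum0 K (a0 ++ b0)); apply: eq_cutsum => a b eab.
  rewrite -cats1 (coch_dual0 cPhi) ?mulr0 // => x.
  rewrite (dlE (coch_lin cPhi) (coch_deg cPhi)).
  have -> : b = map inl (drop (size a) (rot (size b0) u)).
    by rewrite map_drop map_rot eu rot_size_cat eab drop_size_cat.
  by rewrite -[_ :: _]/(map inl (x :: _)) /Phi ceval_plain mulr0.
have -> : map inl u ++ wordof ((u1, xi1) :: z) = wordof ((u ++ u1, xi1) :: z).
  by rewrite !wordof_cons map_cat -catA.
move: ((u ++ u1, xi1) :: z) => {u u1 xi1}z {w}.
case/lastP: z => [|z [u0 xi0]]; first by rewrite /bul /cyc_of big_ord0.
rewrite wordof_rcons /bul cyc_rcons.
have := F_MC (wordof (rcons z (u0, xi0))).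
rewrite /ceval wordof_rcons cyc_rcons cutsum_last; last first.
  by move=> a x v b; rewrite -cat_rcons catA eval_last mulr0.
move=> <-; rewrite cutsum_wordof; apply: eq_cutsum => z1 z2 _.
have E q y : wordof z2 ++ map inl u0 ++ inr xi0 :: wordof z1 = wordof (q :: y) ->
    eval (insertion D D D F F) ((wordof z2 ++ map inl u0) ++ inr xi0 :: wordof z1)
  = cutsum q.1 (fun v v' => ksgn K (wdeg v * wd (map inl v' ++ inr q.2 :: wordof y))
      * insert D Phi Phi (map inl v' ++ inr q.2 :: wordof y ++ map inl v)).
  by case: q => u1 xi1 e; rewrite -catA e eval_wordof -insertion_eval.
case: z2 E => [|[u1 xi1] z2] E.
  rewrite (E (u0, xi0) z1) ?wordof_cons // /block_cut cutsum_map -cutsumZ.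
  apply: eq_cutsum => v v' eu; rewrite mulrA -ksgnD -?catA ?cat_cons; congr (_ * _).
  apply: ksgn_eq; rewrite eu !(wd_rcons, wd_cat, wd_cons, wd_inl) ?map_cat ?wdeg_cat
    ?wd_cat ?wd_inl.
  parity_cases.
rewrite (E (u1, xi1) (rcons z2 (u0, xi0) ++ z1)); last first.
  by rewrite !wordof_cons wordof_cat wordof_rcons cat_rcons -!catA.
rewrite /block_cut cutsum_map -cutsumZ /=.
apply: eq_cutsum => v v' eu; rewrite mulrA -ksgnD.
rewrite wordof_cat wordof_rcons cat_rcons -!catA !cat_cons -!catA; congr (_ * _).
apply: ksgn_eq; move: eu => /= ->; rewrite ?(wordof_cons, wd_rcons, wd_cat, wd_cons, wd_inl) /=.
rewrite ?(map_cat, wdeg_cat, wd_cat, wd_inl).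
parity_cases.
Qed.

End MC.

End EvaluatedInsertions.

(** * Sums over permutations *)

Lemma lift_perm_bij n :
  bijective (fun p : 'I_n.+1 * 'S_n => lift_perm p.1 ord0 p.2).
Proof.
apply: inj_card_bij => [[i s] [j t] /= e|]; last first.
  by rewrite card_prod card_ord !card_Sn factS.
have eij : i = j.
  by apply: (@perm_inj _ (lift_perm j ord0 t)); rewrite -{1}e !lift_perm_id.
subst j; congr (_, _); apply/permP => k; apply: (@lift_inj _ ord0).
by have /permP/(_ (lift i k)) := e; rewrite !lift_perm_lift.
Qed.

(** A permutation of n + 1 elements is the position of 0 and a permutation of the
    others. *)
Lemma sum_lift_perm (R : nmodType) n (E : 'S_n.+1 -> R) :
  \sum_(sigma : 'S_n.+1) E sigma
  = \sum_(j < n.+1) \sum_(sigma : 'S_n) E (lift_perm j ord0 sigma).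
Proof.
rewrite (reindex _ (onW_bij _ (lift_perm_bij n))) /=.
by rewrite pair_bigA.
Qed.

Section Permutations.
Variables (K : fieldType) (d : int) (V : int -> lmodType K).
Implicit Types (s : seq (letter V)) (x : letter V).

Definition tdeg x : int := tag x.
Definition ldeg x : int := d + tag x.
Local Notation hd := (wd_of ldeg).
Local Notation td := (wd_of tdeg).

(** The exponent of the decalage sign, which turns operations on V with symmetry
    sgn^d into graded symmetric operations on V[d]. *)
Fixpoint dec s : int :=
  if s is x :: s' then d * (size s')%:Z * tag x + dec s' else 0.

Lemma dec_sum s :
  dec s = \sum_(i < size s) d * (size s - i.+1)%N%:Z * tag (nth (letter0 V) s i).
Proof.
elim: s => [|x s IH]; first by rewrite big_ord0.
by rewrite big_ord_recl /= IH subn1.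
Qed.

Lemma parity_hd s : parity (hd s) = parity d && odd (size s) (+) parity (td s).
Proof.
elim: s => [|x s IH]; first by rewrite andbF.
by rewrite !wd_cons /ldeg !parityE IH /=; parity_cases; case: (odd _).
Qed.

Lemma parity_dec_insert a x b : parity (dec (a ++ x :: b))
  = parity (dec (a ++ b) + d * (size b)%:Z * tag x + d * td a).
Proof.
elim: a => [|y a IH] /=; first by rewrite mulr0 addr0 addrC.
rewrite wd_cons !parityE IH !size_cat /= !parityE !oddD /= /tdeg.
by case: (parity d); case: (odd (size a)); case: (odd (size b)); parity_cases.
Qed.

Lemma size_permute s (sigma : 'S_(size s)) : size (permute sigma) = size s.
Proof. by rewrite size_map size_enum_ord. Qed.

Lemma nth_permute s (sigma : 'S_(size s)) (i : 'I_(size s)) :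
  nth (letter0 V) (permute sigma) i = nth (letter0 V) s (sigma i).
Proof. by rewrite (nth_map i) ?size_enum_ord // nth_ord_enum. Qed.

Lemma permute_lift x s (j : 'I_(size s).+1) (sigma : 'S_(size s)) :
  permute (lift_perm j ord0 sigma : 'S_(size (x :: s)))
  = take j (permute sigma) ++ x :: drop j (permute sigma).
Proof.
have jn : (j <= size (permute sigma))%N by rewrite size_permute -ltnS.
apply: (@eq_from_nth _ (letter0 V)) => [|i]; rewrite size_permute.
  by rewrite size_cat /= addnS -size_cat cat_take_drop size_permute.
move=> iS; pose i' : 'I_(size (x :: s)) := Ordinal iS.
rewrite -[i]/(nat_of_ord i') nth_permute.
case: (unliftP j i') => [k|] ->; last first.
  by rewrite lift_perm_id nth_cat size_takel // ltnn subnn.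
rewrite lift_perm_lift /= add0n nth_cat size_takel //= /bump.
have e : nth (letter0 V) (permute sigma) k = nth (letter0 V) s (sigma k).
  exact: nth_permute.
case: (leqP j k) => jk; last by rewrite add0n jk nth_take.
rewrite add1n ltnNge (leqW jk) /= subSn //= nth_drop subnKC //.
Qed.

Lemma td_take s j : (j <= size s)%N ->
  td (take j s) = \sum_(k < size s | (k < j)%N) tag (nth (letter0 V) s k).
Proof.
move=> js; rewrite wd_sum (big_nth (letter0 V)) size_takel // big_mkord.
rewrite (big_ord_widen _ (fun k => tdeg (nth (letter0 V) (take j s) k)) js).
by apply: eq_bigr => k kj; rewrite nth_take.
Qed.

(** The new inversions are those of x with the entries placed before it. *)
Lemma perm_sign_lift x s (j : 'I_(size s).+1) (sigma : 'S_(size s)) :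
  parity (perm_sign d (lift_perm j ord0 sigma : 'S_(size (x :: s))))
  = parity (perm_sign d sigma + d * j%:Z + tag x * td (take j (permute sigma))).
Proof.
rewrite /perm_sign.
have pd (b : bool) : parity (d *+ b) = parity d && b by case: b; rewrite ?andbT ?andbF.
rewrite !parityD !pd parityM parity_nat odd_lift_perm /=.
set X := \sum_(i < _) _; set Y := \sum_(i < _) _.
suff -> : X = Y + tag x * td (take j (permute sigma)).
  by rewrite !parityD; case: (odd j); case: (odd_perm _); parity_cases.
have jp : (j <= size (permute sigma))%N by rewrite size_permute -ltnS.
rewrite (td_take jp) size_permute [tag x * _]mulr_sumr /X {X}.
rewrite (bigD1_ord j) //= [X in X + _]big_pred0 ?add0r; last first.
  by move=> k; rewrite lift_perm_id ltn0 andbF.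
rewrite [X in _ + X](_ : _ = \sum_(k < size s)
    (if (k < j)%N then tag x * tag (nth (letter0 V) (permute sigma) k) else 0)).
  rewrite -big_split; apply: eq_bigr => i _ /=.
  rewrite lift_perm_lift [LHS]big_mkcond (bigD1_ord j) //= lift_perm_id addrC.
  rewrite [X in _ = X + _]big_mkcond; congr (_ + _).
    apply: eq_bigr => k _; rewrite lift_perm_lift /= !add0n.
    by rewrite !ltnNge !leq_bump2 ?negbK.
  rewrite nth_permute [tag x * _]mulrC /bump leq0n andbT add0n.
  rewrite -[nth _ (x :: s) ord0]/x; case: (leqP j i) => ji.
    by rewrite add1n ltnNge (leqW ji).
  by rewrite add0n ji.
by rewrite -big_mkcond.
Qed.

(** The sign with which the contraction sums over permutations, decalage
    included. *)
Definition shuffled_sign s (sigma : 'S_(size s)) : int :=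
  perm_sign d sigma + dec (permute sigma).

Lemma shuffled_sign_nil (sigma : 'S_(size ([::] : seq (letter V)))) :
  permute sigma = [::] /\ shuffled_sign sigma = 0.
Proof.
have e : permute sigma = [::] by apply: size0nil; rewrite size_permute.
have -> : sigma = 1%g by apply/permP => -[].
have e1 : permute (1%g : 'S_(size ([::] : seq (letter V)))) = [::].
  by apply: size0nil; rewrite size_permute.
by split=> //; rewrite /shuffled_sign e1 /perm_sign !big_ord0 odd_perm1 /= !addr0 mulr0n.
Qed.

Lemma shuffled_sign_lift x s (j : 'I_(size s).+1) (sigma : 'S_(size s)) :
  parity (shuffled_sign (lift_perm j ord0 sigma : 'S_(size (x :: s))))
  = parity (d * (size s)%:Z * tag x + shuffled_sign sigma
            + ldeg x * hd (take j (permute sigma))).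
Proof.
set p := permute sigma; have sp : size p = size s by exact: size_permute.
have js : (j <= size p)%N by rewrite sp -ltnS.
rewrite /shuffled_sign permute_lift parityD perm_sign_lift -/p.
rewrite !parityD parity_dec_insert cat_take_drop size_drop sp.
rewrite !parityD !parityM parity_hd /ldeg parityD size_takel // !parity_nat.
rewrite oddB; last by rewrite -ltnS.
by case: (odd j); case: (odd (size s)); parity_cases.
Qed.

(** With the decalage signs, the symmetry is the Koszul sign for the degrees
    shifted by d. Both sides place the first entry among the permuted others. *)
Lemma sum_perm s (G : seq (letter V) -> K) :
  \sum_(sigma : 'S_(size s)) ksgn K (shuffled_sign sigma) * G (permute sigma)
  = ksgn K (dec s) * Psum ldeg s G.
Proof.
elim: s G => [|x s IH] G.
  rewrite (big_pred1 1%g) => [|sigma]; last by apply/esym/eqP/permP => -[].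
  by have [-> ->] := shuffled_sign_nil 1%g.
rewrite [LHS]sum_lift_perm exchange_big /= ksgnD -mulrA -IH mulr_sumr.
apply: eq_bigr => sigma _; have sp := size_permute sigma.
rewrite /cutsum sp mulrA mulr_sumr; apply: eq_bigr => j _.
rewrite permute_lift mulrA -!ksgnD; congr (_ * _); apply: ksgn_eq.
exact: shuffled_sign_lift.
Qed.

End Permutations.

(** * Sums over subsets *)

Definition cons_set n (b : bool) (S : {set 'I_n}) : {set 'I_n.+1} :=
  [set i | if unlift ord0 i is Some k then k \in S else b].

Lemma cons_set0 n b (S : {set 'I_n}) : (ord0 \in cons_set b S) = b.
Proof. by rewrite inE unlift_none. Qed.

Lemma cons_setS n b (S : {set 'I_n}) k : (lift ord0 k \in cons_set b S) = (k \in S).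
Proof. by rewrite inE liftK. Qed.

Lemma cons_setC n b (S : {set 'I_n}) : ~: cons_set b S = cons_set (~~ b) (~: S).
Proof. by apply/setP => i; rewrite !inE; case: unlift => [k|] //=; rewrite inE. Qed.

(** A subset of n + 1 elements is a subset of the last n, with or without 0. *)
Lemma sum_cons_set (R : nmodType) n (E : {set 'I_n.+1} -> R) :
  \sum_(S : {set 'I_n.+1}) E S
  = \sum_(S : {set 'I_n}) (E (cons_set true S) + E (cons_set false S)).
Proof.
pose f (p : bool * {set 'I_n}) := cons_set p.1 p.2.
have f_inj : injective f.
  move=> [b S] [c T] e; congr (_, _).
    by have := congr1 (fun X : {set 'I_n.+1} => ord0 \in X) e; rewrite /f !cons_set0.
  apply/setP => k.
  by have := congr1 (fun X : {set 'I_n.+1} => lift ord0 k \in X) e; rewrite /f !cons_setS.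
have f_bij : bijective f.
  have cS m : #|{: {set 'I_m}}| = (2 ^ m)%N.
    by rewrite -cardsT -powersetT card_powerset cardsT card_ord.
  by apply: inj_card_bij f_inj _; rewrite card_prod !cS card_bool expnS.
rewrite (reindex f) /=; last exact: onW_bij.
rewrite -(pair_bigA _ (fun b S => E (cons_set b S))) /= big_bool.
by rewrite -big_split.
Qed.

Section Subsets.
Variables (K : fieldType) (d : int) (V : int -> lmodType K).
Implicit Types (s : seq (letter V)) (x : letter V).
Local Notation tdeg := (@tdeg K V).
Local Notation ldeg := (@ldeg K d V).
Local Notation td := (wd_of tdeg).

Lemma subseq_at_cons x s b (S : {set 'I_(size s)}) :
  subseq_at (cons_set b S : {set 'I_(size (x :: s))})
  = (if b then [:: x] else [::]) ++ subseq_at S.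
Proof.
rewrite /subseq_at /enum_mem -!enumT enum_ordSl /= cons_set0.
have -> : [seq i <- [seq lift ord0 i | i <- enum 'I_(size s)] | i \in cons_set b S]
    = [seq lift ord0 i | i <- [seq i <- enum 'I_(size s) | i \in S]].
  by rewrite filter_map; congr map; apply: eq_filter => k /=; rewrite cons_setS.
by case: b; rewrite /= -map_comp.
Qed.

Lemma size_subseq_at s (S : {set 'I_(size s)}) : size (subseq_at S) = #|S|.
Proof. by rewrite size_map -cardE. Qed.

Lemma sum_subseq_at s (S : {set 'I_(size s)}) (f : letter V -> int) :
  \sum_(j in S) f (nth (letter0 V) s j) = \sum_(y <- subseq_at S) f y.
Proof. by rewrite big_map big_enum. Qed.

Lemma parity_unshuffle_cons x s b (S : {set 'I_(size s)}) :
  parity (unshuffle_sign d (cons_set b S : {set 'I_(size (x :: s))}))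
  = parity (unshuffle_sign d S
            + (if b then 0 else d * (size (subseq_at S))%:Z + tag x * td (subseq_at S))).
Proof.
rewrite /unshuffle_sign cons_setC [X in parity X = _]big_mkcond big_ord_recl cons_set0.
rewrite [X in parity X = _]addrC; congr parity; congr (_ + _).
  rewrite [RHS]big_mkcond; apply: eq_bigr => i _; rewrite cons_setS.
  case: ifP => // _; rewrite big_mkcond big_ord_recl /= andbF add0r [RHS]big_mkcond.
  by apply: eq_bigr => j _; rewrite cons_setS /= !add0n.
case: b => //=; rewrite big_mkcond big_ord_recl /= cons_set0 add0r.
rewrite (eq_bigr (fun j => if j \in S then d + tag x * tag (nth (letter0 V) s j) else 0)).
  rewrite -big_mkcond (sum_subseq_at S (fun y => d + tag x * tag y)) big_split /=.
  by rewrite big_const_seq count_predT iter_addr_0 -mulr_natr natz wd_sum mulr_sumr.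
by move=> j _; rewrite cons_setS andbT.
Qed.

(** The sign of the quadratic term of S in the relation, once the inner and the
    outer operation are replaced by the graded symmetric ones on V[d]. *)
Definition split_sign s (S : {set 'I_(size s)}) : int :=
  unshuffle_sign d S + dec d (subseq_at S) + dec d (subseq_at (~: S))
  + d * (size (subseq_at (~: S)))%:Z * td (subseq_at S).

(** The analogue of [sum_perm]: with the decalage signs, the unshuffles of the
    relation are those of [Msum] for the shifted degrees. *)
Lemma sum_subsets s (G : seq (letter V) -> seq (letter V) -> K) :
  \sum_(S : {set 'I_(size s)}) ksgn K (split_sign S)
     * G (subseq_at S) (subseq_at (~: S))
  = ksgn K (dec d s) * Msum ldeg s G.
Proof.
elim: s G => [|x s IH] G.
  have e (S : {set 'I_(size ([::] : seq (letter V)))}) : subseq_at S = [::].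
    by apply: size0nil; rewrite size_subseq_at; apply: eq_card0 => -[].
  rewrite (big_pred1 set0) => [|S]; last by apply/esym/eqP/setP => -[].
  by rewrite /split_sign /unshuffle_sign !e !big1 /= ?wd_nil ?mulr0 ?mul1r // => -[].
rewrite [LHS]sum_cons_set /= ksgnD -mulrA -IH mulr_sumr.
apply: eq_bigr => S _; rewrite !cons_setC !subseq_at_cons /= mulrDr mulrDr.
have sS : (size (subseq_at S) + size (subseq_at (~: S)) = size s)%N.
  by rewrite !size_subseq_at cardsC card_ord.
have os : odd (size s) = odd (size (subseq_at S)) (+) odd (size (subseq_at (~: S))).
  by rewrite -oddD sS.
have US b := parity_unshuffle_cons x b S.
rewrite !mulrA -!ksgnD; congr (_ * _ + _ * _); apply: ksgn_eq.
  rewrite /split_sign !cons_setC !subseq_at_cons /= wd_cons.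
  rewrite !parityD !US !(parityD, parityM, parity_nat) os.
  rewrite /tdeg /ldeg ?parityD.
  by case: (odd (size (subseq_at S))); case: (odd (size (subseq_at (~: S)))); parity_cases.
rewrite /split_sign !cons_setC !subseq_at_cons /=.
rewrite !parityD !US !(parityD, parityM, parity_nat) parity_hd /= os.
rewrite /tdeg /ldeg ?parityD.
  by case: (odd (size (subseq_at S))); case: (odd (size (subseq_at (~: S)))); parity_cases.
Qed.

Lemma subseq_at_setT s : subseq_at [set: 'I_(size s)] = s.
Proof.
rewrite /subseq_at enum_setT -enumT (map_comp (nth (letter0 V) s) val) val_enum_ord.
exact: mkseq_nth.
Qed.

Lemma subseq_at_set0 s : subseq_at (set0 : {set 'I_(size s)}) = [::].
Proof. by apply: size0nil; rewrite size_subseq_at cards0. Qed.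

Lemma cons_set_true0 n : cons_set true (set0 : {set 'I_n}) = [set ord0].
Proof.
by apply/setP => i; rewrite !inE; case: unliftP => [k|] ->; rewrite ?inE ?eqxx.
Qed.

Lemma cons_set_false1 n (k : 'I_n) : cons_set false [set k] = [set lift ord0 k].
Proof.
apply/setP => i; rewrite !inE; case: unliftP => [j|] ->; rewrite ?inE //.
Qed.

Lemma subseq_at_set1 s (i : 'I_(size s)) :
  [/\ subseq_at [set i] = [:: nth (letter0 V) s i],
      subseq_at (~: [set i]) = take i s ++ drop i.+1 s
    & parity (unshuffle_sign d [set i])
      = parity (d * i%:Z + tag (nth (letter0 V) s i) * td (take i s))].
Proof.
elim: s i => [|x s IH] i; first by case: i.
case: (unliftP ord0 i) => [k|] ->; last first.
  rewrite -cons_set_true0 cons_setC !subseq_at_cons subseq_at_set0 setC0 subseq_at_setT.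
  rewrite parity_unshuffle_cons /= drop0 wd_nil !mulr0 addr0.
  split=> //; rewrite /unshuffle_sign big1 // => j _; rewrite big_pred0 // => l.
  by rewrite inE.
rewrite -cons_set_false1 cons_setC !subseq_at_cons parity_unshuffle_cons.
have [-> -> e] := IH k; split=> //.
have el : (lift ord0 k)%:Z = k%:Z + 1 by rewrite lift0 -addn1 PoszD.
rewrite -[take (lift _ _) _]/(x :: take k s) -[nth _ _ (lift _ _)]/(nth (letter0 V) s k).
rewrite parityD e el !wd_cons wd_nil addr0 -[tdeg x]/(tag x) -[tdeg _]/(tag _).
rewrite !(parityD, parityM, parity_nat) /=.
by case: (parity d); case: (odd k); parity_cases.
Qed.

End Subsets.

(** * The contraction as a sum over arcs *)

Section Contractions.
Variables (K : fieldType) (d : int) (A : int -> lmodType K).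
Local Notation dual := (@dual K d A).
Local Notation letterE := (@letterE K d A).
Local Notation edeg := (@edeg K d A).
Local Notation word := (seq letterE).
Local Notation cyc := (cyc_of edeg).
Local Notation cyclic_cochain := (@cyclic_cochain K d A).
Local Notation pcoch := (@pcoch K d A).
Local Notation inr := (@inr (letter A) dual).
Local Notation inl := (@inl (letter A) dual).
Local Notation is_input := (@is_input K d A).
Local Notation block := (@block K d A).
Local Notation D := (d + 1).
Local Notation label := (letter (cyc_cochain A)).
Local Notation ldeg := (@ldeg K d (cyc_cochain A)).
Implicit Types (w : word) (u v : seq (letter A)) (gs : seq label) (g : label).

Definition letters w : seq (letter A) :=
  pmap (fun x : letterE => if x is Datatypes.inl a then Some a else None) w.

Lemma letters_cat w1 w2 : letters (w1 ++ w2) = letters w1 ++ letters w2.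
Proof. exact: pmap_cat. Qed.

Lemma letters_inl u : letters (map inl u) = u.
Proof. by elim: u => //= a u ->. Qed.

Lemma is_inl_letters w : all is_input w -> w = map inl (letters w).
Proof. by elim: w => [|[a|xi] w IH] //= /IH {1}->. Qed.

Lemma all_is_input u : all is_input (map inl u).
Proof. by elim: u. Qed.

(** Extension by zero to words with functionals. *)
Definition emb (f : seq (letter A) -> K) w : K :=
  if all is_input w then f (letters w) else 0.

(** The sum over rotations, on words that may contain functionals. *)
Definition Hat (f : seq (letter A) -> K) w : K := cyc w (emb f).

Lemma HatE (f : seq (letter A) -> K^o) u : Hat f (map inl u) = cycsum f u.
Proof.
rewrite /Hat /cyc_of size_map; apply: eq_bigr => i _.
rewrite /rho /rotf -map_take -map_drop -map_rot !wd_inl /emb all_is_input letters_inl.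
by [].
Qed.

Lemma plain_Hat f : plain (Hat f).
Proof.
move=> a xi b; rewrite -[RHS](cyc0 K edeg (a ++ inr xi :: b)); apply: eq_cyc => x y e.
by rewrite /emb all_cat andbC -all_cat -e all_cat /= andbF.
Qed.

Lemma Hat_cochain p f : is_cyc_cochain p f -> cyclic_cochain p (Hat f).
Proof.
move=> [fl f0 fd]; split.
- apply: mlin_cyc => s1 s2 i c x y; rewrite /emb !all_cat /= !letters_cat /=.
  by case: ifP => _; [exact: fl|rewrite mulr0 addr0].
- apply: cyc_deg => w hw; rewrite /emb; case: ifP => // pw; apply: fd.
  by rewrite -(@wd_inl K d A) -is_inl_letters.
- by move=> a b; exact: cyc_cat.
by move=> a; exists [::] => xi; rewrite big_nil -cats1 plain_Hat.
Qed.

Lemma cyc_cochainP p (f : cyc_cochain A p) : is_cyc_cochain p (val f).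
Proof. exact/asboolP/(valP f). Qed.

Definition hatp g : pcoch :=
  PCoch (Hat_cochain (cyc_cochainP (tagged g))) (@plain_Hat (val (tagged g))).

Lemma sum_cuts k u (G : seq (seq (letter A)) -> K) :
  \sum_(t <- cuts k.+1 u) G t
  = cutsum u (fun a b => \sum_(r <- cuts k b) G (a :: r)).
Proof.
rewrite -[cuts k.+1 u]/(flatten [seq [seq take i u :: r | r <- cuts k (drop i u)]
  | i <- index_iota 0 (size u).+1]) big_flatten big_map big_mkord.
by apply: eq_bigr => i _; rewrite big_map.
Qed.

Lemma size_cuts k u t : t \in cuts k u -> size t = k.
Proof.
elim: k u t => [|k IH] u t; first by case: u => //=; rewrite inE => /eqP ->.
by case/flattenP => s /mapP[i _ ->] /mapP[r /IH <- ->].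
Qed.

(** The word made from the cut t = u_1 v_1 u_2 v_2 ..., in which each v_i is fed to
    the i-th operand. *)
Fixpoint arc_blocks gs (t : seq (seq (letter A))) : seq block :=
  match gs, t with
  | g :: gs', u :: v :: t' => (u, dlp (hatp g) (map inl v)) :: arc_blocks gs' t'
  | _, _ => [::]
  end.

Fixpoint arc_sign gs (n : int) (t : seq (seq (letter A))) : int :=
  match gs, t with
  | g :: gs', u :: v :: t' =>
      ldeg g * (n + wdeg u) + arc_sign gs' (n + wdeg u + wdeg v) t'
  | _, _ => 0
  end.

(** The recursive sum over arcs is the sum over cuts into 2n words. *)
Lemma arcs_cuts gs n (G : word -> K) u :
  arcs (map hatp gs) n G (map inl u)
  = \sum_(t <- cuts (size gs).*2 u)
      ksgn K (arc_sign gs n t) * G (wordof (arc_blocks gs t)).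
Proof.
elim: gs n G u => [|g gs IH] n G u.
  by case: u => [|a u] /=; rewrite ?big_seq1 ?big_nil ?mul1r.
rewrite doubleS sum_cuts /= cutsum_map.
under eq_cutsum => x z _ do rewrite cutsum_map.
under [RHS]eq_cutsum => x z _ do rewrite sum_cuts.
rewrite -[RHS]cutsumA; apply: eq_cutsum => x z _; apply: eq_cutsum => a b ex.
rewrite IH mulr_sumr; apply: eq_bigr => t _ /=.
by rewrite wordof_cons !wd_inl ex wdeg_cat addrA ksgnD mulrA.
Qed.

Lemma unzip1_arc_blocks gs t : size t = (size gs).*2 ->
  unzip1 (arc_blocks gs t) = mkseq (fun i => nth [::] t i.*2) (size gs).
Proof.
rewrite /mkseq; elim: gs t => [|g gs IH] [|u [|v t]] //= [st].
by rewrite IH // -[1%N]/(1 + 0)%N iotaDl -map_comp.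
Qed.

Lemma arc_sign_sum gs n t : size t = (size gs).*2 ->
  arc_sign gs n t = \sum_(i < size gs)
    ldeg (nth (letter0 _) gs i) * (n + wdeg (flatten (take i.*2.+1 t))).
Proof.
elim: gs n t => [|g gs IH] n [|u [|v t]] //= => [_|[st]]; first by rewrite big_ord0.
rewrite big_ord_recl /= cats0 IH //; congr (_ + _); apply: eq_bigr => i _.
by rewrite /= !wdeg_cat !addrA.
Qed.

Lemma pair_arc_blocks gs t bs : size t = (size gs).*2 ->
  pair (unzip2 (arc_blocks gs t)) bs =
  if size bs == size gs then
    \prod_(i < size gs) dfun (dlp (hatp (nth (letter0 _) gs i))
      (map inl (nth [::] t i.*2.+1))) (nth (letter0 A) bs i)
  else 0.
Proof.
elim: gs t bs => [|g gs IH] [|u [|v t]] [|b bs] //= => [_|[st]].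
  by rewrite big_ord0.
by rewrite IH // eqSS; case: ifP => _; rewrite ?mulr0 // big_ord_recl.
Qed.

Section Contraction.
Variable F : seq (seq (letter A)) -> tens A.

(** The factors of the contraction formula are the values of the functionals of
    the arcs v_i at the outputs of F, and the blocks of F are the words u_i. *)
Lemma contraction_term gs t (n := size gs) : size t = n.*2 ->
  tpair (fun bs =>
    if size bs == n then
      ksgn K (\sum_(i < n) (d * (n - i.+1)%N%:Z * tag (nth (letter0 _) gs i)
         + tag (nth (letter0 _) gs i)
         + (d + tag (nth (letter0 _) gs i)) *
           (wdeg (flatten (take i.*2.+1 t)) + ideg (nth (letter0 A) bs i) + 1)))
      * (\prod_(i < n) cycsum (val (tagged (nth (letter0 _) gs i)))
           (nth (letter0 A) bs i :: nth [::] t i.*2.+1) : K)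
    else 0) (cycsumC D F (mkseq (fun i => nth [::] t i.*2) n))
  = ksgn K (dec d gs) * (ksgn K (arc_sign gs 0 t)
      * ceval F (wordof (arc_blocks gs t))).
Proof.
move=> st; rewrite ceval_wordof unzip1_arc_blocks // mulrA -ksgnD -tpairZ.
apply: eq_tpair => bs; rewrite pair_arc_blocks //.
case: ifP => _; last by rewrite mulr0.
have -> : \prod_(i < size gs) dfun (dlp (hatp (nth (letter0 _) gs i))
      (map inl (nth [::] t i.*2.+1))) (nth (letter0 A) bs i)
   = ksgn K (\sum_(i < n) (tag (nth (letter0 _) gs i)
       + (d + tag (nth (letter0 _) gs i)) * (ideg (nth (letter0 A) bs i) + 1)))
     * \prod_(i < n) cycsum (val (tagged (nth (letter0 _) gs i)))
           (nth (letter0 A) bs i :: nth [::] t i.*2.+1).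
  rewrite (big_morph _ (ksgnD K) (ksgn0 K)) -big_split; apply: eq_bigr => i _ /=.
  set g := nth _ gs i; have c := pcochP (hatp g).
  by rewrite /dlp (dlE (coch_lin c) (coch_deg c)) -HatE.
rewrite mulrA -ksgnD dec_sum arc_sign_sum //; congr (ksgn K _ * _).
rewrite -!big_split /=; apply: eq_bigr => i _.
by rewrite /ldeg; ring.
Qed.

Lemma contractionE (fs : seq label) u : u <> [::] ->
  contraction d F fs u
  = (size fs)%:R^-1 * (ksgn K (dec d fs)
      * Psum ldeg fs (fun gs => arcs (map hatp gs) 0 (ceval F) (map inl u))).
Proof.
case: u => // a u _; rewrite /contraction; set w := a :: u.
congr (_ * _); rewrite -sum_perm; apply: eq_bigr => sigma _.
rewrite /shuffled_sign ksgnD -mulrA; congr (_ * _).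
rewrite arcs_cuts size_permute addnn mulr_sumr; apply: eq_big_seq => t /size_cuts st.
have := @contraction_term (permute sigma) t; rewrite !size_permute.
by move=> /(_ st) <-.
Qed.

End Contraction.

End Contractions.

(** * Classes modulo cyclic rotation *)

Section Classes.
Variables (K : fieldType) (d : int) (A : int -> lmodType K).
Local Notation dual := (@dual K d A).
Local Notation letterE := (@letterE K d A).
Local Notation edeg := (@edeg K d A).
Local Notation word := (seq letterE).
Local Notation wd := (wd_of edeg).
Local Notation cyclic_cochain := (@cyclic_cochain K d A).
Local Notation hdeg := (@hdeg K d A).
Local Notation edl := (@edl K d A).
Local Notation inr := (@inr (letter A) dual).
Local Notation inl := (@inl (letter A) dual).
Local Notation block := (@block K d A).
Local Notation D := (d + 1).
Implicit Types (w : word) (u v : seq (letter A)).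
Implicit Types (F G : seq (seq (letter A)) -> tens A) (z : seq block).

Lemma ceval_lin c F G w :
  ceval (fun us => c *: F us + G us) w = c * ceval F w + ceval G w.
Proof.
suff E us xs u (v : word) : eval_blocks (fun us => c *: F us + G us) us xs u v
    = c * eval_blocks F us xs u v + eval_blocks G us xs u v :> K.
  by rewrite /ceval -cycZ -cycD; apply: eq_cyc => b0 a0 _; exact: E.
elim: v us xs u => [|[a|xi] v IH] us xs u /=; try exact: IH.
case: u => [|x u]; last by rewrite mulr0 addr0.
by rewrite tpairDr tpairZr.
Qed.

(** Any other word is a rotation of one which ends with a functional, or contains
    no functional. *)
Lemma eq_ceval F G : (forall z, ceval F (wordof z) = ceval G (wordof z)) ->
  forall w, ceval F w = ceval G w.
Proof.
move=> e w; have [z [u ->]] := wordofP w.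
case: z => [|[v xi] z]; last first.
  rewrite /ceval !(cyc_cat _ (wordof _)) -!/(ceval _ _).
  have -> : map inl u ++ wordof ((v, xi) :: z) = wordof ((u ++ v, xi) :: z).
    by rewrite !wordof_cons map_cat -catA.
  by rewrite e.
by case: u => [|x u]; [rewrite (e [::])|rewrite !ceval_plain].
Qed.

(** A sum over rotations does not change under rotation, so it vanishes on the
    relations which define the coinvariants. *)
Lemma ceval_cls p (F G : C_cochain A D p) : C_cls F = C_cls G ->
  forall w, ceval (val F) w = ceval (val G) w :> K.
Proof.
move=> /clsP h.
suff E w : ceval (val (F - G)) w = 0 :> K.
  move=> w; apply/eqP; rewrite -subr_eq0 -(E w); apply/eqP.
  rewrite addrC -mulN1r -ceval_lin; congr (ceval _ w); apply/funext => us.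
  by rewrite scaleN1r addrC.
pose P (z : C_cochain A D p) := forall w, ceval (val z) w = 0 :> K.
have hP : P (F - G); last exact: hP.
apply: h => [|z0 [H eH] {}w].
  split=> [v|a x y hx hy v].
    have := ceval_lin 0 (fun _ => 0) (fun _ => 0) v; rewrite mul0r add0r => e0.
    have := ceval_lin (-1) (fun _ => 0 : tens A) (fun _ => 0) v.
    rewrite mulN1r addNr => <-; congr (ceval _ v); apply/funext => us.
    by rewrite scaler0 addr0.
  have -> : val (a *: x + y) = a *: val x + val y by exact: linearP.
  by rewrite [LHS]ceval_lin hx hy mulr0 addr0.
rewrite (_ : val _ = fun us => (-1) *: rotC D 1 (val H) us + val H us); last first.
  by apply/funext => us; rewrite eH scaleN1r addrC.
rewrite ceval_lin mulN1r addrC; apply/eqP; rewrite subr_eq0; apply/eqP.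
apply: eq_ceval => z; case: z => [|p0 z]; first by rewrite /ceval /cyc_of !big_ord0.
rewrite !ceval_cyc -[LHS]cyc_rho1; apply: eq_cyc => a b e.
by rewrite beval_rotC // size_cat addnC -size_cat -e.
Qed.

Lemma ceval_output F u xi :
  ceval F (rcons (map inl u) (inr xi)) = tpair (pair [:: xi]) (F [:: u]).
Proof.
have -> : rcons (map inl u) (inr xi) = wordof [:: (u, xi)].
  by rewrite wordof_cons cats1.
by rewrite ceval_cyc /cyc_of big_ord1 rho0.
Qed.

Section ArcsCochain.
Variables (p : int) (Phi : word -> K).
Hypothesis cPhi : cyclic_cochain p Phi.

Lemma arcs_lin gs t c (G1 G2 G3 : word -> K) w : (forall s, G1 s = c * G2 s + G3 s) ->
  arcs gs t G1 w = c * arcs gs t G2 w + arcs gs t G3 w.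
Proof.
by move=> e; rewrite -arcsZ -arcsD; congr (arcs gs t _ w); apply/funext.
Qed.

Lemma mlin_arcs gs t P : mlin (arcs gs t (fun s => Phi (P ++ s))).
Proof.
elim: gs t P => [|g gs IH] t P.
  by move=> [|x s1] s2 i c x' y /=; rewrite mulr0 addr0.
have E w : arcs (g :: gs) t (fun s => Phi (P ++ s)) w
  = cutsum w (fun x y => cutsum x (fun a b => ksgn K (hdeg g * (t + wd a))
      * arcs gs (t + wd a + wd b) (fun s => Phi ((P ++ a ++ [:: inr (dlp g b)]) ++ s)) y)).
  apply: eq_cutsum => x z _; apply: eq_cutsum => u v ->; rewrite wd_cat addrA.
  by congr (_ * arcs _ _ _ _); apply/funext => s; rewrite -!catA.
move=> s1 s2 i c x y; rewrite !E; move: s1 s2 i c x y.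
apply: mlin_cutsum => [z|x0]; last first.
  move=> s1 s2 i c x y; rewrite -cutsumZ -cutsumD; apply: eq_cutsum => u v _.
  by rewrite IH mulrDr mulrCA.
apply: mlin_cutsum => [v|u] s1 s2 i c x y.
  rewrite !wd_cat !wd_cons; rewrite (@arcs_lin gs _ c _ (fun s => Phi ((P ++
    (s1 ++ inl (Tagged A x) :: s2) ++ [:: inr (dlp g v)]) ++ s))
    (fun s => Phi ((P ++ (s1 ++ inl (Tagged A y) :: s2) ++ [:: inr (dlp g v)]) ++ s))).
    by rewrite mulrDr mulrCA.
  by move=> s; rewrite -!catA !cat_cons !(catA P) (coch_lin cPhi).
rewrite !wd_cat !wd_cons; rewrite (@arcs_lin gs _ c _ (fun s => Phi ((P ++
    u ++ [:: inr (dlp g (s1 ++ inl (Tagged A x) :: s2))]) ++ s))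
    (fun s => Phi ((P ++ u ++ [:: inr (dlp g (s1 ++ inl (Tagged A y) :: s2))]) ++ s))).
  by rewrite mulrDr mulrCA.
move=> s; rewrite -!catA !(catA P) /=; apply: (coch_dual_lin cPhi).
- by rewrite !ddeg_dl !wd_cat !wd_cons.
- by rewrite !ddeg_dl !wd_cat !wd_cons.
by apply: dl_lin; case: (pcochP g).
Qed.

Lemma arcs_deg gs t w : wd w + wd_of edl gs + p != 0 -> arcs gs t Phi w = 0.
Proof.
move=> h; rewrite -(arcs0 gs t w); apply: eq_arcs => s es _.
by rewrite (coch_deg cPhi) // es.
Qed.

End ArcsCochain.

Lemma eq_Psum_wd (T : Type) (h e : T -> int) fs (G H : seq T -> K) :
  (forall t, size t = size fs -> wd_of e t = wd_of e fs -> G t = H t) ->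
  Psum h fs G = Psum h fs H.
Proof.
elim: fs G H => [|f fs IH] G H h'; first exact: h'.
apply: IH => t st et; apply: eq_cutsum => a b eab; congr (_ * _); apply: h'.
  by rewrite size_cat /= addnS -size_cat -eab st.
by rewrite wd_cons -et eab !wd_cat wd_cons; ring.
Qed.

Lemma cycsumE (f : seq (letter A) -> K^o) u : cycsum f u = cyc_of (@ideg K A) u f.
Proof.
apply: eq_bigr => i _; rewrite /rotf /rho.
by rewrite !wd_sum.
Qed.

Lemma wdeg_rot j u : wdeg (rot j u) = wdeg u.
Proof. by rewrite -{2}(cat_take_drop j u) !wdeg_cat addrC. Qed.

Definition char0 := forall n, n.+1%:R != 0 :> K.

(** The argument of [ceval_cls], for cochains without outputs. *)
Lemma cycsum_cls p (f g : cyc_cochain A p) : cyc_cls f = cyc_cls g ->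
  forall u, cycsum (val f) u = cycsum (val g) u.
Proof.
move=> /clsP h.
have cycsum_lin c (f1 f2 : seq (letter A) -> K^o) u :
    cycsum (fun t => c * f1 t + f2 t) u = c * cycsum f1 u + cycsum f2 u.
  by rewrite !cycsumE cycD cycZ.
suff E u : cycsum (val (f - g)) u = 0.
  move=> u; apply/eqP; rewrite -subr_eq0 -(E u); apply/eqP.
  rewrite addrC -mulN1r -cycsum_lin; congr (cycsum _ u); apply/funext => w.
  by rewrite mulN1r addrC.
pose P (z : cyc_cochain A p) := forall u, cycsum (val z) u = 0.
have hP : P (f - g); last exact: hP.
apply: h => [|z0 [H eH] {}u].
  split=> [v|a x y hx hy v]; first (rewrite cycsumE; exact: (cyc0 K (@ideg K A) v)).
  have -> : val (a *: x + y) = a *: val x + val y by exact: linearP.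
  by rewrite [LHS]cycsum_lin hx hy mulr0 addr0.
rewrite (_ : val _ = fun t => -1 * rotf 1 (val H) t + val H t); last first.
  by apply/funext => w; rewrite eH mulN1r addrC.
rewrite cycsum_lin !cycsumE -[cyc_of _ u (val H)]cyc_rho1 mulN1r.
rewrite (_ : rotf 1 (val H) = rho (@ideg K A) 1 (val H)) ?addNr //.
by apply/funext => w; rewrite /rotf /rho !wd_sum.
Qed.

(** In characteristic zero, coinvariants embed in invariants. If all the
    sums over rotations of e vanish, then e is the coboundary h - t h of its mean
    primitive h, where t is the rotation. *)
Lemma cyc_cls_inj p (f g : cyc_cochain A p) : char0 ->
  (forall u, cycsum (val f) u = cycsum (val g) u) -> cyc_cls f = cyc_cls g.
Proof.
move=> ch0 efg; apply/clsP => P _ hP; apply: hP.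
pose e := val (f - g).
have [el e0 ed] : is_cyc_cochain p e by exact: cyc_cochainP.
have rotfE i (h : seq (letter A) -> K^o) u : rotf i h u = rho (@ideg K A) i h u.
  by rewrite /rotf /rho !wd_sum.
have ce u : cycsum e u = 0.
  rewrite cycsumE (_ : e = fun t => -1 * val g t + val f t); last first.
    by apply/funext => w; rewrite mulN1r addrC.
  by rewrite cycD cycZ -!cycsumE efg mulN1r addNr.
(* The primitive is the mean over i of the sums of the first i rotations: the
   difference h - t h telescopes to e minus the mean of all rotations. *)
pose h (w : seq (letter A)) : K^o :=
  (size w)%:R^-1 * \sum_(i < size w) \sum_(j < i) rho (@ideg K A) j e w.
have rlin j s1 s2 i (a : K) (x y : A i) : (j <= size s1 + (size s2).+1)%N ->
    rho (@ideg K A) j e (s1 ++ Tagged A (a *: x + y) :: s2)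
    = a * rho (@ideg K A) j e (s1 ++ Tagged A x :: s2)
      + rho (@ideg K A) j e (s1 ++ Tagged A y :: s2).
  move=> js; have [js1|js1] := leqP j (size s1).
    have [b [c [-> <-]]] : exists b c, s1 = b ++ c /\ size b = j.
      by exists (take j s1), (drop j s1); rewrite cat_take_drop size_takel.
    rewrite -!catA !rho_cat -!catA !cat_cons (el _ _ _ _ _ _) !wd_cat !wd_cons /=.
    by rewrite mulrDr mulrCA.
  have [b [c [-> <-]]] : exists b c, s2 = b ++ c /\ (size (rcons s1 (Tagged A x) ++ b)) = j.
    exists (take (j - (size s1).+1) s2), (drop (j - (size s1).+1) s2).
    rewrite cat_take_drop size_cat size_rcons size_takel ?subnKC //.
    by rewrite leq_subLR addSn -addnS.
  have E (z : A i) : rho (@ideg K A) (size (rcons s1 (Tagged A x) ++ b)) e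
        (s1 ++ Tagged A z :: b ++ c)
      = ksgn K ((wd_of (@ideg K A) s1 + (i - 1) + wd_of (@ideg K A) b)
          * wd_of (@ideg K A) c) * e ((c ++ s1) ++ Tagged A z :: b).
    have -> : size (rcons s1 (Tagged A x) ++ b) = size (rcons s1 (Tagged A z) ++ b).
      by rewrite !size_cat !size_rcons.
    have -> : s1 ++ Tagged A z :: b ++ c = (rcons s1 (Tagged A z) ++ b) ++ c.
      by rewrite -catA cat_rcons.
    by rewrite rho_cat cat_rcons catA !wd_cat wd_cons addrA.
  by rewrite !E (el _ _ _ _ _ _) mulrDr mulrCA.
have hP0 : is_cyc_cochain p h.
  split.
  - move=> s1 s2 i a x y; rewrite /h !size_cat /=.
    rewrite /GRing.scale /= [RHS]addrC mulrCA -mulrDr [RHS]mulrC [LHS]mulrC; congr (_ * _).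
    rewrite mulr_sumr -big_split; apply: eq_bigr => k _ /=.
    rewrite mulr_sumr -big_split; apply: eq_bigr => l _ /=.
    rewrite rlin 1?addrC // ltnW // (ltn_trans (ltn_ord l)) //.
  - by rewrite /h big_ord0 mulr0.
  move=> w hw; rewrite /h big1 ?mulr0 // => k _; rewrite big1 // => l _.
  by rewrite /rho ed ?mulr0 // wdeg_rot.
have memH : h \in submod_pred (is_cyc_cochain_submod A p) by apply/asboolP.
exists (Sub h memH) => w; change (e w = h w - rotf 1 h w); rewrite rotfE.
have [->|wn] := eqVneq w [::].
  by rewrite e0 /rho /h !big_ord0 !mulr0 subr0.
have sw : (size w)%:R != 0 :> K by case: w wn => // b w _; exact: ch0.
pose r j := rho (@ideg K A) j e w.
have h1 : (size w)%:R * h w = \sum_(i < size w) \sum_(j < i) r j.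
  by rewrite /h mulVKf.
have h2 : (size w)%:R * rho (@ideg K A) 1 h w = \sum_(i < size w) \sum_(j < i) r j.+1.
  rewrite {1}/rho /h size_rot mulrCA mulVKf // mulr_sumr; apply: eq_bigr => k _.
  rewrite mulr_sumr; apply: eq_bigr => l _; rewrite /r -[l.+1]/(1 + l)%N rhoD //.
  by rewrite add1n (leq_trans (ltn_ord l)) // ltnW.
have tel n : \sum_(j < n) r j = e w - r n + \sum_(j < n) r j.+1.
  elim: n => [|n IH]; first by rewrite !big_ord0 /r rho0 subrr addr0.
  by rewrite !big_ord_recr /= IH; ring.
apply: (mulfI sw); transitivity
    ((size w)%:R * h w - (size w)%:R * rho (@ideg K A) 1 h w); last first.
  exact: esym (mulrBr _ _ _).
rewrite h1 h2.
under eq_bigr => i _ do rewrite tel.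
rewrite big_split /= addrK sumrB -[\sum_(i < _) r i]/(cyc_of _ w e) -cycsumE ce subr0.
by rewrite big_const_ord iter_addr_0 mulr_natl.
Qed.

End Classes.

(** * The homotopy Lie structure *)

Section HolieStructure.
Variables (K : fieldType) (d : int) (A : int -> lmodType K).
Local Notation dual := (@dual K d A).
Local Notation letterE := (@letterE K d A).
Local Notation edeg := (@edeg K d A).
Local Notation word := (seq letterE).
Local Notation wd := (wd_of edeg).
Local Notation cyc := (cyc_of edeg).
Local Notation cyclic_cochain := (@cyclic_cochain K d A).
Local Notation pcoch := (@pcoch K d A).
Local Notation hdeg := (@hdeg K d A).
Local Notation edl := (@edl K d A).
Local Notation inr := (@inr (letter A) dual).
Local Notation inl := (@inl (letter A) dual).
Local Notation Hat := (@Hat K d A).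
Local Notation hatp := (@hatp K d A).
Local Notation D := (d + 1).
Local Notation label := (letter (cyc_cochain A)).
Implicit Types (w : word) (u : seq (letter A)).

Lemma plain_ext (f g : word -> K) : plain f -> plain g ->
  (forall u, f (map inl u) = g (map inl u)) -> forall w, f w = g w.
Proof.
move=> pf pg e w; have [[|[v xi] z] [u ->]] := wordofP w; first exact: e.
by rewrite wordof_cons -catA cat_cons pf pg.
Qed.

Lemma pcoch_eq (f g : pcoch) : pdeg f = pdeg g -> (forall w, f w = g w) -> f = g.
Proof.
case: f g => p f cf pf [q g cg pg] /= epq /funext efg.
by case: _ / epq cg; case: _ / efg pg => pg cg; congr PCoch; exact: Prop_irrelevance.
Qed.

Lemma Hat_lin c f g w : Hat (fun t => c * f t + g t) w = c * Hat f w + Hat g w.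
Proof.
rewrite /Hat -cycZ -cycD; apply: eq_cyc => a b _; rewrite /emb.
by case: ifP => _ //; rewrite mulr0 addr0.
Qed.

Lemma Hat_of (G : word -> K) (f : seq (letter A) -> K) :
  (forall u, u <> [::] -> f u = G (map inl u)) ->
  forall u, Hat f (map inl u) = cyc (map inl u) G.
Proof.
move=> e u; apply: eq_bigr => i _; congr (_ * _).
rewrite -map_rot /emb all_is_input letters_inl e // => /(congr1 size).
by rewrite size_rot => /eqP; rewrite size_eq0 => /eqP h; case: u h i => //= _ [].
Qed.

Lemma cochain_of q (G : word -> K) (f : seq (letter A) -> K^o) :
  mlin G -> (forall w, wd w + q != 0 -> G w = 0) -> f [::] = 0 ->
  (forall u, u <> [::] -> f u = G (map inl u)) -> is_cyc_cochain q f.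
Proof.
move=> lG dG f0 e; split=> // [s1 s2 i c x y|u hu].
  by rewrite !e ?map_cat /= ?lG; case: s1.
case: u hu => // a u hu; rewrite e // dG //.
by rewrite wd_inl.
Qed.

(** Zero is a default value: f is a cochain in all uses. *)
Definition to_cochain q (f : seq (letter A) -> K^o) : cyc_cochain A q :=
  if pselect (f \in submod_pred (is_cyc_cochain_submod A q)) is left h
  then Sub f h else 0.

Lemma to_cochainE q f : is_cyc_cochain q f -> val (to_cochain q f) = f.
Proof.
rewrite /to_cochain; case: pselect => // h h'; exfalso; apply: h; exact/asboolP.
Qed.

(** It depends on the class only, by [HatC_cls], and determines it, by
    [HatC_inj]; all identities in Cyc are proved on these functions. *)
Definition HatC p (x : Cyc A p) : word -> K := Hat (val (repr x)).

Lemma HatC_cochain p (x : Cyc A p) : cyclic_cochain p (HatC x).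
Proof. exact: (Hat_cochain d (cyc_cochainP (repr x))). Qed.

Lemma plain_HatC p (x : Cyc A p) : plain (HatC x).
Proof. exact: plain_Hat. Qed.

Lemma HatC_cls p (f : cyc_cochain A p) w : HatC (cyc_cls f) w = Hat (val f) w.
Proof.
move: w; apply: plain_ext; [exact: plain_Hat|exact: plain_Hat|move=> u].
by rewrite /HatC !HatE; apply: cycsum_cls; rewrite /cyc_cls cls_repr.
Qed.

Lemma HatC_lin p c (x y : Cyc A p) w :
  HatC (c *: x + y) w = c * HatC x w + HatC y w.
Proof.
have -> : c *: x + y = cyc_cls (c *: repr x + repr y).
  by rewrite /cyc_cls linearP /= !cls_repr.
rewrite HatC_cls -Hat_lin.
have -> : val (c *: repr x + repr y) = c *: val (repr x) + val (repr y) by exact: linearP.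
by [].
Qed.

Lemma HatC0 p w : HatC (0 : Cyc A p) w = 0.
Proof. by have := HatC_lin (-1) (0 : Cyc A p) 0 w; rewrite scaler0 add0r mulN1r addNr. Qed.

Lemma HatC_inj p (x y : Cyc A p) : char0 K ->
  (forall u, HatC x (map inl u) = HatC y (map inl u)) -> x = y.
Proof.
move=> ch0 e; rewrite -(cls_repr x) -(cls_repr y); apply: cyc_cls_inj => // u.
by have := e u; rewrite /HatC !HatE.
Qed.

Definition rep (x : letter (Cyc A)) : label := Tagged (cyc_cochain A) (repr (tagged x)).

Definition hat (x : letter (Cyc A)) : pcoch := hatp (rep x).

Lemma hat_cls (x : label) : hat (letter_cls x) = hatp x.
Proof. by apply: pcoch_eq => // w; exact: HatC_cls. Qed.

Lemma jdegE p (fs : seq pcoch) : jdeg p fs = p + wd_of edl fs.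
Proof.
elim: fs p => [|f fs IH] p; first by rewrite addr0.
by rewrite /= IH wd_cons /edl; ring.
Qed.

Lemma wd_edl (V : int -> lmodType K) (f : letter V -> pcoch) (s : seq (letter V)) :
  (forall x, pdeg (f x) = tag x) ->
  wd_of edl (map f s) = vdeg s - (size s)%:Z * d.
Proof.
move=> hf; elim: s => [|x s IH]; first by rewrite /vdeg big_nil mul0r subr0.
rewrite /= wd_cons IH /edl hf /vdeg big_cons -addn1 PoszD; ring.
Qed.

Lemma dec_map (V W : int -> lmodType K) (f : letter V -> letter W) s :
  (forall x, tag (f x) = tag x) -> dec d (map f s) = dec d s.
Proof. by move=> hf; elim: s => //= x s ->; rewrite size_map hf. Qed.

Lemma cdeg_map (V W : int -> lmodType K) (f : letter V -> letter W) s :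
  (forall x, tag (f x) = tag x) -> cdeg d (map f s) = cdeg d s.
Proof.
move=> hf; rewrite /cdeg size_map /vdeg big_map.
by congr (_ + _); apply: eq_bigr => x _; exact: hf.
Qed.

Section Structure.
Hypothesis ch0 : char0 K.
Variables (mu : seq (letter A) -> forall q, A q) (F : C_cochain A D D).
Let Phi : word -> K := ceval (val F).

Hypothesis F_mu : forall u xi,
  Phi (rcons (map inl u) (inr xi)) = dfun xi (Tagged A (mu u (wdeg u + 2))).
Hypothesis F_MC : forall w, ceval (insertion D D D (val F) (val F)) w = 0 :> K.

Lemma C_cochainP p (G : C_cochain A D p) : is_C_cochain D p (val G).
Proof. exact/asboolP/(valP G). Qed.

Let cPhi : cyclic_cochain D Phi := ceval_cochain (C_cochainP F).
Let MC : forall w, bul D Phi Phi w = 0 := ceval_MC (C_cochainP F) F_MC.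

(** The structure has no component without outputs. *)
Lemma Phi_plain w : restr Phi w = 0.
Proof.
move: w; apply: plain_ext => [||u]; [exact: plain_restr|by []|].
rewrite /restr all_is_input; case: u => [|x u]; last exact: ceval_plain.
by rewrite /Phi /ceval /cyc_of big_ord0.
Qed.

(** The Hochschild differential is the insertion in mu, the component of Phi with
    one output. *)
Lemma hochschild_insert p (f : cyc_cochain A p) u : u <> [::] ->
  hochschild mu p (val f) u = insert p Phi (Hat (val f)) (map inl u).
Proof.
have cf := Hat_cochain d (cyc_cochainP f).
case: u => // a u _; rewrite /hochschild; set w := a :: u.
rewrite /insert cutsum_map /GRing.scale /= mulr_sumr; apply: eq_bigr => i _.
rewrite F_mu (dlE (coch_lin cf) (coch_deg cf)) -[_ :: map _ _]/(map inl (_ :: _)) HatE.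
rewrite wd_inl mulrA -ksgnD; congr (_ * _); apply: ksgn_eq.
by rewrite /ideg /=; parity_cases.
Qed.

Lemma hochschild_cochain p (f : cyc_cochain A p) :
  is_cyc_cochain (p + 1) (hochschild mu p (val f)).
Proof.
have cf := Hat_cochain d (cyc_cochainP f).
apply: cochain_of (hochschild_insert f) => //.
  exact: mlin_insert cPhi (coch_lin cf) (coch_deg cf).
move=> w hw; apply: (insert_deg _ cPhi).
by apply: contra_neq hw => e; lia.
Qed.

Definition delta_mu p (x : Cyc A p) : Cyc A (p + 1) :=
  cyc_cls (to_cochain (p + 1) (hochschild mu p (val (repr x)))).

Lemma HatC_delta_mu p (x : Cyc A p) u :
  HatC (delta_mu x) (map inl u) = bul p Phi (HatC x) (map inl u).
Proof.
rewrite /delta_mu HatC_cls to_cochainE; last exact: hochschild_cochain.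
exact: Hat_of (hochschild_insert (repr x)) u.
Qed.

Lemma delta_mu_linear p : linear (@delta_mu p).
Proof.
move=> c x y; apply: (HatC_inj ch0) => u; rewrite HatC_lin !HatC_delta_mu.
apply: (bul_linr _ cPhi).
- exact: HatC_cochain.
- exact: HatC_cochain.
- exact: HatC_cochain.
by move=> w; exact: HatC_lin.
Qed.

HB.instance Definition _ p := GRing.isLinear.Build K (Cyc A p) (Cyc A (p + 1)) *:%R
  (@delta_mu p) (@delta_mu_linear p).

Definition delta_muL p : {linear Cyc A p -> Cyc A (p + 1)} := @delta_mu p.

Lemma delta_mu_hochschild : is_hochschild_differential mu delta_muL.
Proof.
move=> p f; exists (to_cochain (p + 1) (hochschild mu p (val f))); last first.
  by move=> w; rewrite to_cochainE //; exact: hochschild_cochain.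
rewrite /delta_muL /= /delta_mu; congr (cyc_cls (to_cochain _ _)); apply/funext => -[|a u] //.
have e : Hat (val (repr (cyc_cls f))) = Hat (val f).
  by apply/funext => w; exact: HatC_cls.
by rewrite !hochschild_insert // e.
Qed.

(** The contraction up to its decalage sign, as a function on words. *)
Definition mean_arcs (fs : seq pcoch) w : K :=
  (size fs)%:R^-1 * Psum hdeg fs (fun t => arcs t 0 Phi w).

Lemma mlin_mean_arcs fs : mlin (mean_arcs fs).
Proof.
move=> s1 s2 i c x y; rewrite /mean_arcs mulrCA -mulrDr; congr (_ * _).
rewrite -PsumZ -PsumD; apply: eq_Psum => t _; exact: (mlin_arcs cPhi t 0 [::]).
Qed.

Lemma mean_arcs_deg fs w : wd w + jdeg D fs != 0 -> mean_arcs fs w = 0.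
Proof.
move=> hw; rewrite /mean_arcs -[RHS](mulr0 (size fs)%:R^-1) -(Psum0 K hdeg fs).
congr (_ * _); apply: (@eq_Psum_wd K pcoch hdeg edl) => t _ et; apply: (arcs_deg cPhi).
by move: hw; rewrite jdegE et addrA addrAC.
Qed.

(** The factor 1/n compensates for the n readings of each configuration. *)
Lemma cyc_mean_arcs fs w : (0 < size fs)%N -> cyc w (mean_arcs fs) = J Phi fs w.
Proof.
case: fs => // f fs _; rewrite /mean_arcs cycZ (cyc_arcs _ _ _ cPhi ch0) mulKf //.
exact: ch0.
Qed.

Lemma contraction_mean_arcs (fs : seq label) u : u <> [::] ->
  contraction d (val F) fs u = ksgn K (dec d fs) * mean_arcs (map hatp fs) (map inl u).
Proof.
move=> hu; rewrite (@contractionE K d A _ _ _ hu) /mean_arcs size_map mulrCA.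
rewrite (Psum_map (h1 := @ldeg K d (cyc_cochain A))) //.
Qed.

Lemma contraction_cochain fs :
  is_cyc_cochain (cdeg d fs) (contraction d (val F) fs).
Proof.
apply: (@cochain_of _ (fun w => ksgn K (dec d fs) * mean_arcs (map hatp fs) w)).
- by move=> s1 s2 i c x y; rewrite mlin_mean_arcs mulrDr mulrCA.
- move=> w hw; rewrite mean_arcs_deg ?mulr0 // jdegE wd_edl //.
  by move: hw; rewrite /cdeg; apply: contra_neq => e; lia.
- by [].
exact: contraction_mean_arcs.
Qed.

Lemma pdeg_hat x : pdeg (hat x) = tag x. Proof. by []. Qed.

(** Zero in arity at most one, and in degrees other than that of c_n. *)
Definition cyc_op (s : seq (letter (Cyc A))) q : Cyc A q :=
  if (1 < size s)%N && (q == cdeg d s)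
  then cyc_cls (to_cochain q (contraction d (val F) (map rep s))) else 0.

(** The operations are the derived brackets of Phi, up to decalage. *)
Lemma HatC_cyc_op s q u : (1 < size s)%N -> q = cdeg d s ->
  HatC (cyc_op s q) (map inl u) = ksgn K (dec d s) * J Phi (map hat s) (map inl u).
Proof.
move=> hs ->; rewrite /cyc_op hs eqxx HatC_cls.
have eq : cdeg d (map rep s) = cdeg d s by exact: cdeg_map.
rewrite -eq to_cochainE; last exact: contraction_cochain.
rewrite (Hat_of (G := fun w => ksgn K (dec d (map rep s))
  * mean_arcs (map hatp (map rep s)) w)); last exact: contraction_mean_arcs.
rewrite cycZ cyc_mean_arcs ?size_map ?(ltnW hs) // dec_map // -map_comp.
by [].
Qed.

Lemma J_scale c f g fs w : pdeg g = pdeg f -> (forall w, f w = c * g w) ->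
  J Phi (f :: fs) w = c * J Phi (g :: fs) w.
Proof.
move=> e1 e; rewrite (@J_linr _ d A _ _ (c - 1) f g g fs w cPhi) //.
  by ring.
by move=> v; rewrite e; ring.
Qed.

Lemma J_permute (V : int -> lmodType K) (lab : letter V -> pcoch) s
    (sigma : 'S_(size s)) p (Psi : word -> K) w :
  (forall x, pdeg (lab x) = tag x) -> cyclic_cochain p Psi ->
  ksgn K (shuffled_sign d sigma) * J Psi (map lab (permute sigma)) w
  = ksgn K (dec d s) * J Psi (map lab s) w.
Proof.
move=> hlab; elim: s p Psi sigma => [|x s IH] p Psi sigma cPsi.
  by have [-> ->] := shuffled_sign_nil d sigma.
have [g _ gK] := lift_perm_bij (size s).
rewrite -(gK sigma); case: (g sigma) => j tau.
rewrite -[lift_perm _ _ _]/(lift_perm j ord0 tau) permute_lift map_cat.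
rewrite -[map lab (_ :: _)]/(lab x :: map lab _) (J_move _ _ _ _ cPsi) -map_cat cat_take_drop.
rewrite -[dec d (x :: s)]/(d * (size s)%:Z * tag x + dec d s) (ksgnD K (_ * _)) -[RHS]mulrA.
rewrite -[J Psi (map lab (x :: s)) w]/(J (bul (pdeg (lab x)) Psi (lab x)) (map lab s) w).
rewrite -(IH _ _ tau (cyclic_cochain_bul cPsi (pcochP (lab x)) (@pcoch_plain _ _ _ (lab x)))).
rewrite !mulrA -!ksgnD; congr (_ * _); apply: ksgn_eq.
rewrite (parityD _ (_ * wd_of _ _)) shuffled_sign_lift (wd_map (h1 := @ldeg K d V)).
  by rewrite /hdeg hlab /ldeg !parityD addbK.
by move=> y; rewrite /hdeg hlab.
Qed.

Lemma hat_permute s (sigma : 'S_(size s)) w :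
  ksgn K (dec d (permute sigma)) * J Phi (map hat (permute sigma)) w
  = ksgn K (perm_sign d sigma) * (ksgn K (dec d s) * J Phi (map hat s) w).
Proof.
rewrite -(J_permute sigma w pdeg_hat cPhi) mulrA -ksgnD; congr (_ * _).
by apply: ksgn_eq; rewrite /shuffled_sign !parityD addKb.
Qed.

Lemma cyc_op_contraction pi : C_cls F = pi -> is_contraction pi cyc_op.
Proof.
move=> eF G eG fs hfs; set fs' := map rep (map (@letter_cls K A) fs).
have efs : map hatp fs' = map hatp fs.
  by rewrite /fs' -!map_comp; apply: eq_map => x; exact: hat_cls.
have esz : size fs' = size fs by rewrite !size_map.
have edec : dec d fs' = dec d fs by rewrite /fs' -map_comp dec_map.
have ecdeg : cdeg d fs' = cdeg d fs by rewrite /fs' -map_comp cdeg_map.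
have eG' : ceval (val G) = Phi.
  by apply/funext => w; apply: ceval_cls; rewrite eG eF.
have e : contraction d (val G) fs = contraction d (val F) fs'.
  apply/funext => -[|a u] //.
  rewrite [RHS]contraction_mean_arcs // efs edec (@contractionE K d A) // eG' /mean_arcs size_map.
  by rewrite mulrCA (Psum_map (h1 := @ldeg K d (cyc_cochain A))).
exists (to_cochain (cdeg d fs) (contraction d (val F) fs')).
  rewrite /cyc_op size_map hfs (@cdeg_map _ (Cyc A)) ?eqxx //.
by move=> w; rewrite e to_cochainE // -ecdeg; exact: contraction_cochain.
Qed.

Lemma cyc_op_multilinear q : multilinear (fun s => cyc_op s q).
Proof.
move=> s1 s2 i c x y; set sz := s1 ++ _.
have e (z : Cyc A i) : size (s1 ++ Tagged (Cyc A) z :: s2) = size sz /\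
    cdeg d (s1 ++ Tagged (Cyc A) z :: s2) = cdeg d sz.
  by rewrite /cdeg /vdeg !size_cat /= !big_cat /= !big_cons.
have [h|] := boolP ((1 < size sz)%N && (q == cdeg d sz)); last first.
  move=> /negbTE h; rewrite /cyc_op h; have [-> ->] := e x; have [-> ->] := e y.
  by rewrite h scaler0 addr0.
case/andP: h => hs /eqP hq; apply: (HatC_inj ch0) => u; rewrite HatC_lin.
rewrite HatC_cyc_op // (HatC_cyc_op _ (s := s1 ++ Tagged (Cyc A) x :: s2)); last 2 first.
- by have [-> _] := e x.
- by have [_ ->] := e x.
rewrite (HatC_cyc_op _ (s := s1 ++ Tagged (Cyc A) y :: s2)); last 2 first.
- by have [-> _] := e y.
- by have [_ ->] := e y.
have edec (z : Cyc A i) : dec d (s1 ++ Tagged (Cyc A) z :: s2) = dec d sz.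
  by rewrite /sz; elim: (s1) => //= t s ->; rewrite !size_cat.
rewrite !edec mulrCA -mulrDr; congr (_ * _); rewrite /sz !map_cat /=.
rewrite !(J_move _ _ _ _ cPhi) mulrCA -mulrDr; congr (_ * _).
by apply: (J_linr _ _ cPhi) => // w; exact: HatC_lin.
Qed.

Local Notation JP := (Jp cPhi).

Lemma restr_inl (f : word -> K) u : restr f (map inl u) = f (map inl u).
Proof. by rewrite /restr all_is_input. Qed.

(** The component of Phi without outputs is zero, so the unshuffles with S empty
    do not contribute to the relation. *)
Lemma J_none fs w : J Phi (JP [::] :: fs) w = 0.
Proof.
rewrite (@J_scale 0 _ (JP [::])) ?mul0r // => v.
by rewrite mul0r; exact: Phi_plain.
Qed.

Lemma J_hat_delta_mu p (x : Cyc A p) fs w :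
  J Phi (hat (Tagged (Cyc A) (delta_mu x)) :: fs) w
  = J Phi (JP [:: hat (Tagged (Cyc A) x)] :: fs) w.
Proof.
rewrite -[RHS]mul1r; apply: J_scale => [|v]; first by rewrite /=; ring.
rewrite mul1r; move: v; apply: plain_ext => [||u]; [exact: plain_HatC|exact: plain_restr|].
exact: etrans (HatC_delta_mu x u) (esym (restr_inl _ u)).
Qed.

Lemma J_hat_cyc_op s fs w : (1 < size s)%N ->
  J Phi (hat (Tagged (Cyc A) (cyc_op s (cdeg d s))) :: fs) w
  = ksgn K (dec d s) * J Phi (JP (map hat s) :: fs) w.
Proof.
move=> hs; apply: J_scale => [|v]; first by rewrite /= jdegE wd_edl // /cdeg; ring.
pose g w := ksgn K (dec d s) * restr (J Phi (map hat s)) w.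
move: v; apply: (plain_ext (g := g)) => [|a xi b|u]; first exact: plain_HatC.
  by rewrite /g plain_restr mulr0.
by rewrite [LHS]HatC_cyc_op // /g restr_inl.
Qed.

(** The relation [maurer_cartan_relation] for one entry. *)
Lemma delta_mu_complex : is_complex delta_muL.
Proof.
move=> p x; apply: (HatC_inj ch0) => u; rewrite HatC0.
have := maurer_cartan_relation cPhi _ MC [:: hat (Tagged (Cyc A) x)] (ch0 1)
  (all_is_input d u).
set f := hat _; set v := map inl u; move=> h.
have {}h : J Phi [:: JP [:: f]] v + ksgn K (hdeg f * 0) * J Phi [:: JP [::]; f] v = 0.
  by apply: h; rewrite !parityD; case: (parity d).
by rewrite J_none mulr0 addr0 -J_hat_delta_mu in h; rewrite -[RHS]h; exact: HatC_delta_mu.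
Qed.

(** The term of the relation for the unshuffle which moves S to the front. *)
Definition subset_term s u (S : {set 'I_(size s)}) : K :=
  ksgn K (split_sign d S)
  * J Phi (JP (map hat (subseq_at S)) :: map hat (subseq_at (~: S))) (map inl u).

Lemma sum_subset_term s u : \sum_(S : {set 'I_(size s)}) subset_term u S = 0.
Proof.
rewrite (sum_subsets d s (fun S T => J Phi (JP (map hat S) :: map hat T) (map inl u))).
rewrite -(Msum_map (f := hat) (h2 := hdeg) _ s (fun S T => J Phi (JP S :: T) (map inl u))) //.
rewrite (maurer_cartan_relation cPhi _ MC _ (ch0 1) (all_is_input d u)) ?mulr0 //.
by rewrite !parityD; case: (parity d).
Qed.

Lemma subset_term0 s u : subset_term u (set0 : {set 'I_(size s)}) = 0.
Proof.
have -> : set0 = ~: [set: 'I_(size s)] by rewrite setCT.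
rewrite /subset_term (_ : subseq_at (~: setT) = [::]) ?J_none ?mulr0 //.
by apply: size0nil; rewrite size_subseq_at setCT cards0.
Qed.

(** For 1 < #|S| < n, this is a composition of two operations. *)
Lemma subset_term_mid s u (S : {set 'I_(size s)}) : (1 < #|S| < size s)%N ->
  subset_term u S = ksgn K (d * (#|S| * (size s - #|S|))%N%:Z + unshuffle_sign d S)
    * HatC (cyc_op (Tagged (Cyc A) (cyc_op (subseq_at S) (cdeg d (subseq_at S)))
                 :: subseq_at (~: S)) (cdeg d s + 1)) (map inl u).
Proof.
case/andP=> S1 Sn; have sS := size_subseq_at S.
have sT : (size (subseq_at (~: S)) = size s - #|S|)%N.
  by rewrite size_subseq_at cardsCs setCK card_ord.
have eV : vdeg s = vdeg (subseq_at S) + vdeg (subseq_at (~: S)).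
  rewrite /vdeg -!(sum_subseq_at _ (fun x => tag x)) (big_nth (letter0 (Cyc A))) big_mkord.
  by rewrite (bigID (mem S)) /=; congr (_ + _); apply: eq_bigl => i; rewrite inE.
have szE : (size s)%:Z = #|S|%:Z + (size s - #|S|)%N%:Z by rewrite -PoszD subnKC // ltnW.
rewrite HatC_cyc_op; last 2 first.
- by rewrite /= sT ltnS subn_gt0.
- by rewrite /cdeg /vdeg big_cons -/(vdeg _) /= sT sS eV szE -addn1 PoszD; ring.
rewrite [map hat (_ :: _)]/= [dec d (_ :: _)]/= J_hat_cyc_op ?sS //.
rewrite /subset_term mulrA mulrA -!ksgnD.
congr (_ * _); apply: ksgn_eq; rewrite /split_sign sT /cdeg sS.
have -> : wd_of (@tdeg K (Cyc A)) (subseq_at S) = vdeg (subseq_at S) by rewrite wd_sum.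
set vS := vdeg _; rewrite !parityD !parityM !parityD !parityN !parityM !parity_nat oddM.
by case: (odd #|S|); case: (odd (size s - #|S|)); parity_cases.
Qed.

(** For S = [n], it is the differential of the operation. *)
Lemma subset_termT s u : (1 < size s)%N ->
  subset_term u [set: 'I_(size s)]
  = HatC (delta_mu (cyc_op s (cdeg d s))) (map inl u).
Proof.
move=> hs; rewrite /subset_term subseq_at_setT setCT subseq_at_set0 HatC_delta_mu.
rewrite -[RHS]/(J Phi [:: hat (Tagged (Cyc A) (cyc_op s (cdeg d s)))] (map inl u)).
rewrite J_hat_cyc_op //; congr (ksgn K _ * _).
rewrite /split_sign setCT subseq_at_set0 subseq_at_setT /unshuffle_sign setCT big_set0.
by rewrite /= mulr0 mul0r !addr0 add0r.
Qed.

(** For S = {i}, it is the operation with the differential on the i-th entry. *)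
Lemma subset_term1 s u (i : 'I_(size s)) : (1 < size s)%N ->
  let x := nth (letter0 (Cyc A)) s i in
  subset_term u [set i]
  = ksgn K (d * (size s).-1%:Z + vdeg (take i s))
    * HatC (cyc_op (set_nth (letter0 (Cyc A)) s i (Tagged (Cyc A) (delta_mu (tagged x))))
                (cdeg d s + 1)) (map inl u).
Proof.
move=> hs x; have [e1 e2 e3] := subseq_at_set1 d i.
set y := Tagged (Cyc A) (delta_mu (tagged x)).
have ss : s = take i s ++ x :: drop i.+1 s.
  by rewrite -drop_nth ?cat_take_drop.
have [a [b [ea eb]]] : exists a b, a = take i s /\ b = drop i.+1 s.
  by exists (take i s), (drop i.+1 s).
have szs : (size s = size a + (size b).+1)%N by rewrite {1}ss size_cat -ea -eb.
have sza : nat_of_ord i = size a by rewrite ea size_takel // ltnW.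
have -> : set_nth (letter0 (Cyc A)) s i y = a ++ y :: b.
  by rewrite set_nthE ltn_ord ea eb.
rewrite HatC_cyc_op; last 2 first.
- by rewrite size_cat /= -szs.
- rewrite /cdeg size_cat /= -szs {1}ss -ea -eb /vdeg !big_cat !big_cons /=; ring.
have -> : map hat (a ++ y :: b) = map hat a ++ hat y :: map hat b by rewrite map_cat.
rewrite (J_move _ _ _ _ cPhi) J_hat_delta_mu -map_cat.
have -> : hat (Tagged (Cyc A) (tagged x)) = hat x by case: (x).
rewrite /subset_term /split_sign e1 e2 -/x -ea -eb !mulrA -!ksgnD; congr (_ * _).
apply: ksgn_eq; rewrite !parityD e3 (wd_map (h1 := @ldeg K d (Cyc A))) //.
rewrite -/x -ea sza parity_dec_insert wd_cons wd_nil addr0.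
rewrite -[tdeg x]/(tag x) -[tag y]/(tag x + 1) -[hdeg (hat y)]/(d + (tag x + 1)).
have -> : vdeg a = wd_of (@tdeg K (Cyc A)) a by rewrite wd_sum.
rewrite szs size_cat !(parityD, parityM, parity_nat) parity_hd addnS /= oddD ?andbF ?addbF.
by case: (parity d); case: (odd (size a)); case: (odd (size b)); parity_cases.
Qed.

Lemma HatC_sum p (I : Type) (r : seq I) (P : pred I) (f : I -> Cyc A p) w :
  HatC (\sum_(i <- r | P i) f i) w = \sum_(i <- r | P i) HatC (f i) w.
Proof.
elim: r => [|i r IH]; first by rewrite !big_nil HatC0.
rewrite !big_cons; case: ifP => // _; rewrite -IH -[f i]scale1r HatC_lin.
by rewrite mul1r scale1r.
Qed.

Lemma HatC_Z p c (x : Cyc A p) w : HatC (c *: x) w = c * HatC x w.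
Proof. by rewrite -[c *: x]addr0 HatC_lin HatC0 addr0. Qed.

Lemma HatC_B p (x y : Cyc A p) w : HatC (x - y) w = HatC x w - HatC y w.
Proof. by rewrite addrC -scaleN1r HatC_lin mulN1r addrC. Qed.

Lemma sum_set1 n (E : {set 'I_n} -> K) :
  \sum_(S : {set 'I_n} | #|S| == 1%N) E S = \sum_(i < n) E [set i].
Proof.
rewrite -(big_imset E (h := fun i => [set i]) (A := 'I_n)) /=; last first.
  by move=> i j _ _; exact: set1_inj.
apply: eq_bigl => S; apply/idP/imsetP => [/cards1P[i ->]|[i _ ->]]; last by rewrite cards1.
by exists i.
Qed.

(** The relation [sum_subset_term] is split according to the size of S. *)
Lemma cyc_op_Holie : is_Holie d delta_muL cyc_op.
Proof.
split.
- exact: cyc_op_multilinear.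
- by move=> s q h; rewrite /cyc_op (negbTE h) andbF.
- move=> s q sigma; have ss := size_permute sigma.
  have cs : cdeg d (permute sigma) = cdeg d s.
    rewrite /cdeg ss; congr (_ + _); rewrite /vdeg big_map big_enum /=.
    rewrite (big_nth (letter0 (Cyc A))) big_mkord.
    by rewrite [RHS](reindex_inj (@perm_inj _ sigma)).
  rewrite /cyc_op ss cs; case: ifP => [/andP[hs /eqP hq]|_]; last by rewrite scaler0.
  have -> : cyc_cls (to_cochain q (contraction d (val F) (map rep (permute sigma))))
      = cyc_op (permute sigma) q by rewrite /cyc_op ss cs hs hq eqxx.
  have -> : cyc_cls (to_cochain q (contraction d (val F) (map rep s))) = cyc_op s q.
    by rewrite /cyc_op hs hq eqxx.
  apply: (HatC_inj ch0) => u; rewrite HatC_Z !HatC_cyc_op ?ss ?cs //.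
  exact: hat_permute.
move=> s hs n q; apply: (HatC_inj ch0) => u.
rewrite HatC_B -subset_termT // HatC_Z HatC_sum -scaleN1r HatC_Z HatC_sum.
rewrite mulN1r; apply/eqP; rewrite -subr_eq0 opprK; apply/eqP.
rewrite -[RHS](sum_subset_term s u).
rewrite [RHS](bigID (fun S : {set 'I_(size s)} => 1 < #|S| < n)%N) /= addrC.
congr (_ + _); last first.
  by apply: eq_bigr => S hS; rewrite HatC_Z subset_term_mid.
rewrite [RHS](bigD1 setT) /=; last by rewrite cardsT card_ord ltnn andbF.
congr (_ + _); rewrite mulr_sumr -sumrN.
rewrite [RHS](bigD1 set0) /=; last first.
  by rewrite cards0 /= -subTset subset0 -cards_eq0 cardsT card_ord -lt0n ltnW.
rewrite subset_term0 add0r.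
transitivity (\sum_(i < n) subset_term u [set i]).
  apply: eq_bigr => i _; rewrite HatC_Z subset_term1 // -mulrN ksgnN1 !mulrA -!ksgnD.
  have e : odd n = ~~ odd n.-1 by rewrite /n; case: (size s) hs.
  congr (_ * _); apply: ksgn_eq; rewrite -/n !(parityD, parityM, parityN, parity_nat) e.
  by case: (parity d); case: (odd n.-1); case: (parity (vdeg _)).
rewrite -(sum_set1 (subset_term u)); apply: eq_bigl => S.
have cSn : (#|S| <= n)%N by rewrite -[n]card_ord max_card.
have -> : (S != setT) = (#|S| != n).
  by rewrite eqEcard subsetT /= cardsT card_ord -ltnNge ltn_neqAle cSn andbT.
rewrite -cards_eq0.
by case: (#|S|) cSn hs => [|[|k]] //; rewrite -/n; lia.
Qed.

End Structure.

End HolieStructure.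

Theorem mainTheorem2 (K : fieldType) (charK0 : [pchar K] =i pred0) (d : int)
    (A : int -> lmodType K)
    (mu : seq (letter A) -> forall q, A q) (mu_Ainf : is_Ainfinity mu)
    (pi : C A (d + 1) (d + 1)) (pi_preCY : is_preCY pi)
    (pi_ext : preCY_extends mu pi) :
  exists (delta : forall p, {linear Cyc A p -> Cyc A (p + 1)})
         (c : seq (letter (Cyc A)) -> forall q, Cyc A q),
    [/\ is_hochschild_differential mu delta, is_complex delta,
        is_contraction pi c & is_Holie d delta c].
Proof.
have ch0 : char0 K by move=> n; move/pcharf0P: charK0 => ->.
have [F piF [H H0 bFF]] := pi_preCY; have [F' piF' F'mu] := pi_ext.
have F_mu u (xi : dual d A) : ceval (val F) (rcons (map inl u) (inr xi))
    = dfun xi (Tagged A (mu u (wdeg u + 2))) :> K.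
  rewrite (@ceval_cls K d A _ F F') ?piF ?piF' // ceval_output F'mu.
  by rewrite tpair_pure /= mulr1.
(* The two halves of the bracket agree, D + D * D being even. *)
have bracketE ws : val H ws = 2 *: insertion (d + 1) (d + 1) (d + 1) (val F) (val F) ws.
  rewrite bFF /bracket (_ : ksgn K _ = 1) ?scale1r ?scaler_nat //.
  rewrite -(ksgn0 K); apply: ksgn_eq; rewrite parityD parityM.
  by case: (parity _).
have F_MC (w : seq (letterE d A)) :
    ceval (insertion (d + 1) (d + 1) (d + 1) (val F) (val F)) w = 0 :> K.
  have zE (v : seq (letterE d A)) : ceval (fun _ => 0 : tens A) v = 0 :> K.
    have := ceval_lin (-1) (fun _ => 0 : tens A) (fun _ => 0) v.
    rewrite mulN1r addNr => <-; congr (ceval _ v); apply/funext => us.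
    by rewrite scaler0 addr0.
  have : ceval (val H) w = 0 :> K.
    by rewrite (@ceval_cls K d A _ H 0) ?zE // H0 /C_cls linear0.
  rewrite (_ : val H = fun us =>
    2 *: insertion (d + 1) (d + 1) (d + 1) (val F) (val F) us + 0); last first.
    by apply/funext => us; rewrite bracketE addr0.
  rewrite ceval_lin zE addr0 => /eqP; rewrite mulf_eq0 (negbTE (ch0 1)) /=.
  by move/eqP.
exists (delta_muL ch0 F_mu), (cyc_op F); split.
- exact: delta_mu_hochschild.
- exact: delta_mu_complex.
- exact: cyc_op_contraction.
exact: cyc_op_Holie.
Qed.
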